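(* The solution $(P,Q,R,\xi^* )$ to the limit problem is uniquely determined by the initial data $P(0,\cdot)$ and $\xi^*(0)$; that is, if $(P_1,Q_1,R_1,\xi_1^* )$ and $(P_2,Q_2,R_2,\xi_2^* )$ are two solutions of the limit problem with $P_1(0,\cdot)=P_2(0,\cdot)$ and $\xi^*_1(0)=\xi^*_2(0)$, then $(P_1,Q_1,R_1,\xi_1^* )=(P_2,Q_2,R_2,\xi_2^* )$.
   Context: Fix $0<\tau_{\rm fin}<\infty$, $I=[0,\tau_{\rm fin}]$, $\Omega=I\times\mathbb{R}$, and let $\operatorname{sgn}u=-1$ for $u<0$, $\operatorname{sgn}u=+1$ for $u\ge0$. A solution of the limit problem is a quadruple $(P,Q,R,\xi^* )$ with $\xi^*:I\to\mathbb{R}$ and $P,Q,R:\Omega\to\mathbb{R}$ such that: 1. $\xi^*$ is Lipschitz continuous, so $\Xi^*:=\{(\tau,\xi^*(\tau)):\tau\in I\}$ is a Lipschitz curve in $\Omega$; $Q$, $R$ and $P=Q+R$ are bounded and locally Hölder continuous in $\Omega$; furthermore $R\in L^\infty(I;L^1(\mathbb{R}))$ and $\partial_\xi R\in L^\infty(I;L^2(\mathbb{R}))$. 2. $Q$ is a solution of the heat equation $\partial_\tau Q=\partial_\xi^2Q$ in $\Omega$ with initial data $P(0,\cdot)$. 3. $(P,\xi^* )$ is a distributional solution of $$\partial_\tau P=\partial_\xi^2P\ \text{ in }\Omega\setminus\Xi^*,\qquad [\![P]\!]=0\ \text{ and }\ 2\,\tfrac{\mathrm d}{\mathrm d\tau}\xi^*=[\![\partial_\xi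 P]\!]\ \text{ on }\Xi^*$$ ($[\![\cdot]\!]$ denoting the jump across $\Xi^*$), with initial data $(P(0,\cdot),\xi^*(0))$ attained in $L^\infty(\mathbb{R})\times\mathbb{R}$. Being a distributional solution means $$-\int_0^{\tau_{\rm fin}}\!\!\int_{\mathbb{R}}(P+\mu)\,\partial_\tau\psi\,\mathrm d\xi\,\mathrm d\tau=\int_0^{\tau_{\rm fin}}\!\!\int_{\mathbb{R}}P\,\partial_\xi^2\psi\,\mathrm d\xi\,\mathrm d\tau\qquad\text{for all }\psi\in C^\infty_c((0,\tau_{\rm fin})\times\mathbb{R}),$$ where $\mu(\tau,\xi)=\operatorname{sgn}(\xi^*(\tau)-\xi)$. Moreover, $P(\tau,\xi)\ge-1$ for all $(\tau,\xi)\in\Omega$ and $P(\tau,\xi)\le1$ if $\xi\ge\xi^*(\tau)$ (hence $P\in[-1,1]$ on $\Xi^*$), and $$\tfrac{\mathrm d}{\mathrm d\tau}\xi^*(\tau)\ge0\ \text{ for almost all }\tau\in I,\qquad \tfrac{\mathrm d}{\mathrm d\tau}\xi^*(\tau)=0\ \text{ if }P(\tau,\xi^*(\tau))\ne1 .$$ *)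

(* Defs.v *)
From mathcomp Require Import all_boot all_order all_algebra.
From mathcomp Require Import all_classical all_reals all_analysis.

Set Implicit Arguments.
Unset Strict Implicit.
Unset Printing Implicit Defensive.
Import Order.TTheory GRing.Theory Num.Theory.
Import numFieldNormedType.Exports.
Local Open Scope classical_set_scope.
Local Open Scope ring_scope.

Section limit_problem.
Context {R : realType}.
Variable taufin : R.
Notation mu := (@lebesgue_measure R).

Definition timeI : set R := `[0, taufin].

Definition Omega : set (R * R) := timeI `*` [set: R].

Definition Omega_int : set (R * R) := `]0, taufin[ `*` [set: R].

Definition d_tau (f : R * R -> R) : R * R -> R := 'D_(1, 0) f.

Definition d_xi (f : R * R -> R) : R * R -> R := 'D_(0, 1) f.

(* Unlike [Num.sg], this sign is +1 at the origin. *)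
Definition sgn (u : R) : R := if u < 0 then -1 else 1.

Fixpoint Ck (n : nat) (f : R * R -> R) : Prop :=
  continuous f /\
  if n is m.+1 then
    [/\ (forall z, derivable f z (1, 0)), (forall z, derivable f z (0, 1)),
        Ck m (d_tau f) & Ck m (d_xi f)]
  else True.

(* C^oo functions whose support is a compact subset of (0, taufin) x R. *)
Definition test_function (psi : R * R -> R) : Prop :=
  [/\ forall n, Ck n psi,
      compact (closure [set z | psi z != 0]) &
      closure [set z | psi z != 0] `<=` Omega_int].

Definition integral_Omega (f : R * R -> R) : R :=
  (\int[mu]_(t in timeI) \int[mu]_x f (t, x))%R.

Definition locally_hoelder (f : R * R -> R) : Prop :=
  forall K : set (R * R), compact K -> K `<=` Omega ->
  exists alpha C : R, [/\ 0 < alpha, alpha <= 1 &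
    forall z w, K z -> K w -> `|f z - f w| <= C * `|z - w| `^ alpha].

(* The space L^oo(I; L^p(R)), through jointly measurable representatives. *)
Definition Linfty_Lp (p : \bar R) (f : R * R -> R) : Prop :=
  measurable_fun Omega f /\
  exists M : R, {ae mu, forall tau, timeI tau ->
    ('N[mu]_p [ EFin \o (fun x => f (tau, x)) ] <= M%:E)%E}.

Definition weak_d_xi (f g : R * R -> R) : Prop :=
  forall psi, test_function psi ->
  - integral_Omega (fun z => f z * d_xi psi z) =
    integral_Omega (fun z => g z * psi z).

(* Classical solution. The equation is required for tau in the open interval,
   where the two-sided derivative in tau only involves values on Omega. *)
Definition heat_solution (Q : R * R -> R) : Prop :=
  forall z, Omega_int z ->
  [/\ derivable Q z (1, 0), derivable Q z (0, 1),
      derivable (d_xi Q) z (0, 1) & d_tau Q z = d_xi (d_xi Q) z].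

Definition mu_of (xi : R -> R) : R * R -> R :=
  fun z => sgn (xi z.1 - z.2).

Definition distributional_solution (P : R * R -> R) (xi : R -> R) : Prop :=
  forall psi, test_function psi ->
  - integral_Omega (fun z => (P z + mu_of xi z) * d_tau psi z) =
    integral_Omega (fun z => P z * d_xi (d_xi psi) z).

(* Functions on Omega (resp. I) are represented by functions on R * R
   (resp. R) of which only the values on Omega (resp. I) are constrained. *)
Record limit_solution (P Q Rf : R * R -> R) (xi : R -> R) : Prop := {
  xi_lipschitz : [lipschitz xi tau | tau in timeI] ;
  P_decomp : forall z, Omega z -> P z = Q z + Rf z ;
  P_bounded : [bounded P z | z in Omega] ;
  Q_bounded : [bounded Q z | z in Omega] ;
  R_bounded : [bounded Rf z | z in Omega] ;
  P_hoelder : locally_hoelder P ;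
  Q_hoelder : locally_hoelder Q ;
  R_hoelder : locally_hoelder Rf ;
  R_Linfty_L1 : Linfty_Lp 1%:E Rf ;
  dR_Linfty_L2 : exists2 G, weak_d_xi Rf G & Linfty_Lp 2%:E G ;
  Q_heat : heat_solution Q ;
  Q_initial : forall x, Q (0, x) = P (0, x) ;
  P_distributional : distributional_solution P xi ;
  P_initial : ('N[mu]_+oo [ EFin \o (fun x => (P (tau, x) - P (0, x))%R) ])%E
                @[tau --> 0^'+] --> 0%E ;
  xi_initial : xi tau @[tau --> 0^'+] --> xi 0 ;
  P_ge : forall z, Omega z -> -1 <= P z ;
  P_le : forall tau x, timeI tau -> xi tau <= x -> P (tau, x) <= 1 ;
  (* A Lipschitz [xi] is only differentiable almost everywhere, so the flow
     rule is understood for almost every tau as well. *)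
  xi_monotone : {ae mu, forall tau, timeI tau ->
    derivable xi tau 1 /\ 0 <= 'D_1 xi tau} ;
  xi_flow_rule : {ae mu, forall tau, timeI tau ->
    P (tau, xi tau) != 1 -> 'D_1 xi tau = 0} }.

End limit_problem.

(* Main.v *)
(** By the maximum principle the two solutions share [Q], so that
[W = P1 - P2 = R1 - R2] is integrable in space, uniformly in time. Subtracting the weak
equations and testing with functions of [x] gives, for [g = xi1 - xi2],
  d/dt (integral of W phi) + 2 (phi(xi1) xi1' - phi(xi2) xi2') = integral of W phi''.
The first front moves only where [P1 = 1], while [P2 <= 1] at and beyond [xi2]; hence
[W >= 0] at [xi1] whenever [xi1] moves and [xi1 >= xi2]. So the mass [A] of the negative
part of [W] grows, up to a diffusive error, only while [g < 0]. Exchanging the solutions,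
the mass [B] of the positive part grows only while [g > 0]. With [phi = 1] the equation
reads [B - A + 2 g = 0], so [max(A, A - 2 g) = max(A, B)] selects [A] for [g > 0] and [B]
for [g < 0]: this maximum never increases. It vanishes initially, hence [A = 0] and
[g >= 0], and by symmetry [W = 0] and [g = 0].

The instants with [g = 0] are harmless because both terms then grow only while
[0 < |g| < th], a set of times whose measure tends to [0] with [th]. The inequality for
the negative part is proved for spatial mollifications of [W], with a cutoff at scale
[n] whose second derivative is of order [1 / n ^ 2]. *)

Require Import Defs.
From mathcomp Require Import all_boot all_order all_algebra.
From mathcomp Require Import all_classical all_reals all_analysis.
From mathcomp Require Import measurable_realfun.
From mathcomp Require Import ring lra.

Set Implicit Arguments.
Unset Strict Implicit.
Unset Printing Implicit Defensive.
Import Order.TTheory GRing.Theory Num.Theory.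
Import numFieldNormedType.Exports.
Local Open Scope classical_set_scope.
Local Open Scope ring_scope.

(* No time derivative of [W] or of a mass is ever formed. The fronts are only Lipschitz and [W] only
   Hölder continuous, so every evolution law is an inequality between two times [s <= t], and such
   inequalities are chained by a supremum argument. The term [phi(xi) xi'] becomes the integral of
   [phi] over []xi s, xi t]], and growth confined to a set of times is bounded by the measure of
   that set.

   The parameters are fixed in the order: threshold [k] of the negative part, mollification width
   [e], space step [h], time step. The constant in front of the time spent behind must not depend on
   them; it does not, because a mollifier of height of order [1 / e] meets a short piece of the
   front only for centres in an interval of length [4 * e]. Then [k] tends to [0], next [th] with
   the cutoff fixed, and finally [n] tends to infinity.

   For finite [n] the balance [B - A + 2 g = 0] holds only up to an error of order [1 / n ^ 2].
   Using [A - 2 g] in place of [B] puts this error into the growth estimate and keeps the choice of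
   the branch by the sign of [g] exact. *)
Tactic Notation "lra_from" ne_hyp_list(H) := clear - H; lra.

(** * Monotonicity from local and almost everywhere conditions *)

(** Let [c] be the supremum of the points [x] with [f a <= f x]. The condition to the left of [c]
    puts [c] itself into this set, and the condition to its right pushes past [c] unless [c = b].
    Continuity of [f] is not assumed. *)
Lemma pointwise_nondecreasing (R : realType) (f : R -> R) (a b : R) :
  a <= b ->
  (forall x, a <= x <= b -> exists2 d : R, 0 < d &
     (forall y, a <= y <= b -> x - d < y <= x -> f y <= f x) /\
     (forall y, a <= y <= b -> x <= y < x + d -> f x <= f y)) ->
  f a <= f b.
Proof.
move=> ab H.
pose S := [set x | a <= x <= b /\ f a <= f x].
have Sa : S a by split=> //; rewrite lexx ab.
have hS : has_sup S by split; [exists a|exists b => x [/andP[]]].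
pose c := sup S.
have ac : a <= c by apply: ub_le_sup => //; exact: hS.2.
have cb : c <= b by apply: ge_sup; [exists a|move=> x [/andP[]]].

have cab : a <= c <= b by rewrite ac cb.
have [d d0 [H1 H2]] := H c cab.
have fac : f a <= f c.
  have [x Sx cx] := sup_adherent d0 hS.
  have xc : x <= c by apply: ub_le_sup => //; exact: hS.2.
  case: Sx => xab fx; apply: (le_trans fx); apply: H1 => //.
  by rewrite cx xc.
have [->//|cltb] := eqVneq b c.
have {cltb cb}cb : c < b by rewrite lt_neqAle eq_sym cltb.
pose y := Num.min b (c + d / 2).
have yb : y <= b by rewrite ge_min lexx.
have cy : c < y by rewrite lt_min cb; lra.
have yd : y < c + d by rewrite gt_min; apply/orP; right; lra.
have yab : a <= y <= b by rewrite yb andbT; lra.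
suff : y <= c by rewrite leNgt cy.
apply: ub_le_sup; first exact: hS.2.
split=> //.
by apply: (le_trans fac); apply: H2 => //; rewrite yd ltW.
Qed.

(** The occupation time of [S] up to [t]. It serves as a primitive of the indicator of [S]: growth
    at rate [K] restricted to times in [S] is written as [K] times an increment of [occ]. *)
Definition occ (R : realType) (S : set R) (a t : R) : R :=
  fine (lebesgue_measure (S `&` `[a, t])).

Section occ.
Context {R : realType}.
Notation mu := (@lebesgue_measure R).
Implicit Types (S : set R) (a s t : R).

Lemma lebesgue_measure_itv_fin S (i : interval R) (s t : R) :
  measurable S -> [set` i] `<=` `[s, t] -> (mu (S `&` [set` i]) < +oo)%E.
Proof.
move=> mS ist; apply: (@le_lt_trans _ _ (mu `[s, t])).
  apply: le_measure; rewrite ?inE//; first exact: measurableI.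
  by move=> x [_]; exact: ist.
by rewrite lebesgue_measure_itv/=; case: ifP => _; rewrite ltry.
Qed.

Lemma occD S a s t : measurable S -> a <= s -> s <= t ->
  occ S a t = occ S a s + fine (mu (S `&` `]s, t])).
Proof.
move=> mS as_ st; rewrite /occ -fineD; last 2 first.
- by rewrite ge0_fin_numE//; exact: (@lebesgue_measure_itv_fin _ _ a s).
- rewrite ge0_fin_numE//; apply: (@lebesgue_measure_itv_fin _ _ s t) => //.
  exact: subset_itv_oc_cc.
congr fine; rewrite -measureU//.
- rewrite -setIUr; congr (mu (_ `&` _)).
  rewrite predeqE => x /=; rewrite !in_itv/=; split.
    case/andP=> ax xt; have [xs|sx] := leP x s; [left|right].
      by rewrite ax.
    by rewrite xt.
  by move=> [/andP[ax xs]|/andP[sx xt]]; apply/andP; split=> //; lra.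
- exact: measurableI.
- exact: measurableI.
- rewrite setIACA setIid; apply/seteqP; split => x //=; rewrite !in_itv/=.
  by move=> [_ [/andP[_ xs] /andP[sx _]]]; move: sx; rewrite ltNge xs.
Qed.

Lemma occ_incr_le S S' a s t : measurable S -> measurable S' ->
  a <= s -> s <= t -> S `&` `]s, t] `<=` S' ->
  occ S a t - occ S a s <= occ S' a t - occ S' a s.
Proof.
move=> mS mS' as_ st SS'; rewrite !(occD _ as_ st)//.
have E (x y : R) : x + y - x = y by rewrite addrAC subrr add0r.
rewrite !E.
apply: fine_le.
- rewrite ge0_fin_numE//; apply: (@lebesgue_measure_itv_fin _ _ s t) => //.
  exact: subset_itv_oc_cc.
- rewrite ge0_fin_numE//; apply: (@lebesgue_measure_itv_fin _ _ s t) => //.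
  exact: subset_itv_oc_cc.
- apply: le_measure; rewrite ?inE//; [exact: measurableI..|].
  by move=> x [Sx xst]; split=> //; exact: SS'.
Qed.

Lemma occ_incr_full S a s t : measurable S -> a <= s -> s <= t ->
  `]s, t] `<=` S -> occ S a t - occ S a s = t - s.
Proof.
move=> mS as_ st stS; rewrite (occD _ as_ st)// addrAC subrr add0r.
rewrite (setIidr stS) lebesgue_measure_itv/= lte_fin.
by case: ltP => //= ts; apply/eqP; rewrite eq_sym subr_eq0 eq_le st ts.
Qed.

Lemma occ_nd S a s t : measurable S -> a <= s -> s <= t ->
  occ S a s <= occ S a t.
Proof. by move=> mS as_ st; rewrite (occD _ as_ st)// lerDl fine_ge0. Qed.

Lemma occ_start S a : measurable S -> occ S a a = 0.
Proof.
move=> mS; rewrite /occ; suff -> : mu (S `&` `[a, a]) = 0%E by [].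
apply/eqP; rewrite -measure_le0; have <- : mu [set a] = 0%E.
  exact: lebesgue_measure_set1.
apply: le_measure; rewrite ?inE//; first exact: measurableI.
by move=> x [_] /=; rewrite in_itv/= -eq_le => /eqP ->.
Qed.

End occ.

Lemma derivable_diff_quotient (R : realType) (f : R -> R) (x e : R) :
  derivable f x 1 -> 0 < e -> exists2 d : R, 0 < d & forall y, `|y - x| < d ->
    y != x -> `|(f y - f x) / (y - x) - 'D_1 f x| < e.
Proof.
move=> dfx e0; have := dfx => /cvgrPdist_lt/(_ _ e0)[d /= d0 Hd].
exists d => // y yd yx; have h0 : y - x != 0 by rewrite subr_eq0.
have := Hd (y - x); rewrite /= sub0r normrN => /(_ yd h0).
by rewrite distrC /= [(_ - _) *: 1]mulr1 subrK [_ *: _]mulrC.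
Qed.

(* An open set [U] of small measure covers the exceptional null set, and the Lipschitz
   bound is only paid for the time spent in [U]. *)
Lemma lipschitz_ae_nondecreasing (R : realType) (f : R -> R) (L a b : R) :
  a <= b -> 0 <= L ->
  (forall x y, a <= x <= b -> a <= y <= b -> `|f x - f y| <= L * `|x - y|) ->
  {ae @lebesgue_measure R,
    forall x, a <= x <= b -> derivable f x 1 /\ 0 <= 'D_1 f x} ->
  f a <= f b.
Proof.
move=> ab L0 lipf [N [mN N0' fN]].
have {N0'}N0 : @lebesgue_measure R N = 0%E by exact: N0'.
apply/ler_addgt0Pr => e e0.
(* The loss [e] pays for [L] times the measure of [U] and for a slope [e1] over the length [b - a];
   the summand [1] keeps the denominator positive. *)
pose e1 := e / (L + (b - a) + 1).
have D0 : 0 < L + (b - a) + 1 by lra.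
have e10 : 0 < e1 by rewrite divr_gt0.
have [|U [oU NU UN]] := lebesgue_regularity_outer mN _ e10.
  by apply: (@le_lt_trans _ _ 0%E); rewrite ?ltry// le_eqVlt; apply/orP; left; apply/eqP; exact: N0.
have mU : measurable U by exact: measurable_realfun.open_measurable.
have muU : (@lebesgue_measure R U <= e1%:E)%E.
  have UE : U = N `|` (U `\` N).
    apply/seteqP; split=> x; last by case=> [/NU|[]].
    by move=> Ux; have [Nx|Nx] := pselect (N x); [left|right].
  apply: (@le_trans _ _ (@lebesgue_measure R N + @lebesgue_measure R (U `\` N))%E).
    rewrite {1}UE; apply: measureU2; first exact: mN.
    by apply: measurableD => //; exact: mN.
  rewrite -[leRHS]add0e; apply: leeD; [by rewrite -N0|exact: ltW].
(* Inside [U] the term with [occ] compensates the worst Lipschitz decrease. Outside [U] the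
   derivative of [f] is nonnegative, so difference quotients near the point exceed [- e1]. *)
pose g t := f t + L * occ U a t + e1 * (t - a).
suff : g a <= g b.
  rewrite /g occ_start// subrr !mulr0 !addr0 => /le_trans; apply.
  rewrite -addrA lerD2l.
  have occe : occ U a b <= e1.
    rewrite /occ -lee_fin fineK; last first.
      by rewrite ge0_fin_numE//; exact: (@lebesgue_measure_itv_fin _ _ _ a b).
    apply: le_trans muU; apply: le_measure; rewrite ?inE//.
    exact: measurableI.
  have -> : e = e1 * (L + (b - a) + 1) by rewrite /e1 divfK// gt_eqF.
  have := ler_wpM2l L0 occe; nra.
apply: pointwise_nondecreasing => // x xab.
have [Ux|NUx] := pselect (U x).
  have /nbhs_ballP[d /= d0 xdU] : nbhs x U by exact: open_nbhs_nbhs.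
  have incr (y z : R) : a <= y -> z <= b -> y <= z -> x - d < y -> z < x + d ->
      g y <= g z.
    move=> ay zb yz xdy zxd.
    have := @occ_incr_full _ U a y z mU ay yz.
    have yzU : `]y, z] `<=` U.
      move=> u /=; rewrite in_itv/= => /andP[yu uz].
      by apply: xdU; rewrite /ball/= ltr_norml; apply/andP; split; lra.
    move=> /(_ yzU) H.
    have : `|f z - f y| <= L * `|z - y| by apply: lipf; apply/andP; split; lra.
    rewrite [`|z - y|]ger0_norm ?subr_ge0// => /ler_normlP[+ _].
    rewrite /g; have : 0 <= e1 * (z - y) by rewrite mulr_ge0 ?subr_ge0// ltW.
    have -> : occ U a z = occ U a y + (z - y) by rewrite -H addrC subrK.
    lra.
  exists d => //; case/andP: xab => ax xb; split=> y /andP[ay yb] /andP[].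
    by move=> xdy yx; apply: incr => //; lra.
  by move=> xy yxd; apply: incr => //; lra.
have [dfx dfx0] : derivable f x 1 /\ 0 <= 'D_1 f x.
  apply: contrapT => H; apply: NUx; apply: NU; apply: fN => /= /(_ xab).
  exact: H.
have [d d0 Hd] := derivable_diff_quotient dfx e10.
case/andP: xab => ax xb; exists d => //; split=> y /andP[ay yb] /andP[].
  move=> xdy; rewrite le_eqVlt => /predU1P[->//|yx].
  have yx0 : y - x < 0 by rewrite subr_lt0.
  have := Hd y; rewrite !ltr_norml lt_eqF// => /(_ _ isT) H.
  have {H}/andP[H _] := H ltac:(apply/andP; split; lra).
  have {}H : - e1 < (f y - f x) / (y - x) by lra.
  have := @occ_nd _ U a y x mU ay (ltW yx) => O.
  have LO := ler_wpM2l L0 O.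
  move: H; rewrite ltr_ndivlMr// /g; lra.
move=> + yxd; rewrite le_eqVlt => /predU1P[->//|xy].
have yx0 : 0 < y - x by rewrite subr_gt0.
have := Hd y; rewrite !ltr_norml gt_eqF// => /(_ _ isT) H.
have {H}/andP[H _] := H ltac:(apply/andP; split; lra).
have {}H : - e1 < (f y - f x) / (y - x) by lra.
have := @occ_nd _ U a x y mU ax (ltW xy) => O.
have LO := ler_wpM2l L0 O.
move: H; rewrite ltr_pdivlMr// /g; lra.
Qed.

(** * The maximum principle for the heat equation *)

Definition strip_continuous (R : realType) (T : R) (f : R * R -> R) : Prop :=
  forall M e : R, 0 < e -> exists2 d : R, 0 < d & forall t s x y,
    0 <= t <= T -> 0 <= s <= T -> `|x| <= M -> `|y| <= M ->
    `|t - s| < d -> `|x - y| < d -> `|f (t, x) - f (s, y)| < e.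

Section strip_continuous.
Context {R : realType}.
Implicit Types (T : R) (f g : R * R -> R).

Lemma hoelder_strip_continuous T f : locally_hoelder T f -> strip_continuous T f.
Proof.
move=> hf M e e0.
have [||a [C [a0 a1 H]]] := hf (`[0, T] `*` `[- M, M]).
- by apply: compact_setX; exact: segment_compact.
- by move=> z [Hz _]; split.
(* The Hölder constant may be zero or negative; the maximum makes it a legitimate divisor. *)
pose C' := Num.max C 1.
have C'0 : 0 < C' by rewrite lt_max ltr01 orbT.
have eC' : 0 < e / C' by rewrite divr_gt0.
exists ((e / C') `^ a^-1); first by rewrite powR_gt0.
move=> t s x y tT sT xM yM ts xy.
set d := (e / C') `^ a^-1 in ts xy.
have zK : (`[0, T] `*` `[- M, M]) (t, x).
  by split=> /=; rewrite in_itv/= -?ler_norml.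
have wK : (`[0, T] `*` `[- M, M]) (s, y).
  by split=> /=; rewrite in_itv/= -?ler_norml.
apply: (le_lt_trans (H _ _ zK wK)).
have zw : `|(t, x) - (s, y)| < d by rewrite prod_normE/= gt_max ts xy.
have : `|(t, x) - (s, y)| `^ a < e / C'.
  have -> : e / C' = d `^ a by rewrite /d -powRrM mulVf ?gt_eqF// powRr1// ltW.
  by apply: gt0_ltr_powR; rewrite ?nnegrE ?powR_ge0.
rewrite ltr_pdivlMr// mulrC; apply: le_lt_trans.
by rewrite ler_wpM2r ?powR_ge0// le_max lexx.
Qed.

Lemma strip_continuousB T f g : strip_continuous T f -> strip_continuous T g ->
  strip_continuous T (fun z => f z - g z).
Proof.
move=> cf cg M e e0; have e20 : 0 < e / 2 by rewrite divr_gt0.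
have [d1 d10 H1] := cf M _ e20; have [d2 d20 H2] := cg M _ e20.
exists (Num.min d1 d2); first by rewrite lt_min d10.
move=> t s x y tT sT xM yM; rewrite !lt_min => /andP[ts1 ts2] /andP[xy1 xy2].
have := H1 t s x y tT sT xM yM ts1 xy1; have := H2 t s x y tT sT xM yM ts2 xy2.
by rewrite !ltr_norml => /andP[? ?] /andP[? ?]; apply/andP; split; lra.
Qed.

Lemma strip_continuous_within T f M : strip_continuous T f ->
  {within `[0, T] `*` `[- M, M], continuous f}.
Proof.
move=> cf; apply/subspace_continuousP => -[t x] [tT xM].
apply/cvgrPdist_lt => e e0; have [d d0 H] := cf M e e0.
move: tT xM; rewrite /= !in_itv/= => tT xM.
rewrite near_withinE; near=> z => -[]; rewrite /= !in_itv/= => zT zM.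
rewrite [z]surjective_pairing; apply: H => //; rewrite ?ler_norml//.
  by near: z; apply: (@cvgr_dist_lt _ _ _ _ _ (@fst R R) t) => //; exact: cvg_fst.
by near: z; apply: (@cvgr_dist_lt _ _ _ _ _ (@snd R R) x) => //; exact: cvg_snd.
Unshelve. all: by end_near. Qed.

Lemma strip_continuous_space T f t : 0 <= t <= T -> strip_continuous T f ->
  continuous (fun x => f (t, x)).
Proof.
move=> tT cf x; apply/cvgrPdist_lt => e e0; have [d d0 H] := cf (`|x| + 1) e e0.
near=> y; apply: H; rewrite ?subrr ?normr0 ?lerDl//.
  have : `|x - y| < 1 by near: y; apply: cvgr_dist_lt => //; exact: ltr01.
  by rewrite distrC => /ltW xy; have := ler_normD (y - x) x; rewrite subrK; lra.
Unshelve. all: by end_near. Qed.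

End strip_continuous.

Lemma is_derive_affine (R : realType) (a b x : R) :
  is_derive x 1 (fun s : R => a + b * s) b.
Proof.
have H : is_derive x 1 (cst a + b \*: (@id R)) (0 + b *: 1).
  exact: is_deriveD.
by apply: is_derive_eq; rewrite add0r [LHS]mulr1.
Qed.

Lemma is_derive_square (R : realType) (a b x : R) :
  is_derive x 1 (fun s : R => a + b * (s * s)) (2 * b * x).
Proof.
have H : is_derive x 1 (cst a + b \*: ((@id R) * (@id R))) (0 + b *: (x *: 1 + x *: 1)).
  exact: is_deriveD.
by apply: is_derive_eq; rewrite -![_ *: _]/(_ * _); ring.
Qed.

Section maximum_principle.
Context {R : realType}.
Implicit Types (f g : R -> R).

(** The first derivative [g] vanishes at the maximum. If [v > 0], then [g] is positive just to the
    right of [c], and the mean value theorem makes [f] exceed its maximum. *)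
Lemma second_derivative_max f g (c v r : R) : 0 < r ->
  (forall x, `|x - c| < r -> is_derive x 1 f (g x)) -> is_derive c 1 g v ->
  (forall x, `|x - c| < r -> f x <= f c) -> v <= 0.
Proof.
move=> r0 fg gv fmax.
have cr (x : R) : x \in `]c - r, c + r[ -> `|x - c| < r.
  by rewrite in_itv/= => /andP[? ?]; rewrite ltr_norml; apply/andP; split; lra.
have gc0 : g c = 0.
  have /= D : is_derive c 1 f 0.
    apply: (@derive1_at_max _ f (c - r) (c + r)).
    - lra.
    - by move=> x /cr /fg [].
    - by rewrite in_itv/=; apply/andP; split; lra.
    - by move=> x /cr /fmax.
  have := fg c; rewrite subrr normr0 => /(_ r0) D'.
  by rewrite -(@derive_val _ _ _ _ _ _ _ D') (@derive_val _ _ _ _ _ _ _ D).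
rewrite leNgt; apply/negP => v0.
have dg : derivable g c 1 by case: gv.
have Dg : 'D_1 g c = v by exact: derive_val.
have [d d0 H] := derivable_diff_quotient dg v0.
pose y := c + Num.min d r / 2.
have m0 : 0 < Num.min d r by rewrite lt_min d0.
have md : Num.min d r <= d by rewrite ge_min lexx.
have mr : Num.min d r <= r by rewrite ge_min lexx orbT.
have cy : c < y by rewrite /y; lra.
have sub (x : R) : c <= x <= y -> `|x - c| < r.
  rewrite /y => /andP[? ?]; rewrite ltr_norml; apply/andP; split; lra.
have [||z zcy] := @MVT _ f g c y cy.
- move=> x; rewrite in_itv/= => /andP[cx xy]; apply: fg; apply: sub.
  by rewrite !ltW.
- apply: derivable_within_continuous => x; rewrite in_itv/= => /sub /fg [].
  by [].
move: zcy; rewrite in_itv/= => /andP[cz zy] E.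
have fy : f y <= f c by apply: fmax; apply: sub; rewrite lexx ltW.
have zc0 : 0 < z - c by rewrite subr_gt0.
have := H z; rewrite Dg gc0 subr0 (gt_eqF cz) => /(_ _ isT).
rewrite !ltr_norml => /(_ _)/andP[|+ _].
  by apply/andP; move: zy; rewrite /y; split; lra.
rewrite ltrBrDr addrC subrr => gz.
have {}gz : 0 < g z by rewrite -(@pmulr_lgt0 _ (z - c)^-1)// invr_gt0.
have : 0 < f y - f c by rewrite E mulr_gt0// subr_gt0.
lra.
Qed.

(** Only earlier points are compared because a maximum over a time slab may lie on its final
    time. *)
Lemma left_max_derive_ge0 f (c r : R) : 0 < r -> derivable f c 1 ->
  (forall x, c - r < x <= c -> f x <= f c) -> 0 <= 'D_1 f c.
Proof.
move=> r0 df fmax; rewrite leNgt; apply/negP => D0.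
have ND0 : 0 < - 'D_1 f c by lra.
have [d d0 H] := derivable_diff_quotient df ND0.
pose y := c - Num.min d r / 2.
have m0 : 0 < Num.min d r by rewrite lt_min d0.
have md : Num.min d r <= d by rewrite ge_min lexx.
have mr : Num.min d r <= r by rewrite ge_min lexx orbT.
have yc : y < c by rewrite /y; lra.
have fy : f y <= f c by apply: fmax; rewrite /y; apply/andP; split; lra.
have yc0 : y - c < 0 by rewrite subr_lt0.
have := H y; rewrite (lt_eqF yc) => /(_ _ isT).
rewrite !ltr_norml => /(_ _)/andP[|_].
  by apply/andP; rewrite /y; split; lra.
have : 0 <= (f y - f c) / (y - c).
  by rewrite mulr_le0// ?subr_le0// invr_le0 ltW.
lra.
Qed.

(** The barrier [e * (x ^ 2 + 3 * t)] is a strict supersolution, since its time derivative [3 * e]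
    exceeds its second space derivative [2 * e]. Its growth in [x] beats the bound [B], so a
    positive maximum of the difference can sit neither at the initial time, nor on the lateral
    boundary, nor inside. Then [e] tends to [0] at a fixed point. *)
Lemma heat_maximum_principle (T B : R) (D Dx Dxx Dt : R * R -> R) : 0 < T ->
  strip_continuous T D -> (forall t x : R, 0 <= t <= T -> D (t, x) <= B) ->
  (forall t x : R, 0 < t < T ->
    [/\ is_derive t 1 (fun s => D (s, x)) (Dt (t, x)),
        is_derive x 1 (fun y => D (t, y)) (Dx (t, x)),
        is_derive x 1 (fun y => Dx (t, y)) (Dxx (t, x)) &
        Dt (t, x) = Dxx (t, x)]) ->
  (forall x, D (0, x) <= 0) ->
  forall t x : R, 0 <= t <= T -> D (t, x) <= 0.
Proof.
move=> T0 cD DB heat D0.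
have main (e t1 x1 : R) : 0 < e -> 0 < t1 < T ->
    D (t1, x1) <= e * (x1 ^+ 2 + 3 * t1).
  move=> e0 /andP[t10 t1T].
  (* [M >= 1] and [M >= |B| / e] give [B <= e * M <= e * M ^ 2], so the barrier dominates on the
     sides [x = M] and [x = - M]. *)
  pose M : R := `|x1| + (`|B| / e + 1).
  have Be0 : 0 <= `|B| / e by rewrite divr_ge0// ltW.
  have M1 : 1 <= M by rewrite /M; have := normr_ge0 x1; lra.
  have x1M : `|x1| <= M by rewrite /M; lra.
  have eM : B <= e * M ^+ 2.
    have : `|B| / e <= M by rewrite /M; have := normr_ge0 x1; lra.
    rewrite ler_pdivrMr// => H; apply: (le_trans (ler_norm _)).
    apply: (le_trans H); rewrite mulrC ler_pM2l// expr2 ler_peMr//; lra.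
  pose Z z := D z - e * (z.2 * z.2 + 3 * z.1).
  pose K := `[0, t1] `*` `[- M, M] : set (R * R).
  have cZ : {within K, continuous Z}.
    have cD' : strip_continuous t1 D.
      move=> M' e' /(cD M')[d d0 H]; exists d => // t s x y /andP[? ?] /andP[? ?].
      by apply: H; apply/andP; split; lra.
    move=> z; apply: (@continuousB _ _ (subspace K)).
      exact: strip_continuous_within.
    apply: continuous_subspaceT => {}z.
    apply: cvgM; first exact: cvg_cst.
    apply: cvgD; first by apply: cvgM; exact: cvg_snd.
    by apply: cvgM; [exact: cvg_cst|exact: cvg_fst].
  have cK : compact K by apply: compact_setX; exact: segment_compact.
  have Kz1 : K (t1, x1).
    by split; rewrite /= in_itv/= ?lexx ?andbT -?ler_norml// ltW.
  have [|[t0 x0] /set_mem Kz0 Zmax] := compact_EVT_max _ cK cZ.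
    by exists (t1, x1).
  have {}Zmax t x : K (t, x) -> Z (t, x) <= Z (t0, x0).
    by move=> ?; apply: Zmax; exact: mem_set.
  suff : Z (t0, x0) <= 0.
    by have := Zmax _ _ Kz1; rewrite /Z/=; lra.
  case: Kz0; rewrite /= !in_itv/= => /andP[t00 t0t1] /andP[Mx0 x0M].
  have [t0E|t0N] := eqVneq t0 0.
    rewrite /Z t0E /= mulr0 addr0 -[x0 * x0]expr2; have := D0 x0.
    have : 0 <= e * x0 ^+ 2 by rewrite mulr_ge0// ?sqr_ge0// ltW.
    lra.
  have t0gt : 0 < t0 by rewrite lt_neqAle eq_sym t0N.
  have [x0E|x0N] := eqVneq (x0 ^+ 2) (M ^+ 2).
    rewrite /Z /= -[x0 * x0]expr2 x0E mulrDr.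
    have := DB t0 x0; rewrite t00 /= => /(_ ltac:(lra)).
    have : 0 <= e * (3 * t0) by rewrite mulr_ge0 ?mulr_ge0// ltW.
    lra.
  have Mx0' : - M < x0.
    by rewrite lt_neqAle Mx0 andbT; apply: contraNneq x0N => <-; rewrite sqrrN.
  have x0M' : x0 < M.
    by rewrite lt_neqAle x0M andbT; apply: contraNneq x0N => ->.
  exfalso.
  have t0T : 0 < t0 < T by rewrite t0gt /=; lra.
  have [HDt HDx HDxx E] := heat t0 x0 t0T.
  have Ht : 0 <= Dt (t0, x0) - 3 * e.
    pose f := (fun s => D (s, x0)) - (fun s => e * (x0 * x0) + 3 * e * s).
    have df : is_derive t0 1 f (Dt (t0, x0) - 3 * e).
      by apply: is_deriveB => //; exact: is_derive_affine.
    have -> : Dt (t0, x0) - 3 * e = 'D_1 f t0 by rewrite derive_val.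
    apply: (@left_max_derive_ge0 _ _ t0) => //.
    move=> s; rewrite subrr => /andP[s0 st0].
    have fE u : f u = D (u, x0) - (e * (x0 * x0) + 3 * e * u) by [].
    have : Z (s, x0) <= Z (t0, x0).
      have sK : 0 <= s <= t1 by rewrite (ltW s0) (le_trans st0 t0t1).
      by apply: Zmax; split; rewrite /= in_itv//= Mx0.
    by rewrite !fE /Z /=; move: (D _) (D _) => D1 D2 ZZ; lra_from ZZ.
  have Hx : Dxx (t0, x0) - 2 * e <= 0.
    pose h := (fun y => D (t0, y)) - (fun y => e * (3 * t0) + e * (y * y)).
    have hE u : h u = D (t0, u) - (e * (3 * t0) + e * (u * u)) by [].
    apply: (@second_derivative_max h
      ((fun y => Dx (t0, y)) - (fun y => 0 + 2 * e * y)) x0 _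
      (Num.min (x0 + M) (M - x0))).
    - by rewrite lt_min subr_gt0 x0M' andbT -[M]opprK subr_gt0.
    - move=> y _; have [_ HDx' _ _] := heat t0 y t0T.
      apply: is_deriveB => //.
      by rewrite add0r; exact: is_derive_square.
    - by apply: is_deriveB => //; exact: is_derive_affine.
    - move=> y; rewrite lt_min !ltr_norml => /andP[/andP[y1 _] /andP[_ y2]].
      have yM : - M <= y <= M by apply/andP; split; [lra_from y1|lra_from y2].
      have : Z (t0, y) <= Z (t0, x0).
        by apply: Zmax; split; rewrite /= in_itv//= t00.
      by rewrite !hE /Z /=; move: (D _) (D _) => D1 D2 ZZ; lra_from ZZ.
  by move: Ht Hx; rewrite E => Ht Hx; lra_from e0 Ht Hx.
have open_case (t x : R) : 0 < t < T -> D (t, x) <= 0.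
  move=> tT; apply/ler_addgt0Pr => e e0; rewrite add0r.
  have c0 : 0 < x ^+ 2 + 3 * t.
    have := sqr_ge0 x; case/andP: tT => ? ?; lra.
  have := main (e / (x ^+ 2 + 3 * t)) t x (divr_gt0 e0 c0) tT.
  by rewrite divfK// gt_eqF.
move=> t x /andP[t0 tT].
have [->//|tN0] := eqVneq t 0.
have {}t0 : 0 < t by rewrite lt_neqAle eq_sym tN0.
have [tE|tNT] := eqVneq t T; last first.
  by apply: open_case; rewrite t0 lt_neqAle tNT.
apply/ler_addgt0Pr => e e0; rewrite add0r.
(* The equation is only given for times before [T]; the final time is reached by continuity from a
   nearby earlier time [s]. *)
have [d d0 H] := cD `|x| e e0.
pose s := Num.max (T / 2) (T - d / 2).
have sT : s < T by rewrite gt_max; apply/andP; split; lra.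
have s1 : T / 2 <= s by rewrite le_max lexx.
have s2 : T - d / 2 <= s by rewrite le_max lexx orbT.
have := @open_case s x.
have : `|D (t, x) - D (s, x)| < e.
  apply: H; rewrite ?subrr ?normr0 ?lexx//; last 1 first.
  - by rewrite tE ltr_norml; apply/andP; split; lra.
  - by rewrite tT ltW.
  - by apply/andP; split; lra.
rewrite ltr_norml => /andP[_ ?] /(_ _); lra.
Qed.

End maximum_principle.

(** * Partial derivatives as derivatives of one-variable slices *)

Section slices.
Context {R : realType}.
Implicit Types (f : R * R -> R).

Lemma quotient_slice1 f (t x : R) :
  (fun h : R => h^-1 *: ((f \o shift (t, x)) (h *: (1, 0)) - f (t, x))) =
  (fun h : R => h^-1 *: (((fun s => f (s, x)) \o shift t) (h *: 1) - f (t, x))).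
Proof.
apply/funext => h /=; congr (_ *: (f _ - _)).
by apply/pair_equal_spec; split=> //=; rewrite scaler0 add0r.
Qed.

Lemma quotient_slice2 f (t x : R) :
  (fun h : R => h^-1 *: ((f \o shift (t, x)) (h *: (0, 1)) - f (t, x))) =
  (fun h : R => h^-1 *: (((fun y => f (t, y)) \o shift x) (h *: 1) - f (t, x))).
Proof.
apply/funext => h /=; congr (_ *: (f _ - _)).
by apply/pair_equal_spec; split=> //=; rewrite scaler0 add0r.
Qed.

Lemma derivable_slice1 f (t x : R) :
  derivable f (t, x) (1, 0) <-> derivable (fun s => f (s, x)) t 1.
Proof. by rewrite /derivable quotient_slice1. Qed.

Lemma derivable_slice2 f (t x : R) :
  derivable f (t, x) (0, 1) <-> derivable (fun y => f (t, y)) x 1.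
Proof. by rewrite /derivable quotient_slice2. Qed.

Lemma d_tau_slice f (t x : R) : d_tau f (t, x) = 'D_1 (fun s => f (s, x)) t.
Proof. by rewrite /d_tau /derive quotient_slice1. Qed.

Lemma d_xi_slice f (t x : R) : d_xi f (t, x) = 'D_1 (fun y => f (t, y)) x.
Proof. by rewrite /d_xi /derive quotient_slice2. Qed.

Lemma is_derive_slice1 f (t x : R) : derivable f (t, x) (1, 0) ->
  is_derive t 1 (fun s => f (s, x)) (d_tau f (t, x)).
Proof. by rewrite d_tau_slice => /derivable_slice1 df; exact: DeriveDef. Qed.

Lemma is_derive_slice2 f (t x : R) : derivable f (t, x) (0, 1) ->
  is_derive x 1 (fun y => f (t, y)) (d_xi f (t, x)).
Proof. by rewrite d_xi_slice => /derivable_slice2 df; exact: DeriveDef. Qed.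

End slices.

Lemma OmegaE (R : realType) (T t x : R) : Omega T (t, x) = (0 <= t <= T).
Proof.
rewrite /Omega /timeI /=; apply/propext; rewrite /= in_itv/=.
by split=> [[]//|tT].
Qed.

Lemma timeIE (R : realType) (T t : R) : timeI T t = (0 <= t <= T).
Proof. by rewrite /timeI /= in_itv. Qed.

Lemma heat_solution_le (R : realType) (T : R) (P1 Q1 R1 P2 Q2 R2 : R * R -> R)
    (xi1 xi2 : R -> R) : 0 < T ->
  limit_solution T P1 Q1 R1 xi1 -> limit_solution T P2 Q2 R2 xi2 ->
  (forall x : R, P1 (0, x) = P2 (0, x)) ->
  forall z, Omega T z -> Q1 z <= Q2 z.
Proof.
move=> T0 s1 s2 P12 [t x]; rewrite OmegaE => tT.
rewrite -subr_le0.
have [M1 [_ B1]] := Q_bounded s1; have [M2 [_ B2]] := Q_bounded s2.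
have Om1 (u y : R) : 0 <= u <= T -> `|Q1 (u, y)| <= M1 + 1.
  by move=> uT; apply: B1; rewrite ?ltrDl ?OmegaE.
have Om2 (u y : R) : 0 <= u <= T -> `|Q2 (u, y)| <= M2 + 1.
  by move=> uT; apply: B2; rewrite ?ltrDl ?OmegaE.
apply: (@heat_maximum_principle _ T (M1 + 1 + (M2 + 1)) (fun z => Q1 z - Q2 z)
  (fun z => d_xi Q1 z - d_xi Q2 z) (fun z => d_xi (d_xi Q1) z - d_xi (d_xi Q2) z)
  (fun z => d_tau Q1 z - d_tau Q2 z)) => //.
- apply: strip_continuousB; apply: hoelder_strip_continuous.
    exact: (Q_hoelder s1).
  exact: (Q_hoelder s2).
- move=> {tT}t {}x tT; have := Om1 t x tT; have := Om2 t x tT.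
  by rewrite !ler_norml => /andP[? ?] /andP[? ?]; lra.
- move=> {tT}t {}x tT.
  have Oi : Omega_int T (t, x) by rewrite /Omega_int; split; rewrite //= in_itv.
  have [t1 x1 xx1 E1] := Q_heat s1 Oi; have [t2 x2 xx2 E2] := Q_heat s2 Oi.
  split; last by rewrite E1 E2.
  + exact: is_deriveB (is_derive_slice1 t1) (is_derive_slice1 t2).
  + exact: is_deriveB (is_derive_slice2 x1) (is_derive_slice2 x2).
  + exact: is_deriveB (is_derive_slice2 xx1) (is_derive_slice2 xx2).
- by move=> y; rewrite (Q_initial s1) (Q_initial s2) P12 subrr.
Qed.

(** * Bounded functions with bounded support *)

Section integrals.
Context {R : realType}.
Notation mu := (@lebesgue_measure R).
Implicit Types (f g : R -> R).

(** One constant bounds both the values and the support. All integrands in space are brought into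
    this class, where integrability, and hence linearity of the real-valued integral, is
    automatic. *)
Definition tame f : Prop := measurable_fun setT f /\
  exists M : R, forall x, `|f x| <= M /\ (M < `|x| -> f x = 0).

Lemma tame_integrable f : tame f -> mu.-integrable setT (EFin \o f).
Proof.
move=> [mf [M fM]].
have -> : EFin \o f = (EFin \o f) \_ `[- M, M].
  apply/funext => x; rewrite patchE; case: ifPn => // /negP xM.
  rewrite /= (fM x).2// ltNge; apply/negP => xM'; apply: xM.
  by rewrite inE /= in_itv/= -ler_norml.
apply: (integrable_mkcond (mu := mu) (EFin \o f) (measurable_itv `[- M, M])).1; apply: measurable_bounded_integrable => //.
- by rewrite /= lebesgue_measure_itv/=; case: ifP => _; rewrite ltry.
- exact: measurable_funTS.
- exists M; split; rewrite ?num_real// => x Mx y _ /=.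
  by apply: (le_trans (fM y).1); exact: ltW.
Qed.

Lemma tameD f g : tame f -> tame g -> tame (fun x => f x + g x).
Proof.
move=> [mf [M fM]] [mg [N gN]]; split; first exact: measurable_funD.
have M0 : 0 <= M by apply: le_trans (fM 0).1; exact: normr_ge0.
have N0 : 0 <= N by apply: le_trans (gN 0).1; exact: normr_ge0.
exists (M + N) => x; split.
  by apply: (le_trans (ler_normD _ _)); rewrite lerD// ?(fM x).1// (gN x).1.
by move=> MN; rewrite (fM x).2 ?(gN x).2 ?addr0//; lra.
Qed.

Lemma tameM g f : measurable_fun setT g ->
  (forall N, exists M : R, forall x, `|x| <= N -> `|g x| <= M) ->
  tame f -> tame (fun x => g x * f x).
Proof.
move=> mg bg [mf [M fM]]; split; first exact: measurable_funM.
have M0 : 0 <= M by apply: le_trans (fM 0).1; exact: normr_ge0.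
have [N gN] := bg M.
have N0 : 0 <= N by apply: le_trans (gN 0 _); rewrite ?normr0 ?normr_ge0.
exists (N * M + M) => x; split.
  have [xM|Mx] := leP `|x| M.
    rewrite normrM -[leLHS]addr0 lerD//.
    by apply: ler_pM => //; [exact: gN|exact: (fM x).1].
  by rewrite (fM x).2// mulr0 normr0 addr_ge0// mulr_ge0.
move=> MN; rewrite (fM x).2 ?mulr0//; apply: le_lt_trans MN.
by rewrite lerDr mulr_ge0.
Qed.

Lemma continuous_bounded_itv g (N : R) : continuous g ->
  exists M : R, forall x, `|x| <= N -> `|g x| <= M.
Proof.
move=> cg.
have : bounded_set (g @` `[- N, N]).
  apply: compact_bounded; apply: continuous_compact; last exact: segment_compact.
  exact: continuous_subspaceT.
move=> [M [_ gM]]; exists (M + 1) => x xN; apply: gM; first by rewrite ltrDl.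
by exists x => //=; rewrite in_itv/= -ler_norml.
Qed.

Lemma tameMc g f : continuous g -> tame f -> tame (fun x => g x * f x).
Proof.
move=> cg tf; apply: tameM => //; first exact: continuous_measurable_fun.
by move=> N; exact: continuous_bounded_itv.
Qed.

Lemma tameZ (c : R) f : tame f -> tame (fun x => c * f x).
Proof. by move=> tf; apply: tameMc => //; exact: cst_continuous. Qed.

Lemma tameB f g : tame f -> tame g -> tame (fun x => f x - g x).
Proof.
move=> tf tg; have := tameD tf (tameZ (-1) tg).
by under eq_fun do rewrite mulN1r.
Qed.

Lemma tame_norm f : tame f -> tame (fun x => `|f x|).
Proof.
move=> [mf [M fM]]; split; first exact: measurableT_comp.
exists M => x; rewrite normr_id; split; first exact: (fM x).1.
by move=> /(fM x).2 ->; rewrite normr0.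
Qed.

Lemma tame_continuous f (M : R) : continuous f ->
  (forall x, M < `|x| -> f x = 0) -> tame f.
Proof.
move=> cf fM; split; first exact: continuous_measurable_fun.
have [N fN] := continuous_bounded_itv M cf.
exists (`|N| + `|M|) => x; split.
  have [xM|Mx] := leP `|x| M.
    apply: (le_trans (fN x xM)); apply: (le_trans (ler_norm _)).
    by rewrite lerDl.
  by rewrite fM// normr0 addr_ge0.
by move=> H; apply: fM; apply: le_lt_trans H; rewrite (le_trans (ler_norm _))// lerDr.
Qed.

Lemma tame_indic (i : interval R) (M : R) : [set` i] `<=` `[- M, M] -> 0 <= M ->
  tame (\1_[set` i] : R -> R).
Proof.
move=> iM M0; split; first exact: measurable_indic.
exists (1 + M) => x; split.
  rewrite indicE; case: (_ \in _); rewrite ?normr1 ?normr0; lra.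
move=> Mx; rewrite indicE; case: (boolP (_ \in _)) => //; rewrite inE => /iM.
rewrite /= in_itv/= -ler_norml; lra.
Qed.

Lemma Rintegral_tame_le f g : tame f -> tame g -> (forall x, f x <= g x) ->
  (\int[mu]_x f x <= \int[mu]_x g x)%R.
Proof. by move=> tf tg fg; apply: le_Rintegral => //; exact: tame_integrable. Qed.

Lemma Rintegral_tameD f g : tame f -> tame g ->
  (\int[mu]_x (f x + g x) = \int[mu]_x f x + \int[mu]_x g x)%R.
Proof. by move=> tf tg; apply: RintegralD => //; exact: tame_integrable. Qed.

Lemma Rintegral_tameB f g : tame f -> tame g ->
  (\int[mu]_x (f x - g x) = \int[mu]_x f x - \int[mu]_x g x)%R.
Proof. by move=> tf tg; apply: RintegralB => //; exact: tame_integrable. Qed.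

Lemma Rintegral_tameZ (c : R) f : tame f ->
  (\int[mu]_x (c * f x) = c * \int[mu]_x f x)%R.
Proof. by move=> tf; apply: RintegralZl => //; exact: tame_integrable. Qed.

Lemma Rintegral_indic_itv (i : interval R) :
  (\int[mu]_x \1_[set` i] x = fine (mu [set` i]))%R.
Proof. by rewrite /Rintegral integral_indic// setIT. Qed.

Lemma Rintegral_le_itv f (a b B : R) : tame f -> a <= b -> 0 <= B ->
  (forall x, a <= x <= b -> f x <= B) ->
  (forall x, ~~ (a <= x <= b) -> f x <= 0) ->
  (\int[mu]_x f x <= B * (b - a))%R.
Proof.
move=> tf ab B0 fB f0.
have tab : tame (\1_`[a, b] : R -> R).
  apply: (@tame_indic _ (`|a| + `|b|)); last by rewrite addr_ge0.
  move=> x /=; rewrite !in_itv/= => /andP[ax xb].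
  have := ler_norm b; have := ler_norm (- a); rewrite normrN => H1 H2.
  have := normr_ge0 a; have := normr_ge0 b; move=> *.
  by apply/andP; split; lra.
have -> : B * (b - a) = (\int[mu]_x (B * \1_`[a, b] x))%R.
  rewrite Rintegral_tameZ// Rintegral_indic_itv lebesgue_measure_itv/=.
  rewrite lte_fin; case: ltP => //= ba.
  by rewrite (_ : b = a) ?subrr//; apply/eqP; rewrite eq_le ab ba.
apply: Rintegral_tame_le => //; first exact: tameZ.
move=> x; rewrite indicE; case: (boolP (x \in _)).
  by rewrite inE /= in_itv/= mulr1; exact: fB.
by rewrite notin_setE /= in_itv/= => /negP /f0; rewrite mulr0.
Qed.

Lemma Rintegral_norm_le f (a b B : R) : tame f -> a <= b -> 0 <= B ->
  (forall x, a <= x <= b -> `|f x| <= B) ->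
  (forall x, ~~ (a <= x <= b) -> f x = 0) ->
  (`|\int[mu]_x f x| <= B * (b - a))%R.
Proof.
move=> tf ab B0 fB f0; apply: (@le_trans _ _ (\int[mu]_x `|f x|)%R).
  by apply: le_normr_Rintegral => //; exact: tame_integrable.
apply: Rintegral_le_itv => //; first exact: tame_norm.
by move=> x /f0 ->; rewrite normr0.
Qed.

Lemma Rintegral_translate f (k : R) : continuous f -> (forall x, 0 <= f x) ->
  (\int[mu]_x f (x + k) = \int[mu]_x f x)%R.
Proof.
move=> cf f0; rewrite /Rintegral; congr fine.
have d1 (x : R) : is_derive x 1 (fun y : R => y + k) 1.
  have H : is_derive x 1 (@id R + cst k) (1 + 0) by exact: is_deriveD.
  by apply: is_derive_eq; rewrite addr0.
have D1 : derive1 (fun y : R => y + k) = cst 1.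
  by apply/funext => x; rewrite derive1E derive_val.
rewrite [RHS](@increasing_ge0_integration_by_substitutionT _ (fun y => y + k))//.
- by apply: eq_integral => x _; rewrite D1 /= fctE /= mulr1.
- by move=> x y xy; rewrite ltrD2r.
- by rewrite D1; exact: cst_continuous.
- by rewrite D1; exact: is_cvg_cst.
- by rewrite D1; exact: is_cvg_cst.
- apply/cvgrNyPle => A; near=> x; rewrite -lerBrDr.
  by near: x; apply: nbhs_ninfty_le; exact: num_real.
- apply/cvgryPge => A; near=> x; rewrite -lerBlDr.
  by near: x; apply: nbhs_pinfty_ge; exact: num_real.
Unshelve. all: by end_near. Qed.

End integrals.

(** * A single front *)

Section front.
Context {R : realType}.
Notation mu := (@lebesgue_measure R).
Variables (T : R) (P Q Rf : R * R -> R) (xi : R -> R).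
Hypothesis sol : limit_solution T P Q Rf xi.

Lemma front_lipschitz : exists2 L : R, 0 < L &
  forall s t : R, 0 <= s <= T -> 0 <= t <= T -> `|xi s - xi t| <= L * `|s - t|.
Proof.
have [M [_ HM]] := xi_lipschitz sol.
exists (Num.max M 0 + 1); first by rewrite ltr_wpDl// le_max lexx orbT.
move=> s t sT tT; apply: (HM _ _ (s, t)).
  by rewrite (@le_lt_trans _ _ (Num.max M 0))// ?le_max ?lexx// ltrDl.
by split; rewrite /= timeIE.
Qed.

Lemma front_nondecreasing (s t : R) : 0 <= s -> s <= t -> t <= T -> xi s <= xi t.
Proof.
move=> s0 st tT; have [L L0 HL] := front_lipschitz.
apply: (@lipschitz_ae_nondecreasing _ xi L) => //; first exact: ltW.
  by move=> x y /andP[? ?] /andP[? ?]; apply: HL; apply/andP; split; lra.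
have FF := @ae_filter_ringOfSetsType _ (measurableTypeR R) R mu.
apply: (@filterS _ (almost_everywhere mu) FF _ _ _ (xi_monotone sol)) => x H /andP[? ?]; apply: H.
by rewrite timeIE; apply/andP; split; lra.
Qed.

(** The flow rule makes the derivative vanish almost everywhere, so [- xi] is nondecreasing as well.
    Used in contrapositive form: a front that moves during [[s, t]] has a contact time at which [P]
    equals [1] on it. *)
Lemma front_frozen (s t : R) : 0 <= s -> s <= t -> t <= T ->
  (forall r : R, s <= r <= t -> P (r, xi r) != 1) -> xi s = xi t.
Proof.
move=> s0 st tT HP; have [L L0 HL] := front_lipschitz.
apply/eqP; rewrite eq_le front_nondecreasing//= -lerN2.
apply: (@lipschitz_ae_nondecreasing _ (- xi) L) => //; first exact: ltW.
  move=> x y /andP[? ?] /andP[? ?]; rewrite /= !fctE opprK addrC distrC [`|x - y|]distrC.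
  by rewrite distrC; apply: HL; apply/andP; split; lra.
have FF := @ae_filter_ringOfSetsType _ (measurableTypeR R) R mu.
apply: (@filterS2 _ _ FF _ _ _ _ (xi_monotone sol) (xi_flow_rule sol)) => x Hmono Hflow /andP[? ?].
have xT : timeI T x by rewrite timeIE; apply/andP; split; lra.
have [dx _] := Hmono xT.
have Dx : 'D_1 xi x = 0 by apply: Hflow => //; apply: HP; apply/andP; split.
by split; [exact: derivableN|rewrite deriveN// Dx oppr0].
Qed.

Lemma P_strip_continuous : strip_continuous T P.
Proof. exact: hoelder_strip_continuous (P_hoelder sol). Qed.

Lemma null_set_gap (N : set R) (a b : R) : measurable N -> mu N = 0%E -> a < b ->
  exists2 s, a <= s <= b & ~ N s.
Proof.
move=> mN N0 ab; apply: contrapT => H.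
have abN : `[a, b] `<=` N.
  move=> x /=; rewrite in_itv/= => xab; apply: contrapT => Nx; apply: H.
  by exists x.
have : (mu `[a, b] <= mu N)%E by apply: le_measure; rewrite ?inE.
rewrite N0 lebesgue_measure_itv/= lte_fin ab -EFinD lee_fin; lra.
Qed.

(** The [L^1] bound is given for almost every time only. Every time has admissible times arbitrarily
    near, and on [[- k, k]] uniform continuity of [Rf] carries the bound over with a constant
    independent of [k]. *)
Lemma R_integral_bound : 0 < T -> exists2 M : R, 0 <= M & forall t k : R,
  0 <= t <= T -> 0 <= k -> (\int[mu]_x (`|Rf (t, x)| * \1_`[- k, k] x) <= M)%R.
Proof.
move=> T0; have [_ [M [N [mN N0 HN]]]] := R_Linfty_L1 sol.
have cR := hoelder_strip_continuous (R_hoelder sol).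
have tR (t k : R) : 0 <= t <= T -> 0 <= k -> tame (fun x => `|Rf (t, x)| * \1_`[- k, k] x).
  move=> tT k0; apply: tameMc; last exact: (@tame_indic _ _ k).
  move=> x; apply: cvg_norm; exact: (strip_continuous_space tT cR).
have good (t k : R) : timeI T t -> ~ N t -> 0 <= k ->
    (\int[mu]_x (`|Rf (t, x)| * \1_`[- k, k] x) <= `|M|)%R.
  move=> tT Nt k0.
  have : ('N[mu]_1[EFin \o (fun x => Rf (t, x))] <= M%:E)%E.
    by apply: contrapT => H; apply: Nt; apply: HN => /= /(_ tT).
  rewrite Lnorm1 => H.
  rewrite /Rintegral; apply: (@le_trans _ _ (fine M%:E)); last exact: ler_norm.
  have H2 : (\int[mu]_x (`|Rf (t, x)| * \1_`[- k, k] x)%:E <=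
      \int[mu]_x `|(EFin \o (fun x => Rf (t, x))) x|)%E.
    have tT' : 0 <= t <= T by rewrite -timeIE.
    apply: ge0_le_integral => //=.
    - by apply/measurable_EFinP; exact: (tR t k tT' k0).1.
    - apply/measurable_EFinP; apply: measurableT_comp => //.
      apply: continuous_measurable_fun; exact: (strip_continuous_space tT' cR).
    - move=> x _; rewrite lee_fin ler_piMr// indicE; by case: (_ \in _).
  apply: fine_le => //; last exact: le_trans H2 H.
  rewrite ge0_fin_numE; last by apply: integral_ge0 => x _; rewrite lee_fin mulr_ge0.
  exact: le_lt_trans (le_trans H2 H) (ltry _).
exists `|M| => // t k tT k0; apply/ler_addgt0Pr => e e0.
(* Integrated over [[- k, k]], of length [2 * k], this tolerance costs at most [e]; the summand [1]
   covers [k = 0]. *)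
have e'0 : 0 < e / (2 * k + 1) by rewrite divr_gt0//; lra.
have [d d0 Hd] := cR k _ e'0.
(* The window around [t] is cut to [[0, T]]. It stays nondegenerate even at the endpoints because
   [T > 0], so it cannot lie inside a null set. *)
pose a := Num.max 0 (t - d / 2); pose b := Num.min T (t + d / 2).
case/andP: (tT) => t0 tT'.
have [a0 ta] : 0 <= a /\ t - d / 2 <= a by rewrite /a !le_max !lexx orbT.
have [bT bt] : b <= T /\ b <= t + d / 2 by rewrite /b !ge_min !lexx orbT.
have ab : a < b.
  rewrite /a /b gt_max !lt_min T0 /=; apply/andP; split; first by lra_from sol t0 d0.
  by apply/andP; split; [lra_from sol tT' d0|lra_from sol d0].
have [s /andP[as_ sb] Ns] := null_set_gap mN N0 ab.
have sT : 0 <= s <= T by rewrite (le_trans a0 as_) (le_trans sb bT).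
have := good s k; rewrite timeIE => /(_ sT Ns k0) H.
apply: (@le_trans _ _ (\int[mu]_x (`|Rf (s, x)| * \1_`[- k, k] x + e / (2 * k + 1) * \1_`[- k, k] x))%R).
  apply: Rintegral_tame_le; [exact: tR|apply: tameD; first exact: tR|].
    by apply: tameZ; exact: (@tame_indic _ _ k).
  move=> x; rewrite indicE; case: (boolP (_ \in _)); rewrite ?mulr0 ?addr0// !mulr1.
  rewrite inE /= in_itv/= -ler_norml => xk.
  have := Hd t s x x tT sT xk xk.
  rewrite subrr normr0 => /(_ _ d0) {}Hd.
  have /Hd {}Hd : `|t - s| < d.
    rewrite ltr_norml; apply/andP; split; first by lra_from sol sb bt d0.
    by lra_from sol as_ ta d0.
  have := ler_normD (Rf (t, x) - Rf (s, x)) (Rf (s, x)); rewrite subrK => H'.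
  by apply: (le_trans H'); rewrite addrC lerD2l ltW.
rewrite Rintegral_tameD; [|exact: tR|by apply: tameZ; exact: (@tame_indic _ _ k)].
apply: lerD => //.
rewrite Rintegral_tameZ; last exact: (@tame_indic _ _ k).
rewrite Rintegral_indic_itv lebesgue_measure_itv/= lte_fin.
case: ltP => /= kk; last by rewrite mulr0 ltW.
have k1 : 0 < 2 * k + 1 by lra_from sol k0.
by rewrite opprK mulrAC ler_pdivrMr// ler_pM2l//; lra_from sol k0.
Qed.

End front.

(** * Smooth functions and mollifiers *)

Section smooth.
Context {R : realType}.
Implicit Types (f g : R -> R) (n k : nat) (x y e : R).

Fixpoint Cn n f : Prop :=
  if n is m.+1 then exists2 g : R -> R, (forall x : R, is_derive x 1 f (g x)) & Cn m g
  else continuous f.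

Definition smooth f : Prop := forall n, Cn n f.

Lemma is_derive_continuous f g : (forall x : R, is_derive x 1 f (g x)) -> continuous f.
Proof.
by move=> fg x; apply/differentiable_continuous/derivable1_diffP; case: (fg x).
Qed.

Lemma Cn_continuous n f : Cn n f -> continuous f.
Proof. by case: n => [//|n] [g fg _]; exact: is_derive_continuous fg. Qed.

Lemma CnW n f : Cn n.+1 f -> Cn n f.
Proof.
elim: n f => [|n IH] f; first exact: Cn_continuous.
by move=> [g fg /IH Cg]; exists g.
Qed.

Lemma CnD n f g : Cn n f -> Cn n g -> Cn n (f + g).
Proof.
elim: n f g => [|n IH] f g.
  by move=> cf cg x; apply: continuousD; [exact: cf|exact: cg].
move=> [f' ff' Cf'] [g' gg' Cg']; exists (f' + g'); last exact: IH.
by move=> x; exact: is_deriveD.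
Qed.

Lemma CnM n f g : Cn n f -> Cn n g -> Cn n (f * g).
Proof.
elim: n f g => [|n IH] f g.
  by move=> cf cg x; apply: continuousM; [exact: cf|exact: cg].
move=> Cf Cg; have Cf0 := CnW Cf; have Cg0 := CnW Cg.
case: Cf Cg => [f' ff' Cf'] [g' gg' Cg']; exists (f * g' + g * f').
  by move=> x; exact: is_deriveM.
by apply: CnD; exact: IH.
Qed.

Lemma Cn_cst n (c : R) : Cn n (cst c).
Proof.
elim: n c => [|n IH] c; first exact: cst_continuous.
by exists (cst 0) => // x; exact: is_derive_cst.
Qed.

Lemma Cn_affine n f (a b : R) : Cn n f -> Cn n (fun x => f (a + b * x)).
Proof.
have Daff (x : R) := is_derive_affine a b x.
elim: n f => [|n IH] f.
  move=> cf x; apply: (@continuous_comp _ _ _ (fun x => a + b * x) f); last exact: cf.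
  exact: (is_derive_continuous Daff).
move=> [g fg /IH Cg]; exists (cst b * (fun x => g (a + b * x))).
  move=> x; rewrite fctE /= mulrC; have := fg (a + b * x) => D.
  exact: (@is_derive1_comp _ f (fun x => a + b * x)).
by apply: CnM => //; exact: Cn_cst.
Qed.

Lemma smooth_derive f : smooth f ->
  exists2 g : R -> R, (forall x : R, is_derive x 1 f (g x)) & smooth g.
Proof.
move=> sf; have [g0 fg0 _] := sf 1%N.
exists g0 => // n; have [g fg Cg] := sf n.+1.
suff -> : g0 = g by [].
by apply/funext => x; rewrite -(@derive_val _ _ _ _ _ _ _ (fg0 x)) derive_val.
Qed.

Lemma smooth_from f g : (forall x : R, is_derive x 1 f (g x)) -> smooth g -> smooth f.
Proof. by move=> fg sg [|n]; [exact: is_derive_continuous fg|exists g]. Qed.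

(** The powers of [x^-1] in front of [exp (- 1 / x)] make the family closed under differentiation,
    so one induction gives smoothness of all members. *)
Definition flat k (x : R) : R :=
  if 0 < x then x^-1 ^+ k * expR (- x^-1) else 0.

Lemma flat_ge0 k x : 0 <= flat k x.
Proof.
rewrite /flat; case: ifPn => // x0.
by rewrite mulr_ge0 ?expR_ge0// exprn_ge0// invr_ge0 ltW.
Qed.

Lemma flat_gt0 k x : 0 < x -> 0 < flat k x.
Proof. by move=> x0; rewrite /flat x0 mulr_gt0 ?expR_gt0// exprn_gt0// invr_gt0. Qed.

(** With [u = 1 / x], a single term of the exponential series gives
    [u ^ (k + 2) <= (k + 2)! * exp u]. The quadratic bound is what makes the derivative at [0] exist
    and vanish. *)
Lemma flat_le k x : flat k x <= (k.+2)`!%:R * x ^+ 2.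
Proof.
rewrite /flat; case: ifPn => [x0|_]; last first.
  by rewrite mulr_ge0// sqr_ge0.
have u0 : 0 < x^-1 by rewrite invr_gt0.
set u := x^-1 in u0 *; have -> : x = u^-1 by rewrite /u invrK.
clearbody u.
have := expR_ge1Dxn k.+1 (ltW u0).
rewrite expRN ler_pdivrMr ?expR_gt0// => H.
have {H} : u ^+ k.+2 / k.+2`!%:R <= expR u by lra.
rewrite ler_pdivrMr ?ltr0n ?fact_gt0// => H.
rewrite mulrAC exprVn ler_pdivlMr ?exprn_gt0//.
by rewrite -exprD addn2 mulrC.
Qed.

Lemma is_derive_flat k (x : R) :
  is_derive x 1 (flat k) (- k%:R * flat k.+1 x + flat k.+2 x).
Proof.
have [x0|x0|x0] := ltrgt0P x.
- have -> : - k%:R * flat k.+1 x + flat k.+2 x =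
      ((@GRing.inv R) ^+ k) x *: (expR (- x^-1) * - (- x ^- 2 *: 1)) +
      (expR \o (- (@GRing.inv R))) x *: ((k%:R * x^-1 ^+ k.-1) *: (- x ^- 2 *: 1)).
    rewrite /flat x0 fctE /= !fctE /= -exprVn; set u := x^-1; set E := expR _.
    rewrite -![_ *: _]/(_ * _); case: k => [|k] /=; rewrite ?exprS; ring.
  have Dinv : is_derive x 1 (@GRing.inv R) (- x ^- 2 *: 1).
    by apply: (is_deriveV (f := id)); rewrite gt_eqF.
  apply: (near_eq_is_derive (f := (@GRing.inv R) ^+ k * (expR \o (- (@GRing.inv R))))).
    near=> y; rewrite /flat ifT ?fctE//=; last by near: y; exact: lt_nbhsr.
- apply: (near_eq_is_derive (f := cst 0)).
    near=> y; rewrite /flat ifF//; apply/negbTE; rewrite -leNgt ltW//.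
    by near: y; exact: lt_nbhsl.
  rewrite /flat !ifF ?mulr0 ?addr0; [exact: is_derive_cst|..];
  by apply/negbTE; rewrite -leNgt ltW.
- rewrite x0.
  have f0 j : flat j 0 = 0 by rewrite /flat ltxx.
  rewrite !f0 mulr0 addr0.
  (* Carathéodory's criterion at [0]: the factor [flat k z / z] takes the value [0] at [0], as
     division by zero yields [0], and is bounded by [(k + 2)! * |z|] nearby. *)
  apply/is_derive1_caratheodory; exists (fun z => flat k z / z).
  rewrite invr0 mulr0; split => //.
    by move=> z; rewrite f0 !subr0; have [->|z0] := eqVneq z 0; rewrite ?mulr0 ?f0// divfK.
  apply/cvgrPdist_le => e e0; rewrite invr0 mulr0; near=> z.
  rewrite sub0r normrN normrM.
  have [->|z0] := eqVneq z 0; first by rewrite invr0 normr0 mulr0 ltW.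
  rewrite normfV ger0_norm ?flat_ge0// ler_pdivrMr ?normr_gt0//.
  apply: (le_trans (flat_le k z)); rewrite -real_normK ?num_real// expr2 mulrA.
  rewrite ler_wpM2r// -ler_pdivlMl ?ltr0n ?fact_gt0//.
  near: z; exists ((k.+2)`!%:R^-1 * e) => /=.
    by rewrite mulr_gt0// invr_gt0 ltr0n fact_gt0.
  by move=> z /=; rewrite sub0r normrN => /ltW.
Unshelve. all: by end_near. Qed.

Lemma smooth_flat k : smooth (flat k).
Proof.
move=> n; elim: n k => [|n IH] k; first exact: is_derive_continuous (is_derive_flat k).
exists (cst (- k%:R) * flat k.+1 + flat k.+2); first exact: is_derive_flat.
by apply: CnD; [apply: CnM; [exact: Cn_cst|exact: IH]|exact: IH].
Qed.

(** Positive exactly on []-1, 1[]. The arguments are kept in the form [a + b * x] to match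
    [Cn_affine]. *)
Definition bump (x : R) : R := flat 0 (1 + 1 * x) * flat 0 (1 + (-1) * x).

Lemma smooth_bump : smooth bump.
Proof.
by move=> n; apply: CnM; apply: (@Cn_affine _ (flat 0)); exact: smooth_flat.
Qed.

Lemma bump_ge0 x : 0 <= bump x.
Proof. by rewrite mulr_ge0// flat_ge0. Qed.

Lemma bump_gt0 x : `|x| < 1 -> 0 < bump x.
Proof.
by rewrite ltr_norml => /andP[? ?]; apply: mulr_gt0; apply: flat_gt0; lra.
Qed.

Lemma bump_eq0 x : 1 <= `|x| -> bump x = 0.
Proof.
rewrite /bump /flat leNgt ltr_norml negb_and -!leNgt => /orP[x1|x1].
  by rewrite ifF ?mul0r//; apply/negbTE; rewrite -leNgt; lra.
by rewrite [X in _ * X]ifF ?mulr0//; apply/negbTE; rewrite -leNgt; lra.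
Qed.

Notation mu := (@lebesgue_measure R).

(** A primitive of [bump]. Starting at [-2], to the left of the support, leaves room for the
    fundamental theorem at every [x >= -1]; below that the integral is [0]. *)
Definition bump_step (x : R) : R := (\int[mu]_(y in `[-2, x]) bump y)%R.

Lemma bump_step_le x : x <= -1 -> bump_step x = 0.
Proof.
move=> x1; rewrite /bump_step (@eq_Rintegral _ _ _ _ _ (fun=> 0)).
  by rewrite Rintegral_cst// mul0r.
move=> y; rewrite inE /= in_itv/= => /andP[_ yx]; rewrite bump_eq0//.
by rewrite ler_normr; apply/orP; right; lra.
Qed.

Lemma is_derive_bump_step (x : R) : is_derive x 1 bump_step (bump x).
Proof.
have cb : continuous bump := Cn_continuous (smooth_bump 0).
have [x1|x1] := ltP x (-1).
  rewrite bump_eq0; last by rewrite ler_normr; apply/orP; right; lra.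
  apply: (near_eq_is_derive (f := cst 0)).
  near=> y; rewrite bump_step_le// ltW//.
  by near: y; exact: lt_nbhsl.
have [dS DS] : derivable bump_step x 1 /\ derive1 bump_step x = bump x.
  apply: (@continuous_FTC1_closed _ bump (-2) x (x + 1)).
  - lra.
  - apply: continuous_compact_integrable; first exact: segment_compact.
    exact: continuous_subspaceT.
  - lra.
  - exact: cb.
by rewrite -DS derive1E; apply: DeriveDef; first exact: dS.
Unshelve. all: by end_near. Qed.

Lemma is_derive_MVT f g (a b : R) : a < b ->
  (forall x, a <= x <= b -> is_derive x 1 f (g x)) ->
  exists2 c, a < c < b & f b - f a = g c * (b - a).
Proof.
move=> ab fg.
have fg' (x : R) : x \in `]a, b[ -> is_derive x 1 f (g x).
  by rewrite in_itv/= => /andP[? ?]; apply: fg; rewrite !ltW.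
have cf : {within `[a, b], continuous f}.
  by apply: derivable_within_continuous => x; rewrite in_itv/= => /fg [].
have [c cab E] := MVT ab fg' cf.
by exists c => //; move: cab; rewrite in_itv.
Qed.

Definition bump_mass : R := bump_step 1.

Lemma bump_step_nondecreasing x y : x <= y -> bump_step x <= bump_step y.
Proof.
rewrite le_eqVlt => /predU1P[->//|xy].
have [z _ E] := is_derive_MVT xy (fun z _ => is_derive_bump_step z).
by rewrite -subr_ge0 E mulr_ge0 ?bump_ge0// subr_ge0 ltW.
Qed.

Lemma bump_step_ge x : 1 <= x -> bump_step x = bump_mass.
Proof.
rewrite le_eqVlt => /predU1P[<-//|x1].
have [z /andP[z1 _] E] := is_derive_MVT x1 (fun z _ => is_derive_bump_step z).
apply/eqP; rewrite -subr_eq0 E bump_eq0 ?mul0r//.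
by rewrite ler_normr ltW.
Qed.

Lemma bump_mass_gt0 : 0 < bump_mass.
Proof.
have h1 : - 2^-1 < 2^-1 :> R by lra.
have [z /andP[z1 z2] E] := is_derive_MVT h1 (fun z _ => is_derive_bump_step z).
have z0 : 0 < bump z by apply: bump_gt0; rewrite ltr_norml; apply/andP; split; lra.
have H1 : bump_step 2^-1 <= bump_mass by apply: bump_step_nondecreasing; lra.
have H2 : bump_step (-1) <= bump_step (- 2^-1) by apply: bump_step_nondecreasing; lra.
move: H2; rewrite bump_step_le// => H2.
have H3 : 0 < bump_step 2^-1 - bump_step (- 2^-1) by rewrite E mulr_gt0//; lra.
lra.
Qed.

Lemma bump_step_bounds x : 0 <= bump_step x <= bump_mass.
Proof.
apply/andP; split.
  have [x1|x1] := leP x (-1); first by rewrite bump_step_le.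
  by rewrite -(bump_step_le (lexx (-1))) bump_step_nondecreasing// ltW.
have [x1|x1] := leP 1 x; first by rewrite bump_step_ge.
by rewrite bump_step_nondecreasing// ltW.
Qed.

Lemma smooth_bump_step : smooth bump_step.
Proof. exact: smooth_from is_derive_bump_step smooth_bump. Qed.

Lemma Rintegral_derive f g (a b : R) : a < b ->
  (forall x : R, is_derive x 1 f (g x)) -> continuous g ->
  (forall x, ~~ (a <= x <= b) -> g x = 0) ->
  (\int[mu]_x g x = f b - f a)%R.
Proof.
move=> ab fg cg g0.
have -> : g = g \_ `[a, b].
  apply/funext => x; rewrite patchE; case: ifPn => //.
  by rewrite notin_setE /= in_itv/= => /negP /g0.
rewrite -Rintegral_mkcond /Rintegral (@continuous_FTC2 _ g f)//.
- exact: continuous_subspaceT.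
- split.
  + by move=> x _; case: (fg x).
  + apply: cvg_at_right_filter; exact: (is_derive_continuous fg).
  + apply: cvg_at_left_filter; exact: (is_derive_continuous fg).
- by move=> x _; rewrite derive1E derive_val.
Qed.

Definition mollifier (y e x : R) : R :=
  (bump_mass * e)^-1 * bump (- (y / e) + e^-1 * x).

Lemma mollifier_ge0 y e x : 0 < e -> 0 <= mollifier y e x.
Proof.
move=> e0; rewrite mulr_ge0 ?bump_ge0// invr_ge0 mulr_ge0 ?ltW//.
exact: bump_mass_gt0.
Qed.

Lemma smooth_mollifier y e : smooth (mollifier y e).
Proof.
by move=> n; apply: CnM; [exact: Cn_cst|apply: (@Cn_affine _ bump); exact: smooth_bump].
Qed.

Lemma mollifier_eq0 y e x : 0 < e -> e <= `|x - y| -> mollifier y e x = 0.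
Proof.
move=> e0 exy; rewrite /mollifier bump_eq0 ?mulr0//.
have -> : - (y / e) + e^-1 * x = (x - y) / e by ring.
by rewrite normrM normfV (gtr0_norm e0) ler_pdivlMr ?mul1r.
Qed.

Lemma is_derive_mollifier_step y e (x : R) : 0 < e ->
  is_derive x 1 (fun x => bump_mass^-1 * bump_step (- (y / e) + e^-1 * x))
    (mollifier y e x).
Proof.
move=> e0.
have D1 := is_derive_affine (- (y / e)) e^-1 x.
have D2 := is_derive_bump_step (- (y / e) + e^-1 * x).
have D3 := @is_derive1_comp _ bump_step (fun x => - (y / e) + e^-1 * x) _ _ _ D2 D1.
have D4 := is_deriveZ bump_mass^-1 D3.
apply: (is_derive_eq D4).
by rewrite /mollifier invfM -![_ *: _]/(_ * _); ring.
Qed.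

Lemma tame_mollifier y e : 0 < e -> tame (mollifier y e).
Proof.
move=> e0; apply: (@tame_continuous _ _ (`|y| + e)).
  exact: Cn_continuous (smooth_mollifier y e 0).
move=> x H; apply: mollifier_eq0 => //.
have := ler_normD (x - y) y; rewrite subrK; lra.
Qed.

Lemma Rintegral_mollifier y e : 0 < e -> (\int[mu]_x mollifier y e x = 1)%R.
Proof.
move=> e0; have ab : y - e < y + e by lra.
have ye (s : R) : - (y / e) + e^-1 * (y + s * e) = s.
  by field; rewrite gt_eqF.
rewrite (Rintegral_derive ab (fun x => is_derive_mollifier_step y x e0)).
- have := ye 1; have := ye (-1); rewrite mulN1r mul1r => -> ->.
  rewrite (bump_step_le (lexx _)) mulr0 subr0 mulVf//.
  by rewrite gt_eqF// bump_mass_gt0.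
- exact: Cn_continuous (smooth_mollifier y e 0).
- move=> x xy; apply: mollifier_eq0 => //; rewrite leNgt ltr_norml.
  by apply: contra xy => /andP[? ?]; apply/andP; split; lra.
Qed.

Lemma mollifier_approx f y e (k : R) : 0 < e -> continuous f ->
  (forall x, `|x - y| <= e -> `|f x - f y| <= k) ->
  (`|\int[mu]_x (f x * mollifier y e x) - f y| <= k)%R.
Proof.
move=> e0 cf fk.
have k0 : 0 <= k by have := fk y; rewrite !subrr normr0; apply; exact: ltW.
have tm := tame_mollifier y e0.
have tfm := tameMc cf tm.
have -> : f y = (\int[mu]_x (f y * mollifier y e x))%R.
  by rewrite Rintegral_tameZ// Rintegral_mollifier// mulr1.
rewrite -Rintegral_tameB//; last exact: tameZ.
have td : tame (fun x => f x * mollifier y e x - f y * mollifier y e x).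
  by apply: tameB => //; exact: tameZ.
apply: (@le_trans _ _ (\int[mu]_x `|f x * mollifier y e x - f y * mollifier y e x|)%R).
  by apply: le_normr_Rintegral => //; exact: tame_integrable.
rewrite -[leRHS]mulr1 -(Rintegral_mollifier y e0) -Rintegral_tameZ//.
apply: Rintegral_tame_le; [exact: tame_norm|exact: tameZ|].
move=> x; rewrite -mulrBl normrM (ger0_norm (mollifier_ge0 _ _ e0)).
have [xy|/ltW xy] := leP `|x - y| e.
  by rewrite ler_wpM2r// ?mollifier_ge0// fk.
by rewrite mollifier_eq0// !mulr0.
Qed.

End smooth.

(** * Second differences and cutoff functions *)

Section cutoff.
Context {R : realType}.
Implicit Types (f g : R -> R) (x y e : R).

Lemma support_derive f g (M : R) : (forall x : R, is_derive x 1 f (g x)) ->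
  (forall x, M < `|x| -> f x = 0) -> forall x, M < `|x| -> g x = 0.
Proof.
move=> fg f0 x Mx; have D0 : is_derive x 1 f 0.
  apply: (near_eq_is_derive (f := cst 0)).
  near=> y; rewrite f0//=; near: y.
  have cn : {for x, continuous (@Num.norm R R)} by exact: norm_continuous.
  exact: (cvgr_gt _ cn).
by rewrite -(@derive_val _ _ _ _ _ _ _ (fg x)) derive_val.
Unshelve. all: by end_near. Qed.

Lemma is_derive_comp_affine f (a b x d : R) : is_derive (a + b * x) 1 f d ->
  is_derive x 1 (fun y : R => f (a + b * y)) (b * d).
Proof.
move=> fd; rewrite mulrC.
exact: (@is_derive1_comp _ f (fun s : R => a + b * s) _ _ _ fd (is_derive_affine a b x)).
Qed.

(** The mean value theorem applies first to [u |-> f (u + e) - f u] and then to [g]. *)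
Lemma second_difference f g (h : R -> R) x e : 0 < e ->
  (forall x : R, is_derive x 1 f (g x)) -> (forall x : R, is_derive x 1 g (h x)) ->
  exists2 z, `|z - x| < e & f (x + e) - 2 * f x + f (x - e) = h z * e ^+ 2.
Proof.
move=> e0 fg gh.
pose F (u : R) := f (u + e) - f u.
have DF (u : R) : is_derive u 1 F (g (u + e) - g u).
  have D1 : is_derive u 1 (fun v : R => v + e) 1.
    have H : is_derive u 1 (@id R + cst e) (1 + 0) by exact: is_deriveD.
    by apply: is_derive_eq; rewrite addr0.
  have := @is_derive1_comp _ f (fun v : R => v + e) u _ _ (fg (u + e)) D1.
  by rewrite mulr1 => D2; exact: is_deriveB D2 (fg u).
have xe : x - e < x by lra.
have [c /andP[xc cx] E1] := is_derive_MVT xe (fun u _ => DF u).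
have ce : c < c + e by lra.
have [z /andP[cz ze] E2] := is_derive_MVT ce (fun u _ => gh u).
exists z; first by rewrite ltr_norml; apply/andP; split; lra.
have -> : f (x + e) - 2 * f x + f (x - e) = F x - F (x - e).
  by rewrite /F subrK; ring.
by rewrite E1 E2; ring.
Qed.

(** A fixed profile is dilated by [n]; two derivatives produce the factor [1 / n ^ 2], and [C] comes
    from the profile alone. *)
Lemma cutoff_exists : exists2 C : R, 0 < C & forall n : R, 0 < n ->
  exists chi chi1 chi2 : R -> R,
  [/\ smooth chi, forall x : R, is_derive x 1 chi (chi1 x),
      forall x : R, is_derive x 1 chi1 (chi2 x),
      (forall x, `|x| <= n -> chi x = 1) /\ (forall x, 3 * n < `|x| -> chi x = 0) &
      (forall x, 0 <= chi x <= 1) /\ (forall x, `|chi2 x| <= C / n ^+ 2)].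
Proof.
(* The two steps are both [1] exactly where [2 + x >= 1] and [2 - x >= 1], that is on [[-1, 1]], and
   one of them vanishes beyond [[-3, 3]]. *)
pose k x : R := bump_mass^-1 * bump_step (2 + 1 * x) *
                (bump_mass^-1 * bump_step (2 + (-1) * x)).
have c0 := @bump_mass_gt0 R.
have sk : smooth k.
  move=> n; apply: CnM; apply: CnM; try exact: Cn_cst;
  by apply: (@Cn_affine _ _ bump_step); exact: smooth_bump_step.
have sb x : 0 <= bump_mass^-1 * bump_step x <= 1.
  have /andP[? ?] := bump_step_bounds x; apply/andP; split.
    by rewrite mulr_ge0// invr_ge0 ltW.
  by rewrite mulrC ler_pdivrMr// mul1r.
have k1 x : `|x| <= 1 -> k x = 1.
  rewrite ler_norml => /andP[? ?]; rewrite /k !bump_step_ge; [|lra..].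
  by rewrite mulVf ?mulr1// gt_eqF.
have k0 x : 3 < `|x| -> k x = 0.
  rewrite ltNge ler_norml negb_and -!ltNge => /orP[?|?].
    by rewrite /k bump_step_le ?mulr0 ?mul0r//; lra.
  by rewrite /k (@bump_step_le _ (2 + -1 * x)) ?mulr0//; lra.
have kb x : 0 <= k x <= 1.
  have /andP[? ?] := sb (2 + 1 * x); have /andP[? ?] := sb (2 + (-1) * x).
  by apply/andP; split; [exact: mulr_ge0|exact: mulr_ile1].
have [g kg sg] := smooth_derive sk; have [h gh sh] := smooth_derive sg.
have h0 := support_derive gh (support_derive kg k0).
have [C HC] := continuous_bounded_itv 3 (Cn_continuous (sh 0)).
have hC x : `|h x| <= `|C| + 1.
  have [/HC H|/h0 ->] := leP `|x| 3; first by have := ler_norm C; lra.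
  by rewrite normr0 addr_ge0.
exists (`|C| + 1); first by have := normr_ge0 C; lra.
move=> n n0; have nN0 : n != 0 by rewrite gt_eqF.
exists (fun x => k (0 + n^-1 * x)), (n^-1 \*: (fun x => g (0 + n^-1 * x))),
  (n^-1 \*: (n^-1 \*: (fun x => h (0 + n^-1 * x)))).
have nE x : `|0 + n^-1 * x| = `|x| / n.
  by rewrite add0r normrM normfV (gtr0_norm n0) mulrC.
split.
- by move=> m; apply: (@Cn_affine _ _ k); exact: sk.
- by move=> x; exact: is_derive_comp_affine.
- by move=> x; apply: is_deriveZ; exact: is_derive_comp_affine.
- split=> x xn; [apply: k1|apply: k0]; rewrite nE.
    by rewrite ler_pdivrMr// mul1r.
  by rewrite ltr_pdivlMr.
- split=> x; first exact: kb.
  rewrite -[(_ \*: _) x]/(n^-1 * (n^-1 * h (0 + n^-1 * x))) !normrM.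
  rewrite !normfV (gtr0_norm n0) expr2 invfM mulrA mulrC [leRHS]mulrA.
  by rewrite -!mulrA ler_wpM2r ?hC//; apply: mulr_ge0; rewrite invr_ge0 ltW.
Qed.

End cutoff.

(** * Weak derivatives in time *)

Section tensor.
Context {R : realType}.
Notation mu := (@lebesgue_measure R).
Implicit Types (a f : R -> R).

(** Test functions with separated variables suffice: the factor in time leaves the inner integral,
    and the weak equation becomes a weak derivative in time of an integral over space. *)
Definition tensor a f : R * R -> R := fun z => a z.1 * f z.2.

Lemma tensor_continuous a f : continuous a -> continuous f ->
  continuous (tensor a f).
Proof.
move=> ca cf z; apply: continuousM.
  apply: (@continuous_comp _ _ _ fst a); [exact: cvg_fst|exact: ca].
apply: (@continuous_comp _ _ _ snd f); [exact: cvg_snd|exact: cf].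
Qed.

Lemma is_derive_tensor_tau a a' f (t x : R) : (forall t : R, is_derive t 1 a (a' t)) ->
  is_derive t 1 (fun s => tensor a f (s, x)) (tensor a' f (t, x)).
Proof.
move=> aa'; have := is_deriveZ (f x) (aa' t).
rewrite (_ : _ \*: _ = (fun s => tensor a f (s, x))); last first.
  by apply/funext => s; rewrite /tensor /= mulrC.
by rewrite /tensor/= mulrC.
Qed.

Lemma is_derive_tensor_xi a f f' (t x : R) : (forall x : R, is_derive x 1 f (f' x)) ->
  is_derive x 1 (fun y => tensor a f (t, y)) (tensor a f' (t, x)).
Proof. by move=> ff'; exact: (@is_deriveZ _ _ _ f (a t) x 1 _ (ff' x)). Qed.

Lemma d_tau_tensor a a' f : (forall t : R, is_derive t 1 a (a' t)) ->
  d_tau (tensor a f) = tensor a' f.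
Proof.
move=> aa'; apply/funext => -[t x]; rewrite d_tau_slice.
exact: (@derive_val _ _ _ _ _ _ _ (is_derive_tensor_tau f t x aa')).
Qed.

Lemma d_xi_tensor a f f' : (forall x : R, is_derive x 1 f (f' x)) ->
  d_xi (tensor a f) = tensor a f'.
Proof.
move=> ff'; apply/funext => -[t x]; rewrite d_xi_slice.
exact: (@derive_val _ _ _ _ _ _ _ (is_derive_tensor_xi a t x ff')).
Qed.

Lemma Ck_tensor n a f : smooth a -> smooth f -> Ck n (tensor a f).
Proof.
elim: n a f => [|n IH] a f sa sf.
  by split => //; apply: tensor_continuous; [exact: (sa 0)|exact: (sf 0)].
have [a' aa' sa'] := smooth_derive sa; have [f' ff' sf'] := smooth_derive sf.
split; first by apply: tensor_continuous; [exact: (sa 0)|exact: (sf 0)].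
split.
- move=> -[t x]; apply/derivable_slice1.
  by have [] := is_derive_tensor_tau f t x aa'.
- move=> -[t x]; apply/derivable_slice2.
  by have [] := is_derive_tensor_xi a t x ff'.
- by rewrite (d_tau_tensor f aa'); exact: IH.
- by rewrite (d_xi_tensor a ff'); exact: IH.
Qed.

Lemma test_function_tensor (T l M : R) a f : 0 < l -> smooth a -> smooth f ->
  (forall t, ~~ (l <= t <= T - l) -> a t = 0) ->
  (forall x, M < `|x| -> f x = 0) -> test_function T (tensor a f).
Proof.
move=> l0 sa sf a0 f0.
pose K : set (R * R) := `[l, T - l] `*` `[- M, M].
have cK : compact K by apply: compact_setX; exact: segment_compact.
have clK : closed K by apply: compact_closed => //; exact: norm_hausdorff.
have sub : closure [set z | tensor a f z != 0] `<=` K.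
  rewrite [X in _ `<=` X](closure_id K).1//; apply: closure_subset => -[t x] /=.
  rewrite /tensor/= mulf_eq0 negb_or => /andP[a_0 f_0].
  split; rewrite /= in_itv/=; first by apply: contraNT a_0 => /a0 ->.
  by rewrite -ler_norml leNgt; apply: contraNN f_0 => /f0 ->.
split; first by move=> n; exact: Ck_tensor.
- by apply: subclosed_compact cK sub; exact: closed_closure.
- apply: (subset_trans sub) => -[t x] [/=]; rewrite !in_itv/= => /andP[? ?] _.
  by split; rewrite //= in_itv/=; apply/andP; split; lra.
Qed.

End tensor.

(** * From weak derivatives in time to increments *)

Section du_bois_reymond.
Context {R : realType}.
Notation mu := (@lebesgue_measure R).
Implicit Types (a f g h : R -> R) (s t T : R).

(** Composition with [clamp T] extends a function from [[0, T]] to the line by constants, so that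
    its unconstrained outside values never enter and continuity on [[0, T]] becomes continuity
    everywhere. *)
Definition clamp T t : R := Num.max 0 (Num.min T t).

Lemma clamp_itv T t : 0 <= T -> 0 <= clamp T t <= T.
Proof. by move=> T0; rewrite /clamp le_max lexx/= ge_max T0 ge_min lexx. Qed.

Lemma clamp_id T t : 0 <= t <= T -> clamp T t = t.
Proof. by move=> /andP[t0 tT]; rewrite /clamp (min_idPr tT) (max_idPr t0). Qed.

Lemma clamp_lipschitz T s t : 0 <= T -> `|clamp T s - clamp T t| <= `|s - t|.
Proof.
move=> T0.
wlog st : s t / s <= t => [H|].
  have [/H//|/ltW/H] := leP s t; by rewrite distrC [in leRHS]distrC.
rewrite [leRHS]distrC [leRHS]ger0_norm ?subr_ge0//.
have [m0 m1] : Num.min T s <= Num.min T t /\ Num.min T t - Num.min T s <= t - s.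
  by rewrite /Num.min; case: (ltP T s) => ?; case: (ltP T t) => ?; split; lra.
rewrite /clamp; move: (Num.min T s) (Num.min T t) m0 m1 => u v m0 m1.
rewrite distrC ger0_norm ?subr_ge0 /Num.max.
  by case: (ltP 0 u) => ?; case: (ltP 0 v) => ?; lra.
by case: (ltP 0 u) => ?; case: (ltP 0 v) => ?; lra.
Qed.

Definition itv_continuous T f : Prop := forall e : R, 0 < e ->
  exists2 d : R, 0 < d & forall s t, 0 <= s <= T -> 0 <= t <= T ->
    `|s - t| < d -> `|f s - f t| < e.

Lemma itv_continuousB T f g : itv_continuous T f -> itv_continuous T g ->
  itv_continuous T (fun t => f t - g t).
Proof.
move=> cf cg e e0; have e20 : 0 < e / 2 by rewrite divr_gt0.
have [d1 d10 H1] := cf _ e20; have [d2 d20 H2] := cg _ e20.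
exists (Num.min d1 d2); first by rewrite lt_min d10.
move=> s t sT tT; rewrite lt_min => /andP[st1 st2].
have := H1 s t sT tT st1; have := H2 s t sT tT st2.
by rewrite !ltr_norml => /andP[? ?] /andP[? ?]; apply/andP; split; lra.
Qed.

Lemma continuous_clamp T f : 0 <= T -> itv_continuous T f ->
  continuous (fun t => f (clamp T t)).
Proof.
move=> T0 cf t; apply/cvgrPdist_lt => e e0; have [d d0 H] := cf e e0.
near=> s; apply: H; rewrite ?clamp_itv//.
apply: (le_lt_trans (clamp_lipschitz _ _ T0)).
by near: s; exact: cvgr_dist_lt.
Unshelve. all: by end_near. Qed.

Lemma Rintegral_clamp T a f : 0 <= T ->
  (forall t, ~~ (0 <= t <= T) -> a t = 0) ->
  (\int[mu]_(t in timeI T) (a t * f t) = \int[mu]_t (a t * f (clamp T t)))%R.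
Proof.
move=> T0 a0; rewrite Rintegral_mkcond; apply: eq_Rintegral => t _.
rewrite patchE; case: ifPn; rewrite ?notin_setE ?inE timeIE.
  by move=> tT; rewrite clamp_id.
by move=> /negP /a0 ->; rewrite mul0r.
Qed.

Lemma clamp_modulus T f e : 0 <= T -> itv_continuous T f -> 0 < e ->
  exists2 d : R, 0 < d & forall s r, 0 <= s <= T -> `|r - s| < d ->
    `|f (clamp T r) - f (clamp T s)| < e.
Proof.
move=> T0 cf e0; have [d d0 H] := cf _ e0; exists d => // s r sT rs.
by apply: H; rewrite ?clamp_itv//; exact: le_lt_trans (clamp_lipschitz _ _ T0) rs.
Qed.

(** A smooth substitute for the indicator of [[s, t]]: it is a primitive of the mollifier at [s]
    minus the mollifier at [t], so testing with it produces the increment between these two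
    times. *)
Definition plateau s t e r : R :=
  bump_mass^-1 * bump_step (- (s / e) + e^-1 * r) -
  bump_mass^-1 * bump_step (- (t / e) + e^-1 * r).

Lemma is_derive_plateau s t e (r : R) : 0 < e ->
  is_derive r 1 (plateau s t e) (mollifier s e r - mollifier t e r).
Proof.
move=> e0; exact: is_deriveB (is_derive_mollifier_step s r e0)
  (is_derive_mollifier_step t r e0).
Qed.

Lemma smooth_plateau s t e : 0 < e -> smooth (plateau s t e).
Proof.
move=> e0; apply: (smooth_from (fun r => is_derive_plateau s t r e0)) => n.
apply: (@CnD _ _ _ (- mollifier t e)); first exact: smooth_mollifier.
rewrite (_ : - mollifier t e = cst (-1) * mollifier t e).
  by apply: CnM; [exact: Cn_cst|exact: smooth_mollifier].
by apply/funext => x; rewrite !fctE mulN1r.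
Qed.

Lemma plateau_step_eq1 s e r : 0 < e -> s + e <= r ->
  bump_mass^-1 * bump_step (- (s / e) + e^-1 * r) = 1.
Proof.
move=> e0 sr; rewrite bump_step_ge ?mulVf// ?gt_eqF ?bump_mass_gt0//.
by rewrite (_ : _ + _ = (r - s) / e); [rewrite ler_pdivlMr//; lra|ring].
Qed.

Lemma plateau_step_eq0 s e r : 0 < e -> r <= s - e ->
  bump_mass^-1 * bump_step (- (s / e) + e^-1 * r) = 0.
Proof.
move=> e0 sr; rewrite bump_step_le ?mulr0//.
by rewrite (_ : _ + _ = (r - s) / e); [rewrite ler_pdivrMr//; lra|ring].
Qed.

Lemma plateau_bounds s t e r : 0 < e -> s <= t -> 0 <= plateau s t e r <= 1.
Proof.
move=> e0 st; have m0 := @bump_mass_gt0 R; rewrite /plateau -mulrBr.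
have H : bump_step (- (t / e) + e^-1 * r) <= bump_step (- (s / e) + e^-1 * r).
  by apply: bump_step_nondecreasing; rewrite lerD2r lerN2 ler_wpM2r// invr_ge0 ltW.
have /andP[b1 _] := bump_step_bounds (- (t / e) + e^-1 * r).
have /andP[_ b2] := bump_step_bounds (- (s / e) + e^-1 * r).
apply/andP; split; first by rewrite mulr_ge0 ?subr_ge0// invr_ge0 ltW.
by rewrite mulrC ler_pdivrMr// mul1r (le_trans _ b2)// gerBl.
Qed.

(** The plateau differs from the indicator only within [e] of [s] or of [t]. These are two windows
    of length [2 * e], each with an error of at most [B + |g0|], whence the factor [4 * e]. *)
Lemma Rintegral_plateau s t e g (g0 eta B : R) : 0 < e -> s < t -> continuous g ->
  (forall r, s <= r <= t -> `|g r - g0| <= eta) ->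
  (forall r, s - e <= r <= t + e -> `|g r| <= B) ->
  (`|\int[mu]_r (plateau s t e r * g r) - (t - s) * g0| <=
    eta * (t - s) + 4 * e * (B + `|g0|))%R.
Proof.
move=> e0 st cg gg0 gB.
pose N : R := `|s| + `|t| + 2 * e.
have N0 : 0 <= N by rewrite !addr_ge0// mulr_ge0// ltW.
have ns := ler_norm s; have ns' := ler_norm (- s).
have nt := ler_norm t; have nt' := ler_norm (- t).
rewrite normrN in ns'; rewrite normrN in nt'.
have ti (u v : R) : s - e <= u -> v <= t + e -> tame (\1_`[u, v] : R -> R).
  move=> su vt; apply: (@tame_indic _ _ N) => // x /=; rewrite !in_itv/= => /andP[? ?].
  have := normr_ge0 s; have := normr_ge0 t; rewrite /N => *.
  by apply/andP; split; lra.
have ii (u v : R) : u <= v -> (\int[mu]_x \1_`[u, v] x = v - u)%R.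
  move=> uv; rewrite Rintegral_indic_itv lebesgue_measure_itv/= lte_fin.
  by case: ltP => //= vu; rewrite (_ : v = u) ?subrr//; apply/eqP; rewrite eq_le uv vu.
have B0 : 0 <= B by apply: le_trans (gB s _) => //; apply/andP; split; lra.
have pl0 r : ~~ (s - e <= r <= t + e) -> plateau s t e r = 0.
  rewrite negb_and -!ltNge => /orP[?|?]; rewrite /plateau.
    by rewrite !plateau_step_eq0 ?subrr//; lra.
  by rewrite !plateau_step_eq1 ?subrr//; lra.
have tp : tame (fun r => plateau s t e r * g r).
  apply: (@tame_continuous _ _ N).
    move=> r; apply: continuousM; last exact: cg.
    exact: (Cn_continuous (smooth_plateau s t e0 0)).
  move=> x Nx; rewrite pl0 ?mul0r//; apply: contraL Nx => /andP[? ?].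
  rewrite -leNgt ler_norml /N; have := normr_ge0 s; have := normr_ge0 t => *.
  by apply/andP; split; lra.
have tst : tame (\1_`[s, t] : R -> R) by apply: ti; lra.
have ts : tame (\1_`[s - e, s + e] : R -> R) by apply: ti; lra.
have tt : tame (\1_`[t - e, t + e] : R -> R) by apply: ti; lra.
pose K : R := B + `|g0|.
have K0 : 0 <= K by rewrite addr_ge0.
have eta0 : 0 <= eta by apply: le_trans (gg0 s _) => //; apply/andP; split; lra.
have -> : (t - s) * g0 = (\int[mu]_x (g0 * \1_`[s, t] x))%R.
  by rewrite Rintegral_tameZ// ii 1?mulrC// ltW.
have -> : eta * (t - s) + 4 * e * (B + `|g0|) =
    (\int[mu]_x (eta * \1_`[s, t] x +
      (K * \1_`[s - e, s + e] x + K * \1_`[t - e, t + e] x)))%R.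
  rewrite !(Rintegral_tameD, Rintegral_tameZ)//; try by repeat first [apply: tameD|apply: tameZ].
  by rewrite !ii; [rewrite -/K; ring|lra..].
rewrite -Rintegral_tameB//; last exact: tameZ.
have td := tameB tp (tameZ g0 tst).
apply: (@le_trans _ _ (\int[mu]_x `|plateau s t e x * g x - g0 * \1_`[s, t] x|)%R).
  by apply: le_normr_Rintegral => //; exact: tame_integrable.
apply: Rintegral_tame_le; first exact: tame_norm.
  by repeat first [apply: tameD|apply: tameZ].
move=> r; have /andP[p0 p1] := plateau_bounds r e0 (ltW st).
have i0 (A : set R) : 0 <= (\1_A r : R) by rewrite indicE.
have Kg : `|g0| <= K by rewrite /K lerDr.
have [rst|rst] := boolP (s <= r <= t).
  have -> : \1_`[s, t] r = 1 :> R by rewrite indicE mem_set//= in_itv.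
  rewrite !mulr1.
  have -> : plateau s t e r * g r - g0 =
      plateau s t e r * (g r - g0) - (1 - plateau s t e r) * g0 by ring.
  apply: (le_trans (ler_normB _ _)); apply: lerD.
    rewrite normrM ger0_norm// -[leRHS]mul1r ler_pM//; exact: gg0.
  rewrite normrM ger0_norm ?subr_ge0//.
  have [r1|r1] := leP r (s + e).
    have -> : \1_`[s - e, s + e] r = 1 :> R.
      by rewrite indicE mem_set//= in_itv/=; apply/andP; split; lra.
    rewrite mulr1; apply: (@le_trans _ _ (1 * `|g0|)).
      by rewrite ler_wpM2r// lerBlDr lerDl.
    by rewrite mul1r (le_trans Kg)// lerDl mulr_ge0.
  have [r2|r2] := leP (t - e) r.
    have -> : \1_`[t - e, t + e] r = 1 :> R.
      by rewrite indicE mem_set//= in_itv/=; apply/andP; split; lra.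
    rewrite mulr1; apply: (@le_trans _ _ (1 * `|g0|)).
      by rewrite ler_wpM2r// lerBlDr lerDl.
    by rewrite mul1r (le_trans Kg)// lerDr mulr_ge0.
  rewrite /plateau plateau_step_eq1 ?plateau_step_eq0; [|lra..].
  by rewrite subr0 subrr mul0r addr_ge0// mulr_ge0.
have -> : \1_`[s, t] r = 0 :> R.
  by rewrite indicE memNset//= in_itv/=; exact/negP.
rewrite !mulr0 subr0 add0r.
have [rse|rse] := boolP (s - e <= r <= t + e); last first.
  by rewrite pl0// mul0r normr0 addr_ge0// mulr_ge0.
have gK : `|plateau s t e r * g r| <= K.
  rewrite normrM ger0_norm//; apply: (@le_trans _ _ (1 * B)).
    by rewrite ler_pM// gB.
  by rewrite mul1r lerDl.
apply: (le_trans gK).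
move: rst; rewrite negb_and -!ltNge => /orP[rs|tr].
  have -> : \1_`[s - e, s + e] r = 1 :> R.
    by rewrite indicE mem_set//= in_itv/=; case/andP: rse => *; apply/andP; split; lra.
  by rewrite mulr1 lerDl mulr_ge0.
have -> : \1_`[t - e, t + e] r = 1 :> R.
  by rewrite indicE mem_set//= in_itv/=; case/andP: rse => *; apply/andP; split; lra.
by rewrite mulr1 lerDr mulr_ge0.
Qed.

Definition weak_derivative T f g : Prop :=
  forall a a' (l : R), 0 < l -> smooth a -> (forall t : R, is_derive t 1 a (a' t)) ->
    (forall t, ~~ (l <= t <= T - l) -> a t = 0) ->
  (- (\int[mu]_(t in timeI T) (a' t * f t)) = \int[mu]_(t in timeI T) (a t * g t))%R.

(** Testing with a plateau and letting its width shrink turns the weak derivative into an increment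
    of [f]. Comparing [g] with a constant [g0] avoids an integral of [g] in the conclusion, which
    suits the short time steps used later. *)
Lemma weak_derivative_increment T f g : 0 < T ->
  itv_continuous T f -> itv_continuous T g -> weak_derivative T f g ->
  forall s t (g0 eta : R), 0 <= s -> s <= t -> t <= T ->
  (forall r, s <= r <= t -> `|g r - g0| <= eta) ->
  `|f t - f s - (t - s) * g0| <= eta * (t - s).
Proof.
move=> T0 cf cg wd; have T0' := ltW T0.
have cF := continuous_clamp T0' cf; have cG := continuous_clamp T0' cg.
have inner s t (g0 eta e : R) : 0 < s -> s < t -> t < T -> 0 < e ->
    (forall r, s <= r <= t -> `|g r - g0| <= eta) ->
    `|f t - f s - (t - s) * g0| <= eta * (t - s) + e.
  move=> s0 st tT e0 gg0.
  have [B gB] := continuous_bounded_itv T cG.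
  have B0 : 0 <= B by apply: le_trans (gB 0 _); rewrite ?normr0.
  pose K : R := B + `|g0|.
  have K0 : 0 <= K by rewrite addr_ge0.
  have e40 : 0 < e / 4 by rewrite divr_gt0.
  have [d d0 Hd] := clamp_modulus T0' cf e40.
  (* The width [x] of the plateau lies below the modulus of [f], keeps the support inside []0, T[],
     and makes the error [4 * x * (B + |g0|)] at most [e / 2]; the two mollified values of [f] cost
     [e / 4] each. *)
  pose x : R := Num.min (d / 2) (Num.min (s / 2) (Num.min ((T - t) / 2) (e / (8 * (K + 1))))).
  have x0 : 0 < x.
    by rewrite !lt_min !divr_gt0 ?subr_gt0// mulr_gt0// ltr_wpDl.
  have [x1 [x2 [x3 x4]]] :
      x <= d / 2 /\ x <= s / 2 /\ x <= (T - t) / 2 /\ x <= e / (8 * (K + 1)).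
    by rewrite /x !ge_min !lexx !orbT.
  have xK : 4 * x * K <= e / 2.
    move: x4; rewrite ler_pdivlMr => [x4|]; last by rewrite mulr_gt0// ltr_wpDl.
    by lra_from x4 x0.
  pose l := Num.min (s - x) (T - t - x).
  have l0 : 0 < l.
    by rewrite lt_min; apply/andP; split; [lra_from x2 s0|lra_from x3 tT].
  have [ls lt] : l <= s - x /\ l <= T - t - x by rewrite /l !ge_min !lexx !orbT.
  have pl0 r : ~~ (l <= r <= T - l) -> plateau s t x r = 0.
    rewrite negb_and -!ltNge /plateau => /orP[r1|r1].
      by rewrite !plateau_step_eq0 ?subrr//; [lra_from r1 ls st|lra_from r1 ls].
    by rewrite !plateau_step_eq1 ?subrr//; [lra_from r1 lt|lra_from r1 lt st].
  have outside u r : x <= u -> u <= T - x -> ~~ (0 <= r <= T) -> mollifier u x r = 0.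
    move=> xu uT rT; apply: mollifier_eq0 => //; rewrite leNgt ltr_norml.
    apply: contra rT => /andP[r1 r2].
    by apply/andP; split; [lra_from r1 xu|lra_from r2 uT].
  have := wd _ _ l l0 (smooth_plateau s t x0) (fun r => is_derive_plateau s t r x0) pl0.
  rewrite Rintegral_clamp//; last first.
    move=> r rT; rewrite !outside ?subrr//;
    [lra_from l0 lt x2 s0 st|lra_from l0 lt|lra_from l0 ls|lra_from lt l0 st].
  rewrite Rintegral_clamp//; last first.
    move=> r rT; apply: pl0; apply: contra rT => /andP[r1 r2].
    by apply/andP; split; [lra_from r1 l0|lra_from r2 l0].
  have tm u : tame (fun r => f (clamp T r) * mollifier u x r).
    by apply: tameMc => //; exact: tame_mollifier.
  under [in X in - X = _]eq_Rintegral do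
    rewrite mulrBl ![mollifier _ _ _ * _]mulrC.
  rewrite Rintegral_tameB//.
  have appr u : s <= u <= t ->
     (`|\int[mu]_r (f (clamp T r) * mollifier u x r) - f u| <= e / 4)%R.
    move=> /andP[su ut]; have uT : 0 <= u <= T.
      by rewrite (le_trans (ltW s0) su) (le_trans ut (ltW tT)).
    rewrite -{2}(clamp_id uT); apply: (mollifier_approx (f := fun r => f (clamp T r))) => //.
    move=> r ru; apply/ltW/Hd => //; apply: le_lt_trans ru _.
    by lra_from x1 d0.
  have As : (`|\int[mu]_r (f (clamp T r) * mollifier s x r) - f s| <= e / 4)%R.
    by apply: appr; rewrite lexx ltW.
  have At : (`|\int[mu]_r (f (clamp T r) * mollifier t x r) - f t| <= e / 4)%R.
    by apply: appr; rewrite lexx ltW.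
  have Hp := @Rintegral_plateau s t x (fun r => g (clamp T r)) g0 eta B x0 st cG.
  have /Hp{}Hp : forall r, s <= r <= t -> `|g (clamp T r) - g0| <= eta.
    move=> r rst; rewrite clamp_id; first exact: gg0.
    by case/andP: rst => sr rt; rewrite (le_trans (ltW s0) sr) (le_trans rt (ltW tT)).
  have /Hp{}Hp : forall r, s - x <= r <= t + x -> `|g (clamp T r)| <= B.
    move=> r /andP[r1 r2]; apply: gB; rewrite ler_norml; apply/andP; split.
      by lra_from r1 x2 s0 T0'.
    by lra_from r2 x3 tT.
  move: As At Hp; rewrite -/K.
  move: (Rintegral _ _ _) (Rintegral _ _ _) (Rintegral _ _ _) => X Y Z.
  rewrite !ler_norml => /andP[X1 X2] /andP[Y1 Y2] /andP[Z1 Z2] XYZ.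
  by apply/andP; split; lra_from X1 X2 Y1 Y2 Z1 Z2 XYZ xK.
move=> s t g0 eta s0 st tT gg0.
move: st; rewrite le_eqVlt => /predU1P[<-|st].
  by rewrite !subrr mul0r subr0 normr0 mulr0.
have eta0 : 0 <= eta.
  by apply: (le_trans (normr_ge0 (g s - g0))); apply: gg0; rewrite lexx ltW.
apply/ler_addgt0Pr => e e0.
have e40 : 0 < e / 4 by rewrite divr_gt0.
have [d d0 Hd] := cf _ e40.
(* The endpoints [0] and [T] are reached by applying the inner estimate on [[s + x, t - x]].
   Continuity of [f] and smallness of [2 * x * |g0|] pay for the shift. *)
pose x : R := Num.min (d / 2) (Num.min ((t - s) / 4) (e / (8 * (`|g0| + 1)))).
have g00 := normr_ge0 g0.
have x0 : 0 < x.
  by rewrite !lt_min !divr_gt0 ?subr_gt0// mulr_gt0// ltr_wpDl.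
have [x1 [x2 x3]] : x <= d / 2 /\ x <= (t - s) / 4 /\ x <= e / (8 * (`|g0| + 1)).
  by rewrite /x !ge_min !lexx !orbT.
have xK : 2 * x * `|g0| <= e / 4.
  move: x3; rewrite ler_pdivlMr => [x3|]; last by rewrite mulr_gt0// ltr_wpDl.
  by lra_from x3 x0.
have sx0 : 0 < s + x by rewrite ltr_wpDl.
have sxtx : s + x < t - x by lra_from x2 st.
have txT : t - x < T by lra_from x0 tT.
have xd : `|x| < d by rewrite gtr0_norm//; lra_from x1 d0.
have H : `|f (t - x) - f (s + x) - (t - x - (s + x)) * g0| <=
    eta * (t - x - (s + x)) + e / 4.
  apply: inner => // r /andP[r1 r2]; apply: gg0.
  by apply/andP; split; [lra_from r1 x0|lra_from r2 x0].
have Hs : `|f (s + x) - f s| < e / 4.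
  apply: Hd; rewrite ?s0 ?(ltW sx0) ?(le_trans (ltW st))// ?[s + x]addrC ?addrK//=.
  by rewrite addrC; lra_from sxtx txT x0.
have Ht : `|f (t - x) - f t| < e / 4.
  apply: Hd; last by rewrite addrAC subrr add0r normrN.
    by rewrite (ltW txT) (le_trans (ltW sx0) (ltW sxtx)).
  by rewrite tT (le_trans s0 (ltW st)).
have xg : `|2 * x * g0| <= e / 4.
  by rewrite normrM ger0_norm// mulr_ge0// ltW.
have xe : 0 <= eta * x by rewrite mulr_ge0// ltW.
move: (f (s + x)) (f (t - x)) (f s) (f t) H Hs Ht xg => f1 f2 f3 f4.
rewrite !ler_norml !ltr_norml => /andP[h1 h2] /andP[h3 h4] /andP[h5 h6] /andP[h7 h8].
by apply/andP; split; lra_from h1 h2 h3 h4 h5 h6 h7 h8 xe.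
Qed.

End du_bois_reymond.

(** * The equation for the difference of two solutions *)

Section weak_form.
Context {R : realType}.
Notation mu := (@lebesgue_measure R).
Implicit Types (phi : R -> R) (s t u v x M : R).

(** For [u = xi s] and [v = xi t] this is the time integral of [phi(xi) xi'] after the change of
    variable along the front, so the derivative of [xi] never appears. *)
Definition jump phi u v : R := (\int[mu]_x (phi x * \1_`]u, v] x))%R.

Lemma tame_jump phi u v : continuous phi -> tame (fun x => phi x * \1_`]u, v] x).
Proof.
move=> cphi; apply: tameMc => //; apply: (@tame_indic _ _ (`|u| + `|v|)).
  move=> x /=; rewrite !in_itv/= => /andP[ux xv].
  have := ler_norm v; have := ler_norm (- u); rewrite normrN => H1 H2.
  have := normr_ge0 u; have := normr_ge0 v; move=> *.
  by apply/andP; split; lra.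
by rewrite addr_ge0.
Qed.

Lemma Rintegral_indic_oc u v : u <= v -> (\int[mu]_x \1_`]u, v] x = v - u)%R.
Proof.
move=> uv; rewrite Rintegral_indic_itv lebesgue_measure_itv/= lte_fin.
by case: ltP => //= vu; rewrite (_ : v = u) ?subrr//; apply/eqP; rewrite eq_le uv vu.
Qed.

Lemma jump_ge0 phi u v : (forall x, 0 <= phi x) -> 0 <= jump phi u v.
Proof.
by move=> phi0; apply: Rintegral_ge0 => x _; rewrite mulr_ge0// indicE.
Qed.

Lemma jump_norm_le phi u v (B : R) : continuous phi -> u <= v ->
  (forall x, `|phi x| <= B) -> `|jump phi u v| <= B * (v - u).
Proof.
move=> cphi uv phiB.
have B0 : 0 <= B by apply: le_trans (phiB 0).
apply: Rintegral_norm_le => //; first exact: tame_jump.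
  move=> x _; rewrite normrM -[leRHS]mulr1 ler_pM// indicE.
  by case: (_ \in _); rewrite ?normr1 ?normr0.
move=> x ux; rewrite indicE memNset ?mulr0//= in_itv/= => /andP[xu xv].
by move: ux; rewrite xv (ltW xu).
Qed.

Lemma jump_eq0 phi u v : (forall x, u < x <= v -> phi x = 0) -> jump phi u v = 0.
Proof.
move=> phi0; rewrite /jump (@eq_Rintegral _ _ _ _ _ (fun=> 0)).
  by rewrite Rintegral_cst// mul0r.
move=> x _; rewrite indicE; case: (boolP (x \in _)); last by rewrite mulr0.
by rewrite inE /= in_itv/= => /phi0 ->; rewrite mul0r.
Qed.

Lemma jump_eq1 phi u v : u <= v -> (forall x, u < x <= v -> phi x = 1) ->
  jump phi u v = v - u.
Proof.
move=> uv phi1; rewrite -Rintegral_indic_oc//; apply: eq_Rintegral => x _.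
rewrite indicE; case: (boolP (x \in _)); last by rewrite mulr0.
by rewrite inE /= in_itv/= => /phi1 ->; rewrite mulr1.
Qed.

Lemma mu_ofE (xi : R -> R) t x : mu_of xi (t, x) = 1 - 2 * \1_`]xi t, +oo[ x.
Proof.
rewrite /mu_of /sgn /= subr_lt0 indicE; case: ifPn => tx.
  by rewrite mem_set /= ?in_itv/= ?tx//; ring.
by rewrite memNset /= ?in_itv/= ?andbT ?mulr0 ?subr0//; exact/negP.
Qed.

Lemma mu_of_norm (xi : R -> R) t x : `|mu_of xi (t, x)| <= 1.
Proof. by rewrite /mu_of /sgn; case: ifP => _; rewrite ?normrN normr1. Qed.

Lemma mu_ofB (xi : R -> R) s t x : xi s <= xi t ->
  mu_of xi (t, x) - mu_of xi (s, x) = 2 * \1_`]xi s, xi t] x.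
Proof.
move=> st; rewrite /mu_of /sgn /= !subr_lt0 indicE.
have [xt|xt] := ltP (xi t) x; have [xs|xs] := ltP (xi s) x.
- by rewrite memNset /= ?mulr0 ?subrr// in_itv/= leNgt xt andbF.
- by move: (le_lt_trans st xt); rewrite ltNge xs.
- by rewrite mem_set /= ?in_itv/= ?xs ?xt//; ring.
- by rewrite memNset /= ?mulr0 ?subrr// in_itv/= ltNge xs.
Qed.

Lemma tame_mu_of (xi : R -> R) t phi : tame phi ->
  tame (fun x => mu_of xi (t, x) * phi x).
Proof.
move=> tphi; apply: tameM => //; last by move=> N; exists 1 => x _; exact: mu_of_norm.
under eq_fun do rewrite mu_ofE.
by apply: measurable_funB => //; apply: measurable_funM => //; exact: measurable_indic.
Qed.

Section solution.
Variables (T : R) (P Q Rf : R * R -> R) (xi : R -> R).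
Hypothesis T0 : 0 < T.
Hypothesis sol : limit_solution T P Q Rf xi.

Lemma tame_strip (f : R * R -> R) t phi : 0 <= t <= T -> strip_continuous T f ->
  tame phi -> tame (fun x => f (t, x) * phi x).
Proof. by move=> tT cf tphi; apply: tameMc => //; exact: strip_continuous_space cf. Qed.

Definition weak_lhs phi t : R := (\int[mu]_x ((P (t, x) + mu_of xi (t, x)) * phi x))%R.
Definition weak_rhs phi t : R := (\int[mu]_x (P (t, x) * phi x))%R.

Lemma weak_lhsE phi t : 0 <= t <= T -> tame phi ->
  weak_lhs phi t = weak_rhs phi t + (\int[mu]_x (mu_of xi (t, x) * phi x))%R.
Proof.
move=> tT tphi; rewrite /weak_lhs /weak_rhs -Rintegral_tameD.
- by apply: eq_Rintegral => x _; rewrite mulrDl.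
- by apply: tame_strip => //; exact: P_strip_continuous sol.
- exact: tame_mu_of.
Qed.

Lemma solution_weak_derivative phi phi1 phi2 M : smooth phi ->
  (forall x : R, is_derive x 1 phi (phi1 x)) ->
  (forall x : R, is_derive x 1 phi1 (phi2 x)) ->
  (forall x, M < `|x| -> phi x = 0) ->
  weak_derivative T (weak_lhs phi) (weak_rhs phi2).
Proof.
move=> sphi D1 D2 phi0 a a' l l0 sa aa' a0.
have tphi := tame_continuous (sphi 0) phi0.
have tphi2 : tame phi2.
  apply: (@tame_continuous _ _ M); last exact: support_derive D2 (support_derive D1 phi0).
  have [g D1' sg] := smooth_derive sphi; have [h D2' sh] := smooth_derive sg.
  have -> : phi2 = h; last exact: (sh 0).
  have gE : phi1 = g.
    by apply/funext => x; rewrite -(@derive_val _ _ _ _ _ _ _ (D1 x)) derive_val.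
  apply/funext => x; rewrite -(@derive_val _ _ _ _ _ _ _ (D2 x)).
  by rewrite gE (@derive_val _ _ _ _ _ _ _ (D2' x)).
have tf := test_function_tensor l0 sa sphi a0 phi0.
have := P_distributional sol tf.
rewrite (d_tau_tensor phi aa') (d_xi_tensor a D1) (d_xi_tensor a D2).
rewrite /integral_Omega.
have cP := P_strip_continuous sol.
have -> : (\int[mu]_(t in timeI T) \int[mu]_x
      ((P (t, x) + mu_of xi (t, x)) * tensor a' phi (t, x)))%R =
    (\int[mu]_(t in timeI T) (a' t * weak_lhs phi t))%R.
  apply: eq_Rintegral => t; rewrite inE timeIE => tT.
  rewrite /weak_lhs -Rintegral_tameZ.
    by apply: eq_Rintegral => x _; rewrite /tensor /= mulrCA.
  rewrite (_ : (fun x => _) = (fun x => P (t, x) * phi x + mu_of xi (t, x) * phi x)).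
    by apply: tameD; [exact: tame_strip|exact: tame_mu_of].
  by apply/funext => x; rewrite mulrDl.
have -> : (\int[mu]_(t in timeI T) \int[mu]_x (P (t, x) * tensor a phi2 (t, x)))%R =
    (\int[mu]_(t in timeI T) (a t * weak_rhs phi2 t))%R.
  apply: eq_Rintegral => t; rewrite inE timeIE => tT.
  rewrite /weak_rhs -Rintegral_tameZ; last exact: tame_strip.
  by apply: eq_Rintegral => x _; rewrite /tensor /= mulrCA.
by [].
Qed.

Lemma tame_bounds phi : tame phi ->
  exists2 M, 0 <= M & forall x, `|phi x| <= M /\ (M < `|x| -> phi x = 0).
Proof.
move=> [_ [M HM]]; exists M => //; exact: le_trans (HM 0).1.
Qed.

Lemma strip_itv_continuous (f : R * R -> R) phi : strip_continuous T f -> tame phi ->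
  itv_continuous T (fun t => \int[mu]_x (f (t, x) * phi x))%R.
Proof.
move=> cf tphi e e0; have [M M0 HM] := tame_bounds tphi.
pose k := e / (2 * M * M + 1).
have D0 : 0 < 2 * M * M + 1 by rewrite ltr_wpDl// !mulr_ge0.
have k0 : 0 < k / 2 by rewrite !divr_gt0.
have [d d0 Hd] := cf M _ k0; exists d => // s t sT tT st.
rewrite -Rintegral_tameB; [|exact: tame_strip..].
apply: (@le_lt_trans _ _ (k / 2 * M * (M - - M))).
  apply: Rintegral_norm_le.
  - by apply: tameB; exact: tame_strip.
  - lra.
  - by rewrite mulr_ge0// ltW.
  - move=> x xM; rewrite -mulrBl normrM ler_pM//; last exact: (HM x).1.
    by apply/ltW/Hd; rewrite ?subrr ?normr0 ?ler_norml.
  - move=> x; rewrite -ler_norml -ltNge => xM.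
    by rewrite (HM x).2// !mulr0 subrr.
have -> : k / 2 * M * (M - - M) = k * (M * M) by field.
rewrite /k mulrAC ltr_pdivrMr//.
rewrite ltr_pM2l//; have := mulr_ge0 M0 M0; lra.
Qed.

(** The function [mu_of] is discontinuous in space, but two of its slices differ only between the
    front positions, whose distance is controlled by the Lipschitz constant. *)
Lemma mu_itv_continuous phi : continuous phi -> tame phi ->
  itv_continuous T (fun t => \int[mu]_x (mu_of xi (t, x) * phi x))%R.
Proof.
move=> cphi tphi e e0; have [M M0 HM] := tame_bounds tphi.
have [L L0 HL] := front_lipschitz sol.
have D0 : 0 < 2 * M * L + 1 by rewrite ltr_wpDl// !mulr_ge0// ltW.
exists (e / (2 * M * L + 1)); first by rewrite divr_gt0.
suff H s t : 0 <= s -> s <= t -> t <= T -> t - s < e / (2 * M * L + 1) ->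
    (`|\int[mu]_x (mu_of xi (t, x) * phi x) - \int[mu]_x (mu_of xi (s, x) * phi x)| < e)%R.
  move=> s t /andP[s0 sT] /andP[t0 tT]; have [st|/ltW ts] := leP s t.
    rewrite distrC ger0_norm ?subr_ge0// => st'.
    by rewrite distrC; exact: H.
  by rewrite ger0_norm ?subr_ge0// => st'; exact: H.
move=> s0 st tT; rewrite ltr_pdivlMr// => ts.
have xst := front_nondecreasing sol s0 st tT.
rewrite -Rintegral_tameB; [|exact: tame_mu_of..].
under eq_Rintegral do rewrite -mulrBl mu_ofB// -mulrA [_ * phi _]mulrC.
rewrite Rintegral_tameZ; last exact: tame_jump.
rewrite -/(jump phi (xi s) (xi t)) normrM [`|2|]ger0_norm//.
have HLts : xi t - xi s <= L * (t - s).
  have := HL t s; rewrite !ger0_norm ?subr_ge0//.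
  by apply; apply/andP; split; lra.
have := jump_norm_le cphi xst (fun x => (HM x).1).
move/(ler_wpM2l M0) : HLts; lra.
Qed.

Lemma weak_lhs_continuous phi : continuous phi -> tame phi ->
  itv_continuous T (weak_lhs phi).
Proof.
move=> cphi tphi e e0; have e20 : 0 < e / 2 by rewrite divr_gt0.
have [d1 d10 H1] := strip_itv_continuous (P_strip_continuous sol) tphi e20.
have [d2 d20 H2] := mu_itv_continuous cphi tphi e20.
exists (Num.min d1 d2); first by rewrite lt_min d10.
move=> s t sT tT; rewrite lt_min => /andP[st1 st2].
have := H1 s t sT tT st1; have := H2 s t sT tT st2.
rewrite !weak_lhsE// /weak_rhs.
by rewrite !ltr_norml => /andP[? ?] /andP[? ?]; apply/andP; split; lra.
Qed.

Lemma weak_lhsB phi s t : continuous phi -> tame phi -> 0 <= s -> s <= t -> t <= T ->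
  weak_lhs phi t - weak_lhs phi s =
  weak_rhs phi t - weak_rhs phi s + 2 * jump phi (xi s) (xi t).
Proof.
move=> cphi tphi s0 st tT; have xst := front_nondecreasing sol s0 st tT.
rewrite !weak_lhsE//; try by apply/andP; split; lra.
rewrite opprD addrACA; congr (_ + _).
rewrite -Rintegral_tameB; [|exact: tame_mu_of..].
under eq_Rintegral do rewrite -mulrBl mu_ofB// -mulrA [_ * phi _]mulrC.
by rewrite Rintegral_tameZ//; exact: tame_jump.
Qed.

End solution.
End weak_form.

(** * What two solutions with equal initial data provide for the comparison *)

Section pairs.
Context {R : realType}.
Notation mu := (@lebesgue_measure R).
Implicit Types (phi f g : R -> R) (s t u v x M T : R).

Lemma derive_eq0_closed f g (K : set R) : closed K ->
  (forall x : R, is_derive x 1 f (g x)) -> (forall x, ~ K x -> f x = 0) ->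
  forall x, ~ K x -> g x = 0.
Proof.
move=> cK fg f0 x Kx; have D0 : is_derive x 1 f 0.
  apply: (near_eq_is_derive (f := cst 0)).
  have : nbhs x (~` K) by apply: open_nbhs_nbhs; split => //; exact: closed_openC.
  by apply: filterS => y /f0 ->.
by rewrite -(@derive_val _ _ _ _ _ _ _ (fg x)) derive_val.
Qed.

Lemma weak_derivativeB T f1 g1 f2 g2 : 0 <= T ->
  itv_continuous T f1 -> itv_continuous T g1 ->
  itv_continuous T f2 -> itv_continuous T g2 ->
  weak_derivative T f1 g1 -> weak_derivative T f2 g2 ->
  weak_derivative T (fun t => f1 t - f2 t) (fun t => g1 t - g2 t).
Proof.
move=> T0 cf1 cg1 cf2 cg2 w1 w2 a a' l l0 sa aa' a0.
have a'0 t : ~~ (l <= t <= T - l) -> a' t = 0.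
  move=> lt; apply: (@derive_eq0_closed a a' `[l, T - l]) => //=.
  - exact: interval_closed.
  - by move=> x; rewrite in_itv/= => /negP /a0.
  - by rewrite in_itv/=; exact/negP.
have tb (b f : R -> R) : continuous b -> (forall t, ~~ (l <= t <= T - l) -> b t = 0) ->
    itv_continuous T f -> tame (fun t => b t * f (clamp T t)).
  move=> cb b0 cf; apply: (@tame_continuous _ _ T).
    by move=> t; apply: continuousM; [exact: cb|exact: continuous_clamp].
  move=> t Tt; rewrite b0 ?mul0r//; apply: contraL Tt => /andP[? ?].
  by rewrite -leNgt ler_norml; apply/andP; split; lra.
have ca : continuous a := sa 0.
have ca' : continuous a'.
  have [h ah sh] := smooth_derive sa; suff -> : a' = h by exact: (sh 0).
  by apply/funext => x; rewrite -(@derive_val _ _ _ _ _ _ _ (aa' x)) derive_val.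
have out (b : R -> R) : (forall t, ~~ (l <= t <= T - l) -> b t = 0) ->
    forall t, ~~ (0 <= t <= T) -> b t = 0.
  move=> b0 t tT; apply: b0; apply: contra tT => /andP[? ?].
  by apply/andP; split; lra.
have := w2 a a' l l0 sa aa' a0; have := w1 a a' l l0 sa aa' a0.
rewrite !Rintegral_clamp//; try exact: out.
under [in X in _ -> _ -> - X = _]eq_Rintegral do rewrite mulrBr.
under [in X in _ -> _ -> _ = X]eq_Rintegral do rewrite mulrBr.
by rewrite !Rintegral_tameB; [lra|exact: tb..].
Qed.

(** An interface to the pair that no longer mentions [Q] or the separate solutions. It is
    asymmetric, as contact is recorded for [x1] only; exchanging the solutions yields a second
    instance with [- W] and the fronts swapped. *)
Record front_pair T (W : R * R -> R) (x1 x2 : R -> R) (L M0 : R) : Prop := {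
  pair_continuous : strip_continuous T W ;
  pair_init : forall x, W (0, x) = 0 ;
  pair_L_gt0 : 0 < L ;
  pair_lip1 : forall s t, 0 <= s -> s <= t -> t <= T ->
    0 <= x1 t - x1 s <= L * (t - s) ;
  pair_lip2 : forall s t, 0 <= s -> s <= t -> t <= T ->
    0 <= x2 t - x2 s <= L * (t - s) ;
  pair_front_init : x1 0 = x2 0 ;
  pair_mass_ge0 : 0 <= M0 ;
  pair_mass : forall t (k : R), 0 <= t <= T -> 0 <= k ->
    (\int[mu]_x (`|W (t, x)| * \1_`[- k, k] x) <= M0)%R ;
  pair_increment : forall phi phi1 phi2 M, smooth phi ->
    (forall x : R, is_derive x 1 phi (phi1 x)) ->
    (forall x : R, is_derive x 1 phi1 (phi2 x)) ->
    (forall x, M < `|x| -> phi x = 0) ->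
    forall s t (g0 eta : R), 0 <= s -> s <= t -> t <= T ->
    (forall r, s <= r <= t -> (`|\int[mu]_x (W (r, x) * phi2 x) - g0| <= eta)%R) ->
    (`|\int[mu]_x (W (t, x) * phi x) - \int[mu]_x (W (s, x) * phi x) +
      2 * (jump phi (x1 s) (x1 t) - jump phi (x2 s) (x2 t)) - (t - s) * g0|
      <= eta * (t - s))%R ;
  (* A front moves only where its solution equals [1], and the other solution is at
     most [1] ahead of its own front. *)
  pair_front : forall k : R, 0 < k -> exists2 d : R, 0 < d &
    forall s t, 0 <= s -> s <= t -> t <= T -> x1 s < x1 t ->
    exists2 r, s <= r <= t & (x2 r - d <= x1 r -> - k <= W (r, x1 r)) }.

Lemma front_bounded T (xi : R -> R) L t : 0 < L ->
  (forall s t, 0 <= s -> s <= t -> t <= T -> 0 <= xi t - xi s <= L * (t - s)) ->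
  0 <= t <= T -> `|xi t| <= `|xi 0| + L * T.
Proof.
move=> L0 HL /andP[t0 tT]; have := HL 0 t (lexx _) t0 tT; rewrite subr0 => /andP[? ?].
have : L * t <= L * T by rewrite ler_pM2l.
have := ler_norm (xi 0); have := ler_norm (- xi 0); rewrite normrN => *.
by rewrite ler_norml; apply/andP; split; lra.
Qed.

Lemma front_pair_of_solutions T (P1 Q1 R1 P2 Q2 R2 : R * R -> R)
    (xi1 xi2 : R -> R) : 0 < T ->
  limit_solution T P1 Q1 R1 xi1 -> limit_solution T P2 Q2 R2 xi2 ->
  (forall x : R, P1 (0, x) = P2 (0, x)) -> xi1 0 = xi2 0 ->
  exists L M0, front_pair T (fun z => P1 z - P2 z) xi1 xi2 L M0.
Proof.
move=> T0 s1 s2 P12 x12.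
have [L1 L10 HL1] := front_lipschitz s1; have [L2 L20 HL2] := front_lipschitz s2.
have [M1 M10 HM1] := R_integral_bound s1 T0; have [M2 M20 HM2] := R_integral_bound s2 T0.
have c1 := P_strip_continuous s1; have c2 := P_strip_continuous s2.
have lip (P Q Rf : R * R -> R) (xi : R -> R) L : limit_solution T P Q Rf xi ->
    L <= L1 + L2 ->
    (forall s t, 0 <= s <= T -> 0 <= t <= T -> `|xi s - xi t| <= L * `|s - t|) ->
    forall s t, 0 <= s -> s <= t -> t <= T -> 0 <= xi t - xi s <= (L1 + L2) * (t - s).
  move=> sol LL HL s t s0 st tT.
  have xst := front_nondecreasing sol s0 st tT; rewrite subr_ge0 xst /=.
  apply: (@le_trans _ _ (L * (t - s))); last by rewrite ler_wpM2r ?subr_ge0.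
  have := HL t s; rewrite !ger0_norm ?subr_ge0//; apply.
    by rewrite (le_trans s0 st).
  by rewrite s0 (le_trans st tT).
have lip1 := lip _ _ _ _ L1 s1 (ltac:(by rewrite lerDl ltW)) HL1.
have lip2 := lip _ _ _ _ L2 s2 (ltac:(by rewrite lerDr ltW)) HL2.
have L0 : 0 < L1 + L2 by rewrite addr_gt0.
(* As the heat parts coincide, the mass bound for [W] reduces to the bounds for the two
   remainders. *)
have WE z : Omega T z -> P1 z - P2 z = R1 z - R2 z.
  move=> Oz; rewrite (P_decomp s1 Oz) (P_decomp s2 Oz).
  suff -> : Q1 z = Q2 z by ring.
  apply/eqP; rewrite eq_le (heat_solution_le T0 s1 s2)//.
  by rewrite (heat_solution_le T0 s2 s1).
exists (L1 + L2), (M1 + M2); split => //.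
- exact: strip_continuousB.
- by move=> x; rewrite P12 subrr.
- exact: addr_ge0.
- move=> t k tT k0; have ti := @tame_indic R `[- k, k] k (fun x H => H) k0.
  have tn (f : R * R -> R) : strip_continuous T f -> tame (fun x => `|f (t, x)| * \1_`[- k, k] x).
    move=> cf; apply: tameMc => //.
    by move=> x; apply: cvg_norm; exact: (strip_continuous_space tT cf).
  have cR1 := hoelder_strip_continuous (R_hoelder s1).
  have cR2 := hoelder_strip_continuous (R_hoelder s2).
  apply: le_trans (lerD (HM1 t k tT k0) (HM2 t k tT k0)).
  rewrite -Rintegral_tameD; [|exact: tn..].
  apply: Rintegral_tame_le.
  + exact: (tn (fun z => P1 z - P2 z) (strip_continuousB c1 c2)).
  + by apply: tameD; exact: tn.
  + move=> x; rewrite WE ?OmegaE// -mulrDl ler_wpM2r ?indicE//.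
    exact: ler_normB.
- move=> phi phi1 phi2 M sphi D1 D2 phi0 s t g0 eta s0' st tT Hg.
  have tphi := tame_continuous (sphi 0) phi0.
  have tphi2 : tame phi2.
    apply: (@tame_continuous _ _ M); last exact: support_derive D2 (support_derive D1 phi0).
    have [g D1' sg] := smooth_derive sphi; have [h D2' sh] := smooth_derive sg.
    have -> : phi2 = h; last exact: (sh 0).
    have gE : phi1 = g.
      by apply/funext => x; rewrite -(@derive_val _ _ _ _ _ _ _ (D1 x)) derive_val.
    apply/funext => x; rewrite -(@derive_val _ _ _ _ _ _ _ (D2 x)).
    by rewrite gE (@derive_val _ _ _ _ _ _ _ (D2' x)).
  have cphi : continuous phi := sphi 0.
  have tT' : 0 <= t <= T by apply/andP; split; lra.
  have sT' : 0 <= s <= T by apply/andP; split; lra.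
  have rB psi r : 0 <= r <= T -> tame psi ->
      (\int[mu]_x ((P1 (r, x) - P2 (r, x)) * psi x) =
       weak_rhs P1 psi r - weak_rhs P2 psi r)%R.
    move=> rT tpsi; rewrite /weak_rhs -Rintegral_tameB;
      [|exact: tame_strip rT c1 tpsi|exact: tame_strip rT c2 tpsi].
    by apply: eq_Rintegral => x _; rewrite mulrBl.
  have := @weak_derivative_increment _ T
    (fun t => weak_lhs P1 xi1 phi t - weak_lhs P2 xi2 phi t)
    (fun t => weak_rhs P1 phi2 t - weak_rhs P2 phi2 t) T0 _ _ _ s t g0 eta s0' st tT.
  rewrite !rB// => H.
  have {H} := H _ _ _ _.
  have := weak_lhsB s1 cphi tphi s0' st tT; have := weak_lhsB s2 cphi tphi s0' st tT.
  move=> E2 E1 H.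
  have E (a b c d e f g h i j : R) : a - b = c - d + 2 * i -> e - f = g - h + 2 * j ->
      c - g - (d - h) + 2 * (i - j) = a - e - (b - f) by move=> ? ?; lra.
  rewrite (E _ _ _ _ _ _ _ _ _ _ E1 E2).
  apply: H.
  + by apply: itv_continuousB; [exact: weak_lhs_continuous s1 _ _ _|exact: weak_lhs_continuous s2 _ _ _].
  + by apply: itv_continuousB; exact: strip_itv_continuous.
  + apply: weak_derivativeB; rewrite ?ltW//.
    * exact: weak_lhs_continuous s1 _ _ _.
    * exact: strip_itv_continuous.
    * exact: weak_lhs_continuous s2 _ _ _.
    * exact: strip_itv_continuous.
    * exact: solution_weak_derivative s1 _ _ _ _ sphi D1 D2 phi0.
    * exact: solution_weak_derivative s2 _ _ _ _ sphi D1 D2 phi0.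
  + move=> r rst; rewrite -rB//; first exact: Hg.
    by case/andP: rst => sr rt; rewrite (le_trans s0' sr) (le_trans rt tT).
- move=> k k0; pose X : R := `|xi2 0| + (L1 + L2) * T + (`|xi1 0| + (L1 + L2) * T).
  have [d d0 Hd] := c2 X k k0; exists (d / 2); first by rewrite divr_gt0.
  move=> s t s0' st tT x1st.
  (* A moving front cannot avoid contact throughout [[s, t]]; the negation supplies the contact time
     [r]. *)
  have : ~ (forall r : R, s <= r <= t -> P1 (r, xi1 r) != 1).
    move=> H; have := front_frozen s1 s0' st tT H => E.
    by move: x1st; rewrite E ltxx.
  move/existsNP => [r /not_implyP[rst /negP]]; rewrite negbK => /eqP P1r.
  exists r => // x2x1.
  have rT : 0 <= r <= T.
    by case/andP: rst => sr rt; rewrite (le_trans s0' sr) (le_trans rt tT).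
  (* The point [y] is at or ahead of the second front, so [P2 <= 1] there, and it is at most [d / 2]
     from [xi1 r]. Continuity then bounds [P2] at [xi1 r] by [1 + k], while [P1] equals [1]
     there. *)
  pose y := Num.max (xi1 r) (xi2 r).
  have P2y : P2 (r, y) <= 1.
    by apply: (P_le s2); rewrite ?timeIE// le_max lexx orbT.
  have B1 := front_bounded L0 lip1 rT; have B2 := front_bounded L0 lip2 rT.
  have LT : 0 <= (L1 + L2) * T by rewrite mulr_ge0 ?ltW.
  have X1 : `|xi1 r| <= X by apply: (le_trans B1); rewrite lerDr addr_ge0.
  have X2 : `|xi2 r| <= X by apply: (le_trans B2); rewrite lerDl addr_ge0.
  have : `|P2 (r, y) - P2 (r, xi1 r)| < k.
    apply: Hd => //; rewrite ?subrr ?normr0//.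
      by rewrite /y /Num.max; case: ifP.
    rewrite /y /Num.max; case: ifP => [x12r|_]; last by rewrite subrr normr0.
    rewrite ger0_norm ?subr_ge0 1?ltW//.
    by lra_from x2x1 d0.
  by rewrite P1r ltr_norml => /andP[H _]; lra_from H P2y.
Qed.

End pairs.

(** * Mollification of the difference *)

Section mollify.
Context {R : realType}.
Notation mu := (@lebesgue_measure R).
Implicit Types (f g : R -> R) (s t u v x y e h k : R).

(** The negative part lowered by a threshold: it vanishes for [u >= - k]. The slack [k] absorbs the
    mollification error and the inexact position of the contact point. *)
Definition npart k u : R := Num.max (- u - k) 0.

Lemma npart_ge0 k u : 0 <= npart k u.
Proof. by rewrite /npart le_max lexx orbT. Qed.

(** Convexity, with the subgradient at [u] selected to be [0] at the kink. Only points with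
    [u < - k] then see the front terms. *)
Lemma npart_subgradient k u v :
  npart k u - npart k v <= (if u < - k then 1 else 0) * (v - u).
Proof.
rewrite /npart /Num.max.
case: (ltP (- u - k) 0) => ?; case: (ltP (- v - k) 0) => ?; case: (ltP u (- k)) => ?;
  rewrite ?mul1r ?mul0r; lra.
Qed.

Lemma npart_lipschitz k k' u v : `|npart k u - npart k' v| <= `|k - k'| + `|u - v|.
Proof.
rewrite /npart /Num.max; have := ler_norm (k - k'); have := ler_norm (- (k - k')).
have := ler_norm (u - v); have := ler_norm (- (u - v)); rewrite !normrN => ? ? ? ?.
by case: (ltP (- u - k) 0) => ?; case: (ltP (- v - k') 0) => ?;
  rewrite ler_norml; apply/andP; split; lra.
Qed.

Lemma npart_continuous k f : continuous f -> continuous (fun x => npart k (f x)).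
Proof.
move=> cf x; apply/cvgrPdist_le => e e0.
have := cf x; move=> /cvgrPdist_le/(_ _ e0); apply: filterS => y Hy.
by apply: (le_trans (npart_lipschitz _ _ _ _)); rewrite subrr normr0 add0r.
Qed.

Lemma mollifierE y e x : mollifier y e x = mollifier 0 e (- y + 1 * x).
Proof. by rewrite /mollifier; congr (_ * bump _); ring. Qed.

Lemma mollifier_shift y e h x : mollifier (y + h) e x = mollifier y e (x - h).
Proof. by rewrite /mollifier; congr (_ * bump _); ring. Qed.

Lemma bump_bounded : exists2 B : R, 0 < B & forall x, bump x <= B.
Proof.
have [B HB] := continuous_bounded_itv 1 (Cn_continuous (@smooth_bump R 0)).
exists (`|B| + 1); first by have := normr_ge0 B; lra.
move=> x; have [x1|x1] := leP `|x| 1.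
  have := HB x x1; rewrite ger0_norm ?bump_ge0//; have := ler_norm B; lra.
by rewrite bump_eq0 ?addr_ge0// ltW.
Qed.

Lemma mollifier_bounded : exists2 B : R, 0 < B &
  forall y e x, 0 < e -> `|mollifier y e x| <= B / e.
Proof.
have [B B0 HB] := bump_bounded; have m0 := @bump_mass_gt0 R.
exists (B / bump_mass); first by rewrite divr_gt0.
move=> y e x e0; rewrite ger0_norm ?mollifier_ge0// /mollifier -mulrA -invfM.
by rewrite mulrC ler_wpM2r ?HB// invr_ge0 mulr_ge0 ?ltW.
Qed.

Lemma compact_support_bounded f (M : R) : continuous f ->
  (forall x, M < `|x| -> f x = 0) -> exists2 B : R, 0 < B & forall x, `|f x| <= B.
Proof.
move=> cf f0; have [B HB] := continuous_bounded_itv M cf.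
exists (`|B| + 1); first by have := normr_ge0 B; lra.
move=> x; have [xM|/f0 ->] := leP `|x| M; last by rewrite normr0 addr_ge0.
by have := HB x xM; have := ler_norm B; lra.
Qed.

Lemma derive_lipschitz f g B : (forall x : R, is_derive x 1 f (g x)) ->
  (forall x, `|g x| <= B) -> forall x y, `|f x - f y| <= B * `|x - y|.
Proof.
move=> fg gB x y.
wlog xy : x y / x < y => [H|].
  have [/H//|/H|->] := ltgtP x y; last by rewrite !subrr !normr0 mulr0.
  by rewrite distrC [`|x - y|]distrC.
have [z _ E] := is_derive_MVT xy (fun z _ => fg z).
by rewrite distrC E normrM [`|x - y|]distrC ler_wpM2r.
Qed.

(** The mollifiers of width [e] are translates of the one centred at [0], so all constants depend on
    [e] but not on the centre. *)
Lemma mollifier_derivatives e : 0 < e -> exists p1 p2 : R -> R, exists B1 B2 B3 : R,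
  [/\ forall y x, is_derive x 1 (mollifier y e) (p1 (- y + 1 * x)),
      forall y x, is_derive x 1 (fun x => p1 (- y + 1 * x)) (p2 (- y + 1 * x)),
      continuous p2 /\ (forall x, e < `|x| -> p2 x = 0),
      [/\ 0 < B1, 0 < B2 & 0 < B3] &
      [/\ forall x y, `|mollifier 0 e x - mollifier 0 e y| <= B1 * `|x - y|,
          forall x, `|p2 x| <= B2 & forall x y, `|p2 x - p2 y| <= B3 * `|x - y|]].
Proof.
move=> e0.
have [p1 pp1 sp1] := smooth_derive (smooth_mollifier 0 e).
have [p2 pp2 sp2] := smooth_derive sp1; have [p3 pp3 sp3] := smooth_derive sp2.
have p0 x : e < `|x| -> mollifier 0 e x = 0.
  by move=> ex; apply: mollifier_eq0; rewrite ?subr0// ltW.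
have p10 := support_derive pp1 p0; have p20 := support_derive pp2 p10.
have p30 := support_derive pp3 p20.
have [B1 B10 H1] := compact_support_bounded (Cn_continuous (sp1 0)) p10.
have [B2 B20 H2] := compact_support_bounded (Cn_continuous (sp2 0)) p20.
have [B3 B30 H3] := compact_support_bounded (Cn_continuous (sp3 0)) p30.
exists p1, p2, B1, B2, B3; split => //.
- move=> y x; rewrite (_ : mollifier y e = fun x => mollifier 0 e (- y + 1 * x)).
    by rewrite -[p1 _]mul1r; exact: is_derive_comp_affine.
  by apply/funext => z; exact: mollifierE.
- by move=> y x; rewrite -[p2 _]mul1r; exact: is_derive_comp_affine.
- by split => //; exact: (sp2 0).
- by split => //; [exact: derive_lipschitz pp1 H1|exact: derive_lipschitz pp3 H3].
Qed.

(** Discrete integration by parts, from translation invariance of the integral. The bounded support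
    of [g] makes every product integrable, whatever the growth of [f]. *)
Lemma Rintegral_second_difference (f g : R -> R) (N h : R) : 0 <= h ->
  continuous f -> (forall x, 0 <= f x) -> continuous g -> (forall x, 0 <= g x) ->
  (forall x, N < `|x| -> g x = 0) ->
  (\int[mu]_x (g x * (f (x + h) - 2 * f x + f (x - h))) =
   \int[mu]_x ((g (x + h) - 2 * g x + g (x - h)) * f x))%R.
Proof.
move=> h0 cf f0 cg g0 gN.
have cs f' (k : R) : continuous f' -> continuous (fun x : R => f' (x + k)).
  move=> cf' x; apply: (@continuous_comp _ _ _ (fun x : R => x + k) f'); last exact: cf'.
  by apply: cvgD; [exact: cvg_id|exact: cvg_cst].
have tg (k : R) : `|k| <= h -> tame (fun x => g (x + k)).
  move=> kh; apply: (@tame_continuous _ _ (N + h)); first exact: cs.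
  by move=> x Nx; apply: gN; have := ler_normB (x + k) k; rewrite addrK; lra.
have tgf (k l : R) : `|k| <= h -> tame (fun x => g (x + k) * f (x + l)).
  move=> kh; under eq_fun do rewrite mulrC.
  by apply: tameMc; [exact: cs|exact: tg].
have hn : `|- h| <= h by rewrite normrN ger0_norm.
have hp : `|h| <= h by rewrite ger0_norm.
have h00 : `|0 : R| <= h by rewrite normr0.
have T k : (\int[mu]_x (g x * f (x + k)) = \int[mu]_x (g (x - k) * f x))%R.
  rewrite -(@Rintegral_translate _ (fun x => g (x - k) * f x) k).
  - by apply: eq_Rintegral => x _; rewrite addrK.
  - by move=> x; apply: continuousM; [exact: cs|exact: cf].
  - by move=> x; exact: mulr_ge0.
transitivity (\int[mu]_x (g x * f (x + h)) - \int[mu]_x (2 * (g x * f x)) +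
    \int[mu]_x (g x * f (x - h)))%R.
  rewrite -Rintegral_tameB.
  - rewrite -Rintegral_tameD; first by apply: eq_Rintegral => x _; ring.
      apply: tameB; first by have := tgf 0 h h00; under eq_fun do rewrite addr0.
      apply: tameZ; have := tgf 0 0 h00; by under eq_fun do rewrite !addr0.
    by have := tgf 0 (- h) h00; under eq_fun do rewrite addr0.
  - by have := tgf 0 h h00; under eq_fun do rewrite addr0.
  - by apply: tameZ; have := tgf 0 0 h00; under eq_fun do rewrite !addr0.
rewrite !T opprK.
rewrite -Rintegral_tameB.
- rewrite -Rintegral_tameD; first by apply: eq_Rintegral => x _; ring.
    apply: tameB; first by have := tgf (- h) 0 hn; under eq_fun do rewrite addr0.
    by apply: tameZ; have := tgf 0 0 h00; under eq_fun do rewrite !addr0.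
  by have := tgf h 0 hp; under eq_fun do rewrite addr0.
- by have := tgf (- h) 0 hn; under eq_fun do rewrite addr0.
- by apply: tameZ; have := tgf 0 0 h00; under eq_fun do rewrite !addr0.
Qed.

End mollify.

Section mollified_difference.
Context {R : realType}.
Notation mu := (@lebesgue_measure R).
Implicit Types (s t u v x y e h k N M c : R).
Variables (T : R) (W : R * R -> R) (x1 x2 : R -> R) (L M0 : R).
Hypothesis fp : front_pair T W x1 x2 L M0.

Definition mollify e t y : R := (\int[mu]_x (W (t, x) * mollifier y e x))%R.

Lemma tame_W t (q : R -> R) : 0 <= t <= T -> tame q -> tame (fun x => W (t, x) * q x).
Proof.
by move=> tT tq; apply: tameMc => //; exact: strip_continuous_space (pair_continuous fp).
Qed.

Lemma W_slice_continuous t : 0 <= t <= T -> continuous (fun x => W (t, x)).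
Proof. by move=> tT; exact: strip_continuous_space (pair_continuous fp). Qed.

Lemma tame_normW t k : 0 <= t <= T -> 0 <= k ->
  tame (fun x => `|W (t, x)| * \1_`[- k, k] x).
Proof.
move=> tT k0; apply: tameMc; last exact: (@tame_indic _ _ k).
by move=> x; apply: cvg_norm; exact: W_slice_continuous.
Qed.

Lemma mass_bound t (q : R -> R) B k : 0 <= t <= T -> 0 <= B -> 0 <= k -> tame q ->
  (forall x, `|q x| <= B) -> (forall x, k < `|x| -> q x = 0) ->
  (`|\int[mu]_x (W (t, x) * q x)| <= B * M0)%R.
Proof.
move=> tT B0 k0 tq qB q0.
apply: (@le_trans _ _ (\int[mu]_x `|W (t, x) * q x|)%R).
  by apply: le_normr_Rintegral => //; apply: tame_integrable; exact: tame_W.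
apply: (@le_trans _ _ (\int[mu]_x (B * (`|W (t, x)| * \1_`[- k, k] x)))%R).
  apply: Rintegral_tame_le; first by apply: tame_norm; exact: tame_W.
    by apply: tameZ; exact: tame_normW.
  move=> x; rewrite normrM mulrC; have [xk|/q0 ->] := leP `|x| k.
    rewrite indicE mem_set /= ?in_itv/= -?ler_norml// mulr1.
    by rewrite ler_wpM2r.
  by rewrite normr0 mul0r !mulr_ge0// indicE.
rewrite Rintegral_tameZ; last exact: tame_normW.
by rewrite ler_wpM2l//; exact: (pair_mass fp).
Qed.

Lemma mollifier_support y e x : 0 < e -> `|y| + e < `|x| -> mollifier y e x = 0.
Proof.
move=> e0 H; apply: mollifier_eq0 => //.
have := ler_normD (x - y) y; rewrite subrK; lra.
Qed.

Lemma mollify_continuous t e : 0 <= t <= T -> 0 < e -> continuous (mollify e t).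
Proof.
move=> tT e0 y.
have [p1 [p2 [B1 [B2 [B3 [D1 D2 [cp2 p20] [B10 B20 B30] [HB1 HB2 HB3]]]]]]] :=
  mollifier_derivatives e0.
have M00 := pair_mass_ge0 fp.
have D0 : 0 < B1 * (M0 + 1) by rewrite mulr_gt0//; lra.
apply/cvgrPdist_le => d d0.
have r0 : 0 < d / (B1 * (M0 + 1)) by rewrite divr_gt0.
near=> z.
rewrite /mollify -Rintegral_tameB; try by apply: tame_W => //; exact: tame_mollifier.
have -> : (\int[mu]_x (W (t, x) * mollifier y e x - W (t, x) * mollifier z e x) =
    \int[mu]_x (W (t, x) * (mollifier y e x - mollifier z e x)))%R.
  by apply: eq_Rintegral => x _; rewrite mulrBr.
have yz0 : 0 <= B1 * `|y - z| by rewrite mulr_ge0// ltW.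
apply: (@le_trans _ _ (B1 * `|y - z| * M0)).
  apply: (@mass_bound _ _ _ (`|y| + `|z| + e)) => //.
  - by rewrite !addr_ge0// ltW.
  - by apply: tameB; exact: tame_mollifier.
  - move=> x; rewrite !(mollifierE _ e x); apply: (le_trans (HB1 _ _)).
    by rewrite (_ : _ - _ = z - y) ?[`|z - y|]distrC//; ring.
  - move=> x xk; have := normr_ge0 y; have := normr_ge0 z => ? ?.
    by rewrite !mollifier_support ?subrr//; lra.
have : `|y - z| <= d / (B1 * (M0 + 1)).
  by near: z; exists (d / (B1 * (M0 + 1))) => //= z /ltW.
rewrite ler_pdivlMr//; apply: le_trans.
rewrite -mulrA mulrCA ler_wpM2l// ler_wpM2l//; [exact: ltW|lra].
Unshelve. all: by end_near. Qed.

Lemma mollify_approx N k : 0 < k -> exists2 d : R, 0 < d & forall e t y,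
  0 < e -> e <= d -> 0 <= t <= T -> `|y| <= N -> `|mollify e t y - W (t, y)| <= k.
Proof.
move=> k0; have [d d0 Hd] := pair_continuous fp (N + 1) k0.
exists (Num.min (d / 2) 1); first by rewrite lt_min ltr01 andbT divr_gt0.
move=> e t y e0; rewrite le_min => /andP[ed e1] tT yN.
apply: (mollifier_approx (f := fun x => W (t, x))) => //.
  exact: W_slice_continuous.
move=> x xy; apply/ltW/Hd => //; rewrite ?subrr ?normr0//; [|lra|lra].
have := ler_normD (x - y) y; rewrite subrK; lra.
Qed.

(* The mollified function inherits the heat equation up to an error that is
   uniform in [y]; the second space derivative appears as a difference quotient. *)
Lemma mollify_increment e N k : 0 < e -> 0 <= N -> 0 < k -> exists2 h0 : R, 0 < h0 &
  forall h, 0 < h -> h <= h0 -> exists2 d : R, 0 < d & forall s t y,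
  0 <= s -> s <= t -> t <= T -> t - s <= d -> `|y| <= N ->
  `|mollify e t y - mollify e s y +
     2 * (jump (mollifier y e) (x1 s) (x1 t) - jump (mollifier y e) (x2 s) (x2 t)) -
     (t - s) * ((mollify e t (y + h) - 2 * mollify e t y + mollify e t (y - h)) / h ^+ 2)|
   <= k * (t - s).
Proof.
move=> e0 N0 k0.
have [p1 [p2 [B1 [B2 [B3 [D1 D2 [cp2 p20] [B10 B20 B30] [HB1 HB2 HB3]]]]]]] :=
  mollifier_derivatives e0.
have M00 := pair_mass_ge0 fp.
have D0 : 0 < 2 * (B3 * (M0 + 1)) by rewrite !mulr_gt0//; lra.
(* With this bound on [h], replacing the second derivative of the mollifier by its difference
   quotient costs at most [B3 * h * M0 <= k / 2]. The other half of [k] pays for the variation in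
   time. *)
exists (k / (2 * (B3 * (M0 + 1)))); first by rewrite divr_gt0.
move=> h h0 hh0.
(* An oscillation [k'] of [W] in time, integrated against [p2] over a length [2 * (N + e)],
   contributes at most [k / 2]. *)
pose k' : R := k / (4 * B2 * (N + e) + 1).
have D1' : 0 < 4 * B2 * (N + e) + 1.
  by rewrite ltr_wpDl// !mulr_ge0 ?ltW//; lra.
have k'0 : 0 < k' by rewrite divr_gt0.
have [d d0 Hd] := pair_continuous fp (N + e) k'0.
exists (d / 2); first by rewrite divr_gt0.
move=> s t y s0 st tT tsd yN.
have tT' : 0 <= t <= T by rewrite (le_trans s0 st).
pose q x := p2 (- y + 1 * x).
have q0 x : N + e < `|x| -> q x = 0.
  move=> H; apply: p20; have := ler_normD (- y + 1 * x) y.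
  by rewrite (_ : - y + 1 * x + y = x); [lra|ring].
have cq : continuous q.
  move=> x; apply: (@continuous_comp _ _ _ (fun x => - y + 1 * x) p2); last exact: cp2.
  exact: (is_derive_continuous (fun x => is_derive_affine (- y) 1 x)).
have tq : tame q by exact: tame_continuous cq q0.
have wyy r : s <= r <= t ->
    (`|\int[mu]_x (W (r, x) * q x) - \int[mu]_x (W (t, x) * q x)| <= k / 2)%R.
  move=> /andP[sr rt]; have rT : 0 <= r <= T by apply/andP; split; lra.
  rewrite -Rintegral_tameB; [|exact: tame_W..].
  apply: (@le_trans _ _ (k' * B2 * (N + e - - (N + e)))).
    apply: Rintegral_norm_le.
    - by apply: tameB; exact: tame_W.
    - lra.
    - by rewrite mulr_ge0// ltW.
    - move=> x; rewrite -ler_norml => xN; rewrite -mulrBl normrM ler_pM//.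
        by apply/ltW/Hd => //; rewrite ?subrr ?normr0// distrC ger0_norm; lra.
      exact: HB2.
    - by move=> x; rewrite -ler_norml -ltNge => /q0 ->; rewrite !mulr0 subrr.
  rewrite (_ : _ * (_ - _) = k' * (2 * B2 * (N + e))); last by ring.
  rewrite /k' mulrAC ler_pdivrMr//.
  rewrite [leRHS](_ : _ = k * (2 * B2 * (N + e)) + k / 2); last by field.
  by rewrite lerDl ltW// divr_gt0.
have sd : `|(mollify e t (y + h) - 2 * mollify e t y + mollify e t (y - h)) / h ^+ 2 -
    (\int[mu]_x (W (t, x) * q x))%R| <= k / 2.
  have tm z : tame (fun x => W (t, x) * mollifier z e x).
    by apply: tame_W => //; exact: tame_mollifier.
  pose Z x := (mollifier (y + h) e x - 2 * mollifier y e x + mollifier (y - h) e x) / h ^+ 2 - q x.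
  have tZ : tame Z.
    apply: tameB => //.
    rewrite (_ : (fun x => _) = (fun x => (h ^+ 2)^-1 * (mollifier (y + h) e x -
        2 * mollifier y e x + mollifier (y - h) e x))); last by apply/funext => x; rewrite mulrC.
    by apply: tameZ; apply: tameD; [apply: tameB; [|apply: tameZ]|]; exact: tame_mollifier.
  have -> : (mollify e t (y + h) - 2 * mollify e t y + mollify e t (y - h)) / h ^+ 2 -
      (\int[mu]_x (W (t, x) * q x))%R = (\int[mu]_x (W (t, x) * Z x))%R.
    rewrite /mollify [_ / h ^+ 2]mulrC -!(Rintegral_tameZ, Rintegral_tameB, Rintegral_tameD)//;
      try by repeat first [exact: tm|exact: tame_W|apply: tameZ|apply: tameB|apply: tameD].
    by apply: eq_Rintegral => x _; rewrite /Z; ring.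
  apply: (@le_trans _ _ (B3 * h * M0)).
    apply: (@mass_bound _ _ _ (N + e + h)) => //.
    - by rewrite mulr_ge0// ltW.
    - by rewrite !addr_ge0// ltW.
    - move=> x; rewrite /Z.
      have [z zx E] := second_difference x h0 (D1 y) (D2 y).
      rewrite !mollifier_shift opprK.
      have -> : mollifier y e (x - h) - 2 * mollifier y e x + mollifier y e (x + h) =
          p2 (- y + 1 * z) * h ^+ 2 by rewrite -E; ring.
      rewrite mulfK ?expf_neq0 ?gt_eqF// /q; apply: (le_trans (HB3 _ _)).
      rewrite (_ : _ - _ = z - x); last by ring.
      by rewrite ler_wpM2l ?ltW.
    - move=> x xN; have nh : `|h| = h by rewrite gtr0_norm.
      have yh1 := ler_normD y h; have yh2 := ler_normB y h; rewrite nh in yh1 yh2.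
      have out z : `|z| <= N + h -> mollifier z e x = 0.
        by move=> zN; apply: mollifier_support => //; lra_from fp zN xN.
      rewrite /Z q0; last by lra_from fp xN h0.
      rewrite !out ?mulr0 ?subrr ?addr0 ?mul0r ?subrr//.
      + by lra_from fp yh2 yN.
      + by lra_from fp yN h0.
      + by lra_from fp yh1 yN.
  move: hh0; rewrite ler_pdivlMr// => hh0.
  have : 0 <= B3 * h by rewrite mulr_ge0 ?ltW.
  lra.
have := @pair_increment _ _ _ _ _ _ _ fp _ _ _ (`|y| + e)
  (smooth_mollifier y e) (D1 y) (D2 y) (fun x => mollifier_support e0) s t
  ((mollify e t (y + h) - 2 * mollify e t y + mollify e t (y - h)) / h ^+ 2) k s0 st tT.
apply=> r rst; have := wyy r rst; move: sd; rewrite /q.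
set X := Rintegral _ _ _; set Y := Rintegral _ _ _; set Z := _ / _.
by rewrite !ler_norml => /andP[? ?] /andP[? ?]; apply/andP; split; lra.
Qed.

End mollified_difference.

(** * Growth of the negative mass *)

(** A discrete Kato inequality: the equation is multiplied by the subgradient at [w0]. The space
    differences and the backward time difference share the value [w0] at the later time, so one
    subgradient serves them all. The term [Y] of the second front has the favourable sign and is
    dropped; [X] survives only when [b] holds. *)
Lemma npart_step (R : realType) (k w0 wp wm ws X Y h2 d : R) (b : bool) :
  0 < h2 -> 0 <= d -> 0 < k -> 0 <= X -> 0 <= Y ->
  (w0 < - k -> b = false -> X = 0) ->
  `|w0 - ws + 2 * (X - Y) - d * ((wp - 2 * w0 + wm) / h2)| <= k * d ->
  npart k w0 - npart k ws <=
    d * ((npart k wp - 2 * npart k w0 + npart k wm) / h2 + k) +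
    (if b then 2 * X else 0).
Proof.
move=> hh ts0 k0 X0 Y0 key.
have S1 := npart_subgradient k w0 wp; have S2 := npart_subgradient k w0 wm.
have S3 := npart_subgradient k w0 ws.
move: (npart k w0) (npart k wp) (npart k wm) (npart k ws) S1 S2 S3 => p p1 p2 p3 S1 S2 S3.
set q := (wp - 2 * w0 + wm) / h2.
rewrite ler_norml => /andP[I2 _].
have pq : (if w0 < - k then 1 else 0) * - q <= (p1 - 2 * p + p2) / h2.
  rewrite /q -mulNr mulrA ler_pM2r ?invr_gt0//; move: S1 S2.
  by case: ifP => _; rewrite ?mul1r ?mul0r; lra.
have tspq := ler_wpM2l ts0 pq.
move: S3 key tspq I2; case: ifP => [wk|_].
  rewrite !mul1r => S3 key tspq; case: b key => key ?; first lra.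
  by have := key isT erefl; lra.
by rewrite !mul0r => S3 _ tspq _; have := mulr_ge0 ts0 (ltW k0); case: b; lra.
Qed.

Lemma small_step_nondecreasing (R : realType) (f : R -> R) (a b d : R) :
  a <= b -> 0 < d ->
  (forall u v, a <= u -> u <= v -> v <= b -> v - u <= d -> f u <= f v) ->
  f a <= f b.
Proof.
move=> ab d0 H; apply: pointwise_nondecreasing => // x /andP[ax xb].
exists d => //; split=> y /andP[ay yb] /andP[h1 h2]; apply: H => //.
  by rewrite lerBlDr -lerBlDl ltW.
by rewrite lerBlDl ltW.
Qed.

Section negative_mass.
Context {R : realType}.
Notation mu := (@lebesgue_measure R).
Implicit Types (s t u v x y e h k N M c : R).
Variables (T : R) (W : R * R -> R) (x1 x2 : R -> R) (L M0 : R).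
Hypothesis T0 : 0 < T.
Hypothesis fp : front_pair T W x1 x2 L M0.

Lemma pair_lip_sub s t u v : 0 <= s -> t <= T -> s <= u -> u <= v -> v <= t ->
  (0 <= x1 v - x1 u <= L * (t - s)) /\ (0 <= x2 v - x2 u <= L * (t - s)).
Proof.
move=> s0 tT su uv vt.
have H : L * (v - u) <= L * (t - s).
  by rewrite ler_pM2l ?(pair_L_gt0 fp)// lerB.
have /andP[-> H1] := pair_lip1 fp (le_trans s0 su) uv (le_trans vt tT).
have /andP[-> H2] := pair_lip2 fp (le_trans s0 su) uv (le_trans vt tT).
by rewrite (le_trans H1 H) (le_trans H2 H).
Qed.

(* When the first front moves during [s, t] without being behind the second one
   throughout, [W] is almost nonnegative near its whole path. *)
Lemma front_contact N k : 0 <= N -> 0 < k -> exists2 d : R, 0 < d &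
  forall s t e y, 0 <= s -> s <= t -> t <= T -> t - s <= d -> 0 < e -> e <= d ->
  `|y| <= N -> (exists2 r, s <= r <= t & x2 r <= x1 r) ->
  jump (mollifier y e) (x1 s) (x1 t) = 0 \/ - k <= W (t, y).
Proof.
move=> N0 k0; have k20 : 0 < k / 2 by rewrite divr_gt0.
have L0 := pair_L_gt0 fp.
have [df df0 Hf] := pair_front fp k20.
have [dW dW0 HW] := pair_continuous fp (N + 1) k20.
(* Let [K = L * (t - s)] bound the motion of either front. These choices give [K + e < dW] and
   [K + e <= 1], so [W] varies by less than [k / 2] between the contact point and [y], and
   [2 * K <= df]. *)
exists (Num.min (Num.min (dW / 4) (1 / 2))
         (Num.min (df / (2 * L)) (Num.min (dW / (4 * L)) (1 / (2 * L))))).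
  have L2 : 0 < 2 * L by rewrite mulr_gt0.
  have L4 : 0 < 4 * L by rewrite mulr_gt0.
  by rewrite !lt_min !divr_gt0.
move=> s t e y s0 st tT; rewrite !le_min.
move=> /andP[/andP[tsW _] /andP[tsf /andP[tsL ts1]]] e0 /andP[/andP[eW e1] _] yN.
move=> [r0 /andP[sr0 r0t] x21].
have [x1E|x1st] := eqVneq (x1 s) (x1 t).
  left; apply: jump_eq0 => x; rewrite x1E => /andP[H1 H2].
  by move: (lt_le_trans H1 H2); rewrite ltxx.
have [/andP[a1 a2] _] := pair_lip_sub s0 tT (lexx _) st (lexx _).
have {}x1st : x1 s < x1 t by rewrite lt_neqAle x1st -subr_ge0.
have [r /andP[sr rt] Hr] := Hf s t s0 st tT x1st.
have [/andP[b1 b2] _] := pair_lip_sub s0 tT (lexx _) sr rt.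
have [/andP[c1 c2] _] := pair_lip_sub s0 tT sr rt (lexx _).
move: tsf tsL ts1; rewrite !ler_pdivlMr ?mulr_gt0// => tsf tsL ts1.
have [K Kdef] : exists K, K = L * (t - s) by exists (L * (t - s)).
have Kf : 2 * K <= df by rewrite Kdef; lra_from T0 fp tsf.
have KW : 4 * K <= dW by rewrite Kdef; lra_from T0 fp tsL.
have K1 : 2 * K <= 1 by rewrite Kdef; lra_from T0 fp ts1.
(* The order of the fronts is known at [r0], the contact happens at [r]. The motion in between is
   absorbed by the tolerance [df] of [pair_front]. *)
have x2r : x2 r - df <= x1 r.
  have [rr|/ltW rr] := leP r r0.
    have [/andP[p1 p2] /andP[q1 q2]] := pair_lip_sub s0 tT sr rr r0t.
    by rewrite -Kdef in p1 p2 q1 q2; lra_from T0 fp p1 p2 q1 q2 Kf x21.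
  have [/andP[p1 p2] /andP[q1 q2]] := pair_lip_sub s0 tT sr0 rr rt.
  by rewrite -Kdef in p1 p2 q1 q2; lra_from T0 fp p1 p2 q1 q2 Kf x21.
(* Either the support of the mollifier misses the path of the front and the jump vanishes, or [y]
   lies within [K + e] of the contact point. *)
have [[x /andP[sx xt] xy]|Hfar] :=
    pselect (exists2 x, x1 s < x <= x1 t & `|x - y| < e); last first.
  left; apply: jump_eq0 => x sxt; apply: mollifier_eq0 => //.
  by rewrite leNgt; apply/negP => xy; apply: Hfar; exists x.
right; have {}Hr := Hr x2r.
have rT : 0 <= r <= T by rewrite (le_trans s0 sr) (le_trans rt tT).
have tT' : 0 <= t <= T by rewrite (le_trans s0 st).
rewrite -Kdef in a2 b2 c2.
move: xy; rewrite ltr_norml => /andP[xy1 xy2].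
have near_y : - (K + e) <= x1 r - y <= K + e.
  clear - T0 fp a1 a2 b1 b2 c1 c2 sx xt xy1 xy2.
  by apply/andP; split; lra.
have KeW : K + e < dW by lra_from T0 fp KW eW dW0.
have Ke1 : K + e <= 1 by lra_from T0 fp K1 e1.
move: near_y; rewrite -ler_norml => near_y.
have : `|W (r, x1 r) - W (t, y)| < k / 2.
  apply: HW => //.
  - have := ler_normD (x1 r - y) y; rewrite subrK => H.
    by lra_from T0 fp H near_y Ke1 yN.
  - by lra_from T0 fp yN.
  - rewrite distrC ger0_norm ?subr_ge0//; lra_from T0 fp sr rt tsW dW0.
  - exact: le_lt_trans near_y KeW.
rewrite ltr_norml => /andP[_ H].
by lra_from T0 fp H Hr.
Qed.

(* [b = false] records that the first front is not behind the second one
   throughout [s, t]; then the jump term has no effect. *)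
Lemma npart_mollify_increment N k : 0 <= N -> 0 < k ->
  exists2 e0 : R, 0 < e0 & forall e, 0 < e -> e <= e0 ->
  exists2 h : R, 0 < h <= 1 & exists2 d : R, 0 < d & forall s t y (b : bool),
  0 <= s -> s <= t -> t <= T -> t - s <= d -> `|y| <= N ->
  (b = false -> exists2 r, s <= r <= t & x2 r <= x1 r) ->
  npart k (mollify W e t y) - npart k (mollify W e s y) <=
    (t - s) * ((npart k (mollify W e t (y + h)) - 2 * npart k (mollify W e t y) +
                npart k (mollify W e t (y - h))) / h ^+ 2 + k) +
    (if b then 2 * jump (mollifier y e) (x1 s) (x1 t) else 0).
Proof.
move=> N0 k0; have k20 : 0 < k / 2 by rewrite divr_gt0.
have [da da0 Ha] := mollify_approx fp N k20.
have [dc dc0 Hc] := front_contact N0 k20.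
exists (Num.min da dc); first by rewrite lt_min da0.
move=> e e0; rewrite !le_min => /andP[eda edc].
have [h0 h00 Hh] := mollify_increment fp e0 N0 k0.
(* The bound [h <= 1] keeps [y + h] and [y - h] within distance [1] of [y], which later confines the
   shifted cutoffs to [[- (N + 1), N + 1]]. *)
pose h := Num.min h0 1.
have h_gt0 : 0 < h by rewrite lt_min h00 ltr01.
have hh0 : h <= h0 by rewrite /h ge_min lexx.
have h1 : h <= 1 by rewrite /h ge_min lexx orbT.
have [di di0 Hi] := Hh h h_gt0 hh0.
exists h; first by rewrite h_gt0.
exists (Num.min di dc); first by rewrite lt_min di0.
move=> s t y b s0 st tT; rewrite le_min => /andP[tsi tsc] yN Hb.
have ts0 : 0 <= t - s by rewrite subr_ge0.
have J10 : 0 <= jump (mollifier y e) (x1 s) (x1 t).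
  by apply: jump_ge0 => x; exact: mollifier_ge0.
have J20 : 0 <= jump (mollifier y e) (x2 s) (x2 t).
  by apply: jump_ge0 => x; exact: mollifier_ge0.
have key : mollify W e t y < - k -> b = false ->
    jump (mollifier y e) (x1 s) (x1 t) = 0.
  move=> wk bF; have [//|Wk] := Hc s t e y s0 st tT tsc e0 edc yN (Hb bF).
  have tT' : 0 <= t <= T by rewrite (le_trans s0 st).
  have := Ha e t y e0 eda tT' yN; rewrite ler_norml => /andP[H _].
  by exfalso; lra_from T0 fp wk Wk H.
exact: npart_step (exprn_gt0 2 h_gt0) ts0 k0 J10 J20 key (Hi s t y s0 st tT tsi yN).
Qed.

Definition npart_mass (chi : R -> R) k (V : R -> R) : R :=
  (\int[mu]_y (chi y * npart k (V y)))%R.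

Section cutoff.
Variables (chi : R -> R) (N c : R).
Hypothesis N0 : 0 <= N.
Hypothesis c0 : 0 <= c.
Hypothesis chi_continuous : continuous chi.
Hypothesis chi_bounds : forall x, 0 <= chi x <= 1.
Hypothesis chi_support : forall x, N < `|x| -> chi x = 0.
Hypothesis chi_second : forall x h, 0 < h ->
  chi (x + h) - 2 * chi x + chi (x - h) <= c * h ^+ 2.

Lemma tame_chi : tame chi.
Proof. exact: tame_continuous chi_continuous chi_support. Qed.

Lemma tame_chiM (f : R -> R) : continuous f -> tame (fun x => chi x * f x).
Proof.
by move=> cf; under eq_fun do rewrite mulrC; apply: tameMc => //; exact: tame_chi.
Qed.

Lemma Rintegral_chi_le : (\int[mu]_x chi x <= 2 * N)%R.
Proof.
have -> : 2 * N = 1 * (N - - N) by ring.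
apply: Rintegral_le_itv => //.
- exact: tame_chi.
- by apply: le_trans N0; rewrite oppr_le0.
- by move=> x _; have /andP[] := chi_bounds x.
- by move=> x; rewrite -ler_norml -ltNge => /chi_support ->.
Qed.

(* Moving the second difference onto the cutoff leaves only the mass of [W]. *)
Lemma npart_diffusion k e t h : 0 < k -> 0 < e -> 0 <= t <= T -> 0 < h -> h <= 1 ->
  (forall y, `|y| <= N + 1 -> `|mollify W e t y - W (t, y)| <= k) ->
  (\int[mu]_y (chi y * (npart k (mollify W e t (y + h)) - 2 * npart k (mollify W e t y) +
     npart k (mollify W e t (y - h)))) <= c * h ^+ 2 * M0)%R.
Proof.
move=> k0 e0 tT h0 h1 wW.
pose f y := npart k (mollify W e t y).
have cf : continuous f by apply: npart_continuous; exact: mollify_continuous fp _ _ tT e0.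
rewrite (@Rintegral_second_difference _ f chi N h (ltW h0)) => //; last 2 first.
- by move=> x; exact: npart_ge0.
- by move=> x; have /andP[] := chi_bounds x.
have ch0 : 0 <= c * h ^+ 2 by rewrite mulr_ge0// exprn_ge0// ltW.
have N10 : 0 <= N + 1 by rewrite addr_ge0.
have csh (z : R) : continuous (fun x => chi (x + z)).
  move=> x; apply: (@continuous_comp _ _ _ (fun x : R => x + z) chi).
    by apply: cvgD; [exact: cvg_id|exact: cvg_cst].
  exact: chi_continuous.
have chih0 x : N + 1 < `|x| -> chi (x + h) - 2 * chi x + chi (x - h) = 0.
  move=> Nx; have nh : `|h| = h by rewrite gtr0_norm.
  have H1 := ler_normB (x + h) h; have H2 := ler_normD (x - h) h.
  rewrite addrK nh in H1; rewrite subrK nh in H2.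
  rewrite !chi_support ?mulr0 ?subr0 ?addr0//.
  - by lra_from T0 fp N0 c0 chi_continuous chi_bounds chi_support chi_second H2 h1 Nx.
  - by lra_from T0 fp N0 c0 chi_continuous chi_bounds chi_support chi_second Nx.
  - by lra_from T0 fp N0 c0 chi_continuous chi_bounds chi_support chi_second H1 h1 Nx.
have cd : continuous (fun x : R => chi (x + h) - 2 * chi x + chi (x - h)).
  move=> x; apply: cvgD; last exact: (csh (- h)).
  by apply: cvgB; [exact: (csh h)|apply: cvgM; [exact: cvg_cst|exact: chi_continuous]].
apply: (@le_trans _ _ (\int[mu]_x (c * h ^+ 2 * (`|W (t, x)| * \1_`[- (N + 1), N + 1] x)))%R).
  apply: Rintegral_tame_le.
  - by under eq_fun do rewrite mulrC; apply: tameMc => //; exact: tame_continuous cd chih0.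
  - by apply: tameZ; exact: tame_normW fp _ _ tT N10.
  - move=> x; have [xN|/chih0 ->] := leP `|x| (N + 1); last first.
      by rewrite mul0r mulr_ge0// mulr_ge0// indicE.
    rewrite indicE mem_set /= ?in_itv/= -?ler_norml// mulr1.
    have f0 : 0 <= f x by exact: npart_ge0.
    apply: (@le_trans _ _ (c * h ^+ 2 * f x)); first by rewrite ler_wpM2r// chi_second.
    (* The threshold exactly offsets the approximation error: [- w - k <= - W <= |W|] when
       [|w - W| <= k]. *)
    rewrite ler_wpM2l// /f /npart ge_max normr_ge0 andbT.
    have := wW x xN; rewrite ler_norml => /andP[H1 H2].
    have H3 := ler_norm (- W (t, x)); rewrite normrN in H3.
    by lra_from T0 fp N0 c0 chi_continuous chi_bounds chi_support chi_second H1 H2 H3.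
rewrite Rintegral_tameZ; last exact: tame_normW fp _ _ tT N10.
by rewrite ler_wpM2l//; exact: (pair_mass fp).
Qed.

(** The mollifier is at most [Bm / e], and the front travels at most [e], so only centres within
    [2 * e] of its starting point can see it. Integration in [y] then cancels the factor [1 / e]. *)
Lemma npart_mass_jump e (s t : R) Bm : 0 < e -> 0 <= s -> s <= t -> t <= T ->
  L * (t - s) <= e -> 0 < Bm ->
  (forall y e x, 0 < e -> `|mollifier y e x| <= Bm / e) ->
  forall y, 2 * jump (mollifier y e) (x1 s) (x1 t) <=
    2 * Bm / e * (L * (t - s)) * \1_`[x1 s - 2 * e, x1 s + 2 * e] y.
Proof.
move=> e0 s0 st tT Lts Bm0 HB y.
have /andP[i0 i1] := pair_lip1 fp s0 st tT.
have Be0 : 0 <= Bm / e by rewrite divr_ge0 ?ltW.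
have [ym|ym] := boolP (y \in `[x1 s - 2 * e, x1 s + 2 * e]).
  rewrite indicE mem_set// mulr1 -!mulrA ler_pM2l// mulrA.
  apply: (le_trans (ler_norm _)).
  apply: (@le_trans _ _ (Bm / e * (x1 t - x1 s))).
    apply: jump_norm_le; last by move=> x; exact: HB.
      exact: Cn_continuous (smooth_mollifier y e 0).
    by rewrite -subr_ge0.
  by rewrite ler_wpM2l.
rewrite jump_eq0 ?mulr0; last first.
  move=> x /andP[sx xt]; apply: mollifier_eq0 => //; rewrite leNgt ltr_norml.
  apply: contra ym => /andP[a1 a2]; rewrite in_itv/=.
  clear - T0 fp N0 c0 chi_continuous chi_bounds chi_support chi_second i1 Lts sx xt a1 a2 e0.
  by apply/andP; split; lra.
apply: mulr_ge0; last by rewrite indicE.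
apply: mulr_ge0; last by rewrite (le_trans i0).
by rewrite -mulrA mulr_ge0.
Qed.

(** Clamping makes this an open subset of the whole line, hence measurable. *)
Definition behind : set R := [set r | x1 (clamp T r) < x2 (clamp T r)].

Lemma front1_continuous : continuous (fun r => x1 (clamp T r)).
Proof.
apply: continuous_clamp; rewrite ?ltW// => e e0; exists (e / L).
  by rewrite divr_gt0// (pair_L_gt0 fp).
have H s t : 0 <= s -> s <= t -> t <= T -> t - s < e / L -> `|x1 s - x1 t| < e.
  move=> s0 st tT; rewrite ltr_pdivlMr ?(pair_L_gt0 fp)// => tse.
  have /andP[i0 i1] := pair_lip1 fp s0 st tT.
  by rewrite distrC ger0_norm//; apply: le_lt_trans i1 _; rewrite mulrC.
move=> s t /andP[s0 sT] /andP[t0 tT]; have [st|/ltW ts] := leP s t.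
  by rewrite distrC ger0_norm ?subr_ge0//; exact: H.
by rewrite ger0_norm ?subr_ge0// distrC; exact: H.
Qed.

Lemma front2_continuous : continuous (fun r => x2 (clamp T r)).
Proof.
apply: continuous_clamp; rewrite ?ltW// => e e0; exists (e / L).
  by rewrite divr_gt0// (pair_L_gt0 fp).
have H s t : 0 <= s -> s <= t -> t <= T -> t - s < e / L -> `|x2 s - x2 t| < e.
  move=> s0 st tT; rewrite ltr_pdivlMr ?(pair_L_gt0 fp)// => tse.
  have /andP[i0 i1] := pair_lip2 fp s0 st tT.
  by rewrite distrC ger0_norm//; apply: le_lt_trans i1 _; rewrite mulrC.
move=> s t /andP[s0 sT] /andP[t0 tT]; have [st|/ltW ts] := leP s t.
  by rewrite distrC ger0_norm ?subr_ge0//; exact: H.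
by rewrite ger0_norm ?subr_ge0// distrC; exact: H.
Qed.

Lemma gap_continuous : continuous (fun r => x1 (clamp T r) - x2 (clamp T r)).
Proof.
by move=> r; apply: cvgB; [exact: front1_continuous|exact: front2_continuous].
Qed.

Lemma measurable_behind : measurable behind.
Proof.
apply: measurable_realfun.open_measurable.
have -> : behind = (fun r => x1 (clamp T r) - x2 (clamp T r)) @^-1` [set x | x < 0].
  by apply/seteqP; split => r /=; rewrite /behind /= subr_lt0.
by apply: open_comp => // r _; exact: gap_continuous.
Qed.

(** The pointwise step is integrated against the cutoff: diffusion yields [c * M0], the error [k] is
    weighted by the integral of [chi], at most [2 * N], and the jump yields [K], which is chosen
    before [k] and [e]. *)
Lemma npart_mass_step : exists2 K : R, 0 <= K & forall k, 0 < k ->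
  exists2 e1 : R, 0 < e1 & forall e, 0 < e -> e <= e1 ->
  exists2 d : R, 0 < d & forall s t, 0 <= s -> s <= t -> t <= T -> t - s <= d ->
  npart_mass chi k (mollify W e t) - npart_mass chi k (mollify W e s) <=
    K * (occ behind 0 t - occ behind 0 s) + (c * M0 + 2 * N * k) * (t - s).
Proof.
have L0 := pair_L_gt0 fp.
have [Bm Bm0 HB] := @mollifier_bounded R.
have K0 : 0 <= 8 * Bm * L by rewrite !mulr_ge0// ltW.
exists (8 * Bm * L) => // k k0.
have [e0 e00 He] := npart_mollify_increment N0 k0.
have [da da0 Ha] := mollify_approx fp (N + 1) k0.
exists (Num.min e0 da); first by rewrite lt_min e00.
move=> e e_gt0; rewrite le_min => /andP[ee0 eda].
have [h /andP[h0 h1] [d d0 Hd]] := He e e_gt0 ee0.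
exists (Num.min d (e / L)); first by rewrite lt_min d0 divr_gt0.
move=> s t s0 st tT; rewrite le_min => /andP[tsd tse].
have Lts : L * (t - s) <= e by move: tse; rewrite ler_pdivlMr// mulrC.
have tT' : 0 <= t <= T by rewrite (le_trans s0 st).
have sT' : 0 <= s <= T by rewrite s0 (le_trans st tT).
have ts0 : 0 <= t - s by rewrite subr_ge0.
have hh : 0 < h ^+ 2 by rewrite exprn_gt0.
(* If the first front is strictly behind during all of [[s, t]], the whole step is charged to [occ].
   Otherwise there is a time with the right order, and the jump has no effect. *)
pose b := `[< forall r, s <= r <= t -> x1 r < x2 r >].
have bP : b = false -> exists2 r, s <= r <= t & x2 r <= x1 r.
  move=> /negbT/asboolPn/existsNP[r /not_implyP[rst /negP]]; rewrite -leNgt => ?.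
  by exists r.
have cnp u : 0 <= u <= T -> continuous (fun y => npart k (mollify W e u y)).
  by move=> uT; apply: npart_continuous; exact: mollify_continuous fp _ _ uT e_gt0.
pose nt y := npart k (mollify W e t y); pose ns y := npart k (mollify W e s y).
have cnt : continuous nt := cnp t tT'; have cns : continuous ns := cnp s sT'.
pose sd y := nt (y + h) - 2 * nt y + nt (y - h).
have csd : continuous sd.
  have csh (z : R) : continuous (fun x => nt (x + z)).
    move=> x; apply: (@continuous_comp _ _ _ (fun x : R => x + z) nt).
      by apply: cvgD; [exact: cvg_id|exact: cvg_cst].
    exact: cnt.
  move=> x; apply: cvgD; last exact: (csh (- h)).
  by apply: cvgB; [exact: (csh h)|apply: cvgM; [exact: cvg_cst|exact: cnt]].
pose A := 2 * Bm / e * (L * (t - s)).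
have A0 : 0 <= A by rewrite /A !mulr_ge0 ?invr_ge0// ltW.
pose i := `[x1 s - 2 * e, x1 s + 2 * e].
have ti : tame (\1_[set` i] : R -> R).
  apply: (@tame_indic _ _ (`|x1 s| + 2 * e)).
    move=> y; rewrite /i /= !in_itv/= => /andP[y1 y2].
    have n1 := ler_norm (x1 s); have n2 := ler_norm (- x1 s); rewrite normrN in n2.
    clear - T0 fp N0 c0 chi_continuous chi_bounds chi_support chi_second y1 y2 n1 n2.
    by apply/andP; split; lra.
  by rewrite addr_ge0// mulr_ge0// ltW.
have tsdc := tame_chiM csd.
rewrite /npart_mass -Rintegral_tameB; [|exact: tame_chiM..].
apply: (@le_trans _ _ (\int[mu]_y ((t - s) * ((h ^+ 2)^-1 * (chi y * sd y) + k * chi y) +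
    (if b then A else 0) * \1_[set` i] y))%R).
  apply: Rintegral_tame_le.
  - by apply: tameB; exact: tame_chiM.
  - apply: tameD; last exact: tameZ.
    by apply: tameZ; apply: tameD; apply: tameZ => //; exact: tame_chi.
  - move=> y; rewrite -mulrBr.
    have bA : 0 <= (if b then A else 0) * \1_[set` i] y.
      by rewrite mulr_ge0 ?indicE//; case: ifP.
    have [yN|/chi_support ->] := leP `|y| N; last by rewrite !(mul0r, mulr0, addr0, add0r).
    have /andP[c1 c2] := chi_bounds y.
    have H : nt y - ns y <= (t - s) * (sd y / h ^+ 2 + k) +
        (if b then 2 * jump (mollifier y e) (x1 s) (x1 t) else 0).
      exact: Hd s t y b s0 st tT tsd yN bP.
    apply: (@le_trans _ _ (chi y * ((t - s) * (sd y / h ^+ 2 + k) +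
        (if b then A else 0) * \1_[set` i] y))).
      apply: ler_wpM2l => //; apply: (le_trans H); rewrite lerD2l.
      by case: (b) => //; rewrite ?mul0r//; exact: npart_mass_jump.
    rewrite mulrDr; apply: lerD; last by rewrite -[leRHS]mul1r ler_wpM2r.
    rewrite le_eqVlt; apply/orP; left; apply/eqP; ring.
have tc := tame_chi.
have t1 := tameZ (h ^+ 2)^-1 tsdc; have t2 := tameZ k tc.
have t3 := tameD t1 t2; have t4 := tameZ (t - s) t3.
have t5 := tameZ (if b then A else 0) ti.
rewrite (Rintegral_tameD t4 t5) (Rintegral_tameZ _ t3) (Rintegral_tameZ _ ti).
rewrite (Rintegral_tameD t1 t2) (Rintegral_tameZ _ tsdc) (Rintegral_tameZ _ tc).
rewrite addrC; apply: lerD.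
  have [bT|bF] := boolP b; last first.
    by rewrite mul0r mulr_ge0// subr_ge0; apply: occ_nd => //; exact: measurable_behind.
  (* The length [4 * e] times the height [2 * Bm / e] gives the constant [8 * Bm], free of [e]. *)
  have -> : (\int[mu]_x \1_[set` i] x = 4 * e)%R.
    rewrite Rintegral_indic_itv lebesgue_measure_itv/= lte_fin ifT.
      by rewrite /=; ring.
    by rewrite ltrBlDr -addrA ltrDl addr_gt0// mulr_gt0.
  rewrite occ_incr_full//; first by rewrite /A le_eqVlt; apply/orP; left; apply/eqP; field; rewrite gt_eqF.
    exact: measurable_behind.
  move=> r /=; rewrite in_itv/= => /andP[sr rt]; rewrite /behind /= clamp_id.
    by move/asboolP: bT; apply; rewrite (ltW sr).
  by rewrite (le_trans s0 (ltW sr)) (le_trans rt tT).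
rewrite mulrC ler_wpM2r//; apply: lerD.
  rewrite mulrC ler_pdivrMr// mulrAC.
  exact: (npart_diffusion k0 e_gt0 tT' h0 h1 (fun y => Ha e t y e_gt0 eda tT')).
by rewrite mulrC ler_wpM2r ?Rintegral_chi_le// ltW.
Qed.

Lemma npart_mass_approx k e t : 0 < k -> 0 < e -> 0 <= t <= T ->
  (forall y, `|y| <= N -> `|mollify W e t y - W (t, y)| <= k) ->
  `|npart_mass chi 0 (fun y => W (t, y)) - npart_mass chi k (mollify W e t)|
    <= 4 * N * k.
Proof.
move=> k0 e0 tT Hk.
have cW : continuous (fun y => npart 0 (W (t, y))).
  by apply: npart_continuous; exact: W_slice_continuous fp _ tT.
have cw : continuous (fun y => npart k (mollify W e t y)).
  by apply: npart_continuous; exact: mollify_continuous fp _ _ tT e0.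
rewrite /npart_mass -Rintegral_tameB; [|exact: tame_chiM..].
have -> : 4 * N * k = (k + k) * (N - - N) by ring.
apply: Rintegral_norm_le.
- by apply: tameB; exact: tame_chiM.
- by apply: le_trans N0; rewrite oppr_le0.
- by rewrite addr_ge0// ltW.
- move=> y; rewrite -ler_norml => yN; rewrite -mulrBr normrM.
  have /andP[a0 a1] := chi_bounds y; rewrite (ger0_norm a0) -[leRHS]mul1r.
  apply: ler_pM => //; apply: (le_trans (npart_lipschitz _ _ _ _)).
  by rewrite sub0r normrN (gtr0_norm k0) lerD2l distrC; exact: Hk.
- by move=> y; rewrite -ler_norml -ltNge => /chi_support ->; rewrite !mul0r subrr.
Qed.

(** The short steps are chained at fixed [k] and [e]; afterwards [k] tends to [0], which is harmless
    because [K] does not depend on it. *)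
Lemma negative_mass_increment : exists2 K : R, 0 <= K &
  forall s t, 0 <= s -> s <= t -> t <= T ->
  npart_mass chi 0 (fun y => W (t, y)) - npart_mass chi 0 (fun y => W (s, y)) <=
    K * (occ behind 0 t - occ behind 0 s) + c * M0 * (t - s).
Proof.
have [K K0 HK] := npart_mass_step; exists K => // s t s0 st tT.
apply/ler_addgt0Pr => e' e'0.
(* The errors are [2 * N * k * (t - s)] from the steps and [4 * N * k] from the approximation at
   each of the two times; the summand [1] keeps the divisor positive. *)
have D0 : 0 < 2 * N * (t - s) + 8 * N + 1.
  by rewrite ltr_wpDl// addr_ge0// !mulr_ge0// subr_ge0.
have [k k0 kE] : exists2 k, 0 < k & k * (2 * N * (t - s) + 8 * N + 1) = e'.
  by exists (e' / (2 * N * (t - s) + 8 * N + 1)); rewrite ?divr_gt0// divfK// gt_eqF.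
have [e1 e10 He1] := HK k k0; have [da da0 Ha] := mollify_approx fp N k0.
pose e := Num.min e1 da.
have e0 : 0 < e by rewrite lt_min e10.
have ee1 : e <= e1 by rewrite /e ge_min lexx.
have eda : e <= da by rewrite /e ge_min lexx orbT.
have [d d0 Hd] := He1 e e0 ee1.
pose psi r := K * occ behind 0 r + (c * M0 + 2 * N * k) * r -
  npart_mass chi k (mollify W e r).
have psi_le u v : 0 <= u -> u <= v -> v <= T -> v - u <= d -> psi u <= psi v.
  move=> u0 uv vT vu; have := Hd u v u0 uv vT vu; rewrite /psi.
  move: (npart_mass chi k (mollify W e u)) (npart_mass chi k (mollify W e v)).
  move: (occ behind 0 u) (occ behind 0 v) => a1 a2 a3 a4 H.
  by lra_from T0 fp N0 c0 chi_continuous chi_bounds chi_support chi_second H.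
have : psi s <= psi t.
  apply: (small_step_nondecreasing st d0) => u v su uv vt.
  exact: psi_le (le_trans s0 su) uv (le_trans vt tT).
have tT' : 0 <= t <= T by rewrite (le_trans s0 st).
have sT' : 0 <= s <= T by rewrite s0 (le_trans st tT).
have := npart_mass_approx k0 e0 tT' (fun y => Ha e t y e0 eda tT').
have := npart_mass_approx k0 e0 sT' (fun y => Ha e s y e0 eda sT').
rewrite /psi; move: (npart_mass chi k (mollify W e s)) (npart_mass chi k (mollify W e t)).
move: (npart_mass chi 0 (fun y => W (s, y))) (npart_mass chi 0 (fun y => W (t, y))).
move: (occ behind 0 s) (occ behind 0 t) => o1 o2 A1 A2 B1 B2.
rewrite !ler_norml => /andP[a1 a2] /andP[b1 b2] H.
clear - T0 fp N0 c0 chi_continuous chi_bounds chi_support chi_second a1 a2 b1 b2 H kE k0.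
by lra.
Qed.

End cutoff.
End negative_mass.

(** * Comparison of the fronts *)

(** By the balance, the increment of [a - 2 * (y1 - y2)] is that of [b] up to [c * M * r], so it
    inherits the growth bound of [b]. The constants are enlarged to be common to both
    conclusions. *)
Lemma mass_exchange (R : realType) (a_t a_s b_t b_s K K' p q c M M' r y1t y1s y2t y2s : R) :
  0 <= K -> 0 <= K' -> 0 <= p -> 0 <= q -> 0 <= c * M' * r ->
  a_t - a_s <= K * p + c * M * r -> b_t - b_s <= K' * q + c * M' * r ->
  `|b_t - a_t - (b_s - a_s) + 2 * (y1t - y1s - (y2t - y2s))| <= c * M * r ->
  a_t - a_s <= (K + K') * p + c * (M + M') * r /\
  (a_t - 2 * (y1t - y2t)) - (a_s - 2 * (y1s - y2s)) <=
    (K + K') * q + c * (M + M') * r.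
Proof.
move=> K0 K'0 p0 q0 m H H'; rewrite ler_norml => /andP[B1 B2].
have m1 := mulr_ge0 K'0 p0; have m2 := mulr_ge0 K0 q0.
by split; lra.
Qed.

Section comparison.
Context {R : realType}.
Notation mu := (@lebesgue_measure R).
Implicit Types (s t u v x y n : R).
Variables (T : R) (W : R * R -> R) (x1 x2 : R -> R) (L M0 L' M0' : R).
Hypothesis T0 : 0 < T.
Hypothesis fp : front_pair T W x1 x2 L M0.
Hypothesis fp' : front_pair T (fun z => - W z) x2 x1 L' M0'.

Let gap (r : R) : R := x1 (clamp T r) - x2 (clamp T r).

(** Zero is excluded on purpose: the fronts may coincide for a set of times of positive measure, and
    only without these times do the sets shrink to the empty set. *)
Definition narrow (th : R) : set R := [set r | 0 < `|gap r| < th].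

Lemma measurable_narrow th : measurable (narrow th).
Proof.
have cg := gap_continuous T0 fp.
have cn : continuous (fun r => `|gap r|) by move=> r; apply: cvg_norm; exact: cg.
apply: measurable_realfun.open_measurable.
have -> : narrow th = (fun r => `|gap r|) @^-1` `]0, th[.
  by apply/seteqP; split => r /=; rewrite in_itv.
by apply: open_comp => //; exact: interval_open.
Qed.

(** Continuity from above of the measure along the decreasing sets with [th = 1 / (i + 1)]. *)
Lemma narrow_small e : 0 < e -> exists2 th : R, 0 < th & occ (narrow th) 0 T < e.
Proof.
move=> e0; pose F (i : nat) := narrow i.+1%:R^-1 `&` `[0, T].
have mF i : measurable (F i) by apply: measurableI => //; exact: measurable_narrow.
have F0 : \bigcap_i F i = set0.
  apply/seteqP; split => // r /= H.
  have [/andP[g0 _] _] := H 0%N I.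
  have [i _ Hi] := near_infty_natSinv_lt (PosNum g0).
  have [/andP[_ gi] _] := H i I.
  by move: (Hi i (leqnn i)); rewrite /= ltNge (ltW gi).
have : mu (F n) @[n --> \oo] --> mu (\bigcap_i F i).
  apply: nonincreasing_cvg_mu => //.
  - exact: lebesgue_measure_itv_fin (measurable_narrow _) (fun x H => H).
  - by rewrite F0; exact: measurable0.
  - move=> i j ij; apply/subsetPset => r [/andP[g0 gj] rT]; split => //.
    apply/andP; split => //; apply: lt_le_trans gj _.
    by rewrite lef_pV2 ?posrE// ler_nat.
rewrite F0 measure0 => /fine_cvgP[_ /cvgrPdist_lt/(_ _ e0)[i _ Hi]].
exists i.+1%:R^-1; first by rewrite invr_gt0.
have := Hi i (leqnn i); rewrite /= sub0r normrN; apply: le_lt_trans.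
exact: ler_norm.
Qed.

Lemma npart0B (w : R) : npart 0 (- w) - npart 0 w = w.
Proof.
rewrite /npart /Num.max !subr0 opprK.
by case: (ltP w 0) => ?; case: (ltP (- w) 0) => ?; lra.
Qed.

Section cutoff.
Variables (chi chi1 chi2 : R -> R) (n C : R).
Hypothesis n0 : 0 < n.
Hypothesis C0 : 0 < C.
Hypothesis schi : smooth chi.
Hypothesis dchi : forall x : R, is_derive x 1 chi (chi1 x).
Hypothesis dchi1 : forall x : R, is_derive x 1 chi1 (chi2 x).
Hypothesis chi_in : forall x, `|x| <= n -> chi x = 1.
Hypothesis chi_out : forall x, 3 * n < `|x| -> chi x = 0.
Hypothesis chi_bounds : forall x, 0 <= chi x <= 1.
Hypothesis chi2_le : forall x, `|chi2 x| <= C / n ^+ 2.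
Hypothesis front1_in : forall t, 0 <= t <= T -> `|x1 t| <= n.
Hypothesis front2_in : forall t, 0 <= t <= T -> `|x2 t| <= n.
Let c := C / n ^+ 2.
Let A t := npart_mass chi 0 (fun y => W (t, y)).
(** It stands in for the mass of the positive part, whose growth it shares up to the balance error.
    Unlike that mass, it compares with [A] exactly according to the sign of the gap. *)
Let A' t := A t - 2 * (x1 t - x2 t).

Lemma chi_second x h : 0 < h -> chi (x + h) - 2 * chi x + chi (x - h) <= c * h ^+ 2.
Proof.
move=> h0; have [z _ ->] := second_difference x h0 dchi dchi1.
by rewrite ler_wpM2r ?exprn_ge0 ?(ltW h0)// (le_trans (ler_norm _)).
Qed.

Lemma chi2_tame : tame chi2.
Proof.
have [g D1' sg] := smooth_derive schi; have [h D2' sh] := smooth_derive sg.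
have gE : chi1 = g.
  by apply/funext => x; rewrite -(@derive_val _ _ _ _ _ _ _ (dchi x)) derive_val.
have hE : chi2 = h.
  apply/funext => x; rewrite -(@derive_val _ _ _ _ _ _ _ (dchi1 x)).
  by rewrite gE (@derive_val _ _ _ _ _ _ _ (D2' x)).
apply: (@tame_continuous _ _ (3 * n)); first by rewrite hE; exact: (sh 0).
exact: support_derive dchi1 (support_derive dchi chi_out).
Qed.

Lemma jump_chi (xi : R -> R) s t : xi s <= xi t -> `|xi s| <= n -> `|xi t| <= n ->
  jump chi (xi s) (xi t) = xi t - xi s.
Proof.
move=> st; rewrite !ler_norml => /andP[s1 s2] /andP[t1 t2].
apply: jump_eq1 => // x /andP[sx xt]; apply: chi_in; rewrite ler_norml.
by rewrite (le_trans s1 (ltW sx)) (le_trans xt t2).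
Qed.

Lemma c_ge0 : 0 <= c.
Proof. by rewrite /c divr_ge0 ?exprn_ge0// ltW. Qed.

(* The integral of [W] against the cutoff compensates the gap between the fronts. *)
Lemma mass_balance s t : 0 <= s -> s <= t -> t <= T ->
  `|(\int[mu]_x (W (t, x) * chi x))%R - (\int[mu]_x (W (s, x) * chi x))%R +
    2 * ((x1 t - x1 s) - (x2 t - x2 s))| <= c * M0 * (t - s).
Proof.
move=> s0 st tT; have tT' : 0 <= t <= T by rewrite (le_trans s0 st).
have sT' : 0 <= s <= T by rewrite s0 (le_trans st tT).
have := @pair_increment _ _ _ _ _ _ _ fp _ _ _ (3 * n) schi dchi dchi1 chi_out
  s t 0 (c * M0) s0 st tT.
rewrite mulr0 subr0 !jump_chi ?front1_in ?front2_in//.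
- apply=> r /andP[sr rt]; rewrite subr0.
  apply: (mass_bound fp (k := 3 * n)) => //.
  + by rewrite (le_trans s0 sr) (le_trans rt tT).
  + exact: c_ge0.
  + by rewrite mulr_ge0// ltW.
  + exact: chi2_tame.
  + exact: support_derive dchi1 (support_derive dchi chi_out).
- by have /andP[+ _] := pair_lip2 fp s0 st tT; rewrite subr_ge0.
- by have /andP[+ _] := pair_lip1 fp s0 st tT; rewrite subr_ge0.
Qed.

Lemma npart_mass_balance t : 0 <= t <= T ->
  npart_mass chi 0 (fun y => - W (t, y)) - A t = (\int[mu]_x (W (t, x) * chi x))%R.
Proof.
move=> tT; have cW := W_slice_continuous fp tT; have cW' := W_slice_continuous fp' tT.
rewrite /A /npart_mass -Rintegral_tameB.
- by apply: eq_Rintegral => x _; rewrite -mulrBr npart0B mulrC.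
- by apply: (tame_chiM (schi 0) chi_out); exact: npart_continuous.
- by apply: (tame_chiM (schi 0) chi_out); exact: npart_continuous.
Qed.

Lemma mass_increments : exists2 K : R, 0 <= K & forall s t, 0 <= s -> s <= t -> t <= T ->
  A t - A s <= K * (occ (behind T x1 x2) 0 t - occ (behind T x1 x2) 0 s) +
    c * (M0 + M0') * (t - s) /\
  A' t - A' s <= K * (occ (behind T x2 x1) 0 t - occ (behind T x2 x1) 0 s) +
    c * (M0 + M0') * (t - s).
Proof.
have N0 : 0 <= 3 * n by rewrite mulr_ge0// ltW.
have cchi : continuous chi := schi 0.
have [K K0 HK] := negative_mass_increment T0 fp N0 c_ge0 cchi chi_bounds chi_out chi_second.
have [K' K'0 HK'] := negative_mass_increment T0 fp' N0 c_ge0 cchi chi_bounds chi_out chi_second.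
exists (K + K'); first exact: addr_ge0.
move=> s t s0 st tT; have H := HK s t s0 st tT; have H' := HK' s t s0 st tT.
have B := mass_balance s0 st tT.
have tT' : 0 <= t <= T by rewrite (le_trans s0 st).
have sT' : 0 <= s <= T by rewrite s0 (le_trans st tT).
rewrite -!npart_mass_balance// in B.
have o1 : 0 <= occ (behind T x1 x2) 0 t - occ (behind T x1 x2) 0 s.
  by rewrite subr_ge0; exact: occ_nd (measurable_behind T0 fp) s0 st.
have o2 : 0 <= occ (behind T x2 x1) 0 t - occ (behind T x2 x1) 0 s.
  by rewrite subr_ge0; exact: occ_nd (measurable_behind T0 fp') s0 st.
have m3 : 0 <= c * M0' * (t - s).
  apply: mulr_ge0; last by rewrite subr_ge0.
  by apply: mulr_ge0; [exact: c_ge0|exact: (pair_mass_ge0 fp')].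
exact: mass_exchange K0 K'0 o1 o2 m3 H H' B.
Qed.

Lemma A_init : A 0 = 0.
Proof.
rewrite /A /npart_mass (@eq_Rintegral _ _ _ _ _ (fun=> 0)).
  by rewrite Rintegral_cst// mul0r.
by move=> x _; rewrite (pair_init fp) /npart oppr0 addr0 maxxx mulr0.
Qed.

Lemma front_gap_init : x1 0 - x2 0 = 0.
Proof. by rewrite (pair_front_init fp) subrr. Qed.

Let F t := Num.max (A t) (A' t).

(* The functional [F] is nonincreasing up to the time the gap spends in
   [0 < |gap| < th]: off its zero set the sign of the gap selects the branch of the
   maximum whose growth term vanishes, and near its zeros both branches grow only
   while the gap is narrow. *)
Lemma F_bound : exists2 K : R, 0 <= K & forall th t, 0 < th -> 0 <= t <= T ->
  F t <= K * occ (narrow th) 0 t + c * (M0 + M0') * t.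
Proof.
have [K K0 HK] := mass_increments; exists K => // th t th0 /andP[t0 tT].
pose psi r := K * occ (narrow th) 0 r + c * (M0 + M0') * r - F r.
have mn := measurable_narrow th.
have F_0 : F 0 = 0.
  by rewrite /F /A' A_init front_gap_init mulr0 subr0 maxxx.
suff : psi 0 <= psi t.
  by rewrite /psi occ_start// F_0 !mulr0 addr0 subr0 subr_ge0.
have cg := gap_continuous T0 fp.
have occ_sub (S : set R) u v : measurable S -> 0 <= u -> u <= v ->
    S `&` `]u, v] `<=` narrow th ->
    K * (occ S 0 v - occ S 0 u) <= K * (occ (narrow th) 0 v - occ (narrow th) 0 u).
  by move=> mS u0 uv sub; rewrite ler_wpM2l//; exact: occ_incr_le.
have gapE r : 0 <= r -> r <= T -> gap r = x1 r - x2 r.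
  by move=> r0 rT; rewrite /gap clamp_id// r0.
have local r : exists2 d : R, 0 < d & forall u v, 0 <= u -> u <= v -> v <= t ->
    `|u - r| < d -> `|v - r| < d -> psi u <= psi v.
  have nb (d : R) (u v z : R) : `|u - r| < d -> `|v - r| < d -> u <= z <= v -> `|z - r| < d.
    rewrite !ltr_norml => /andP[a1 a2] /andP[b1 b2] /andP[uz zv].
    by rewrite (lt_le_trans a1) ?lerD2r//= (le_lt_trans _ b2)// lerD2r.
  (* The sign of the gap at the end time [v] alone tells which branch realizes [F v], and [F u]
     dominates both branches at [u]. Hence only the growth of the selected branch has to be charged
     to narrow times; in the third case both are. *)
  have step u v : 0 <= u -> u <= v -> v <= t ->
      [\/ 0 <= gap v /\ behind T x1 x2 `&` `]u, v] `<=` narrow th,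
          gap v <= 0 /\ behind T x2 x1 `&` `]u, v] `<=` narrow th |
          behind T x1 x2 `&` `]u, v] `<=` narrow th /\
          behind T x2 x1 `&` `]u, v] `<=` narrow th] -> psi u <= psi v.
    move=> u0 uv vt H; have vT := le_trans vt tT.
    have [I1 I2] := HK u v u0 uv vT.
    have v0 := le_trans u0 uv.
    pose X := K * (occ (narrow th) 0 v - occ (narrow th) 0 u) + c * (M0 + M0') * (v - u).
    have X1 : behind T x1 x2 `&` `]u, v] `<=` narrow th -> A v <= A u + X.
      move=> sub; rewrite addrC -lerBlDr; apply: (le_trans I1).
      by rewrite lerD2r; apply: occ_sub => //; exact: measurable_behind fp.
    have X2 : behind T x2 x1 `&` `]u, v] `<=` narrow th -> A' v <= A' u + X.
      move=> sub; rewrite addrC -lerBlDr; apply: (le_trans I2).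
      by rewrite lerD2r; apply: occ_sub => //; exact: measurable_behind fp'.
    have uF : A u <= F u by rewrite le_max lexx.
    have uF' : A' u <= F u by rewrite le_max lexx orbT.
    have vE : A' v = A v - 2 * gap v by rewrite gapE.
    have FX : F v <= F u + X.
      rewrite /F ge_max -/(F u); case: H => [[g0 /X1 a1]|[g0 /X2 a1]|[/X1 a1 /X2 a2]].
      - rewrite (le_trans a1) ?lerD2r//= vE (le_trans _ (le_trans a1 _)) ?lerD2r//.
        by rewrite gerBl mulr_ge0.
      - rewrite [X in _ && X](le_trans a1) ?lerD2r// andbT.
        rewrite (le_trans _ (le_trans a1 _)) ?lerD2r// vE lerDl oppr_ge0.
        by rewrite mulr_ge0_le0.
      - by rewrite (le_trans a1) ?(le_trans a2) ?lerD2r.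
    move: FX; rewrite /X /psi.
    move: (F u) (F v) (occ (narrow th) 0 u) (occ (narrow th) 0 v) (c * (M0 + M0')).
    move=> f1 f2 o1 o2 cM {}H.
    suff : f2 - f1 <= K * o2 - K * o1 + (cM * v - cM * u) by lra.
    by rewrite lerBlDl -!mulrBr.
  have bd d u v z : `|u - r| < d -> `|v - r| < d -> 0 <= u -> v <= t -> z \in `]u, v] ->
      `|z - r| < d /\ gap z = x1 z - x2 z /\ clamp T z = z.
    move=> ur vr u0 vt; rewrite in_itv/= => /andP[uz zv].
    have z0 := le_trans u0 (ltW uz); have zT := le_trans zv (le_trans vt tT).
    split; first by apply: (nb _ u v) => //; rewrite (ltW uz).
    by rewrite gapE// clamp_id// z0.
  have [g0|g0|g0] := ltrgt0P (gap r).
  (* Near a positive gap the first front is never behind, so the required inclusion is vacuous; the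
     next case is its mirror image. *)
  - have [d /= d0 Hd] := cvgr_gt _ (cg r) _ g0.
    exists d => // u v u0 uv vt ur vr; apply: step => //; apply: Or31.
    split; first by apply/ltW/Hd; rewrite /= distrC.
    move=> z [Dz zuv]; have [zr [zE zc]] := bd _ _ _ _ ur vr u0 vt zuv.
    move: Dz; rewrite /behind /= -subr_lt0 -/(gap z) => Dz.
    by have := Hd z; rewrite /= distrC => /(_ zr); rewrite ltNge (ltW Dz).
  - have [d /= d0 Hd] := cvgr_lt _ (cg r) _ g0.
    exists d => // u v u0 uv vt ur vr; apply: step => //; apply: Or32.
    split; first by apply/ltW/Hd; rewrite /= distrC.
    move=> z [Dz zuv]; have [zr [zE zc]] := bd _ _ _ _ ur vr u0 vt zuv.
    move: Dz; rewrite /behind /= -subr_gt0 -/(gap z) => Dz.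
    by have := Hd z; rewrite /= distrC => /(_ zr); rewrite ltNge (ltW Dz).
  (* Near a zero the gap stays below [th] in absolute value. Being behind means that it is nonzero,
     so both sets of times are narrow. *)
  - have := cg r; move=> /cvgrPdist_lt/(_ _ th0)[d /= d0 Hd].
    exists d => // u v u0 uv vt ur vr; apply: step => //; apply: Or33.
    split=> z [Dz zuv]; have [zr [zE zc]] := bd _ _ _ _ ur vr u0 vt zuv.
    + have := Hd z; rewrite /= distrC => /(_ zr).
      rewrite -/(gap r) -/(gap z) g0 sub0r normrN /narrow /= => ->; rewrite andbT normr_gt0.
      by rewrite lt_eqF// /gap subr_lt0.
    + have := Hd z; rewrite /= distrC => /(_ zr).
      rewrite -/(gap r) -/(gap z) g0 sub0r normrN /narrow /= => ->; rewrite andbT normr_gt0.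
      by rewrite gt_eqF// /gap subr_gt0.
clearbody psi.
apply: pointwise_nondecreasing => // r /andP[r0 rt].
have [d d0 Hd] := local r; exists d => //; split=> y /andP[y0 yt] /andP[h1 h2];
  apply: Hd => //; rewrite ?subrr ?normr0// ltr_norml.
  by rewrite ltrBrDl h1 (le_lt_trans _ d0)// subr_le0.
by rewrite ltrBlDl h2 andbT (lt_le_trans _ (_ : 0 <= y - r)) ?oppr_lt0 ?subr_ge0.
Qed.

Lemma negative_mass_le t : 0 <= t <= T ->
  npart_mass chi 0 (fun y => W (t, y)) <= C / n ^+ 2 * (M0 + M0') * T /\
  npart_mass chi 0 (fun y => W (t, y)) - 2 * (x1 t - x2 t) <=
    C / n ^+ 2 * (M0 + M0') * T.
Proof.
move=> tT; suff : F t <= c * (M0 + M0') * T by rewrite /F ge_max => /andP[].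
have [K K0 HK] := F_bound; apply/ler_addgt0Pr => e e0.
have K1 : 0 < K + 1 by rewrite ltr_wpDl.
(* [K] is already fixed here, so the narrow times can be made to contribute less than [e]; [K + 1]
   avoids division by zero. *)
have [th th0 small] : exists2 th : R, 0 < th & occ (narrow th) 0 T < e / (K + 1).
  by apply: narrow_small; rewrite divr_gt0.
have /andP[t0 tT'] := tT.
have m : 0 <= c * (M0 + M0').
  apply: mulr_ge0; first exact: c_ge0.
  by apply: addr_ge0; [exact: (pair_mass_ge0 fp)|exact: (pair_mass_ge0 fp')].
apply: (le_trans (HK th t th0 tT)); rewrite addrC; apply: lerD; first exact: ler_wpM2l.
have o1 := occ_nd (measurable_narrow th) (lexx 0) t0.
have o2 := occ_nd (measurable_narrow th) t0 tT'.
rewrite (occ_start _ (measurable_narrow th)) in o1.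
apply: (@le_trans _ _ ((K + 1) * occ (narrow th) 0 T)); last first.
  by rewrite mulrC -ler_pdivlMr// ltW.
by apply: ler_pM => //; rewrite lerDl.
Qed.

End cutoff.

Lemma cutoff_mass_small t N e : 0 <= t <= T -> 0 < e -> exists chi : R -> R,
  [/\ tame (fun y => chi y * npart 0 (W (t, y))), forall x, 0 <= chi x,
      forall x, `|x| <= N -> chi x = 1,
      npart_mass chi 0 (fun y => W (t, y)) <= e &
      npart_mass chi 0 (fun y => W (t, y)) - 2 * (x1 t - x2 t) <= e].
Proof.
move=> tT e0; have [C C0 HC] := @cutoff_exists R.
have L0 := pair_L_gt0 fp.
have [D DE] : exists D, D = C * (M0 + M0') * T by exists (C * (M0 + M0') * T).
have D0 : 0 <= D.
  rewrite DE !mulr_ge0 ?addr_ge0 ?(ltW T0) ?(ltW C0)//.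
    exact: (pair_mass_ge0 fp).
  exact: (pair_mass_ge0 fp').
pose b1 := `|x1 0| + L * T; pose b2 := `|x2 0| + L * T.
(* From [n >= 1] and [n >= D / e] follows [D / n ^ 2 <= e]. The other entries place [[- N, N]] and
   both fronts, at all times, where the cutoff equals [1]. *)
pose n := Num.max (Num.max 1 (D / e)) (Num.max N (Num.max b1 b2)).
have n1 : 1 <= n by rewrite !le_max lexx.
have nD : D / e <= n by rewrite !le_max lexx orbT.
have nN : N <= n by rewrite !le_max lexx !orbT.
have nb1 : b1 <= n by rewrite !le_max lexx !orbT.
have nb2 : b2 <= n by rewrite !le_max lexx !orbT.
have n0 : 0 < n := lt_le_trans ltr01 n1.
have [chi [chi1 [chi2 [sc d1 d2 [cin cout] [cb c2]]]]] := HC n n0.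
have f1 r : 0 <= r <= T -> `|x1 r| <= n.
  by move=> rT; apply: le_trans nb1; exact: front_bounded L0 (pair_lip1 fp) rT.
have f2 r : 0 <= r <= T -> `|x2 r| <= n.
  by move=> rT; apply: le_trans nb2; exact: front_bounded L0 (pair_lip2 fp) rT.
have small : C / n ^+ 2 * (M0 + M0') * T <= e.
  have -> : C / n ^+ 2 * (M0 + M0') * T = D / n ^+ 2.
    by rewrite DE; field; rewrite gt_eqF.
  rewrite ler_pdivrMr ?exprn_gt0// mulrC expr2.
  apply: (@le_trans _ _ (n * e)); first by rewrite -ler_pdivrMr.
  by rewrite ler_pM2r// -[leLHS]mulr1 ler_pM2l.
have [H1 H2] := negative_mass_le n0 C0 sc d1 d2 cin cout cb c2 f1 f2 tT.
exists chi; split.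
- apply: (tame_chiM (sc 0) cout); apply: npart_continuous.
  exact: (W_slice_continuous fp tT).
- by move=> x; have /andP[] := cb x.
- by move=> x xN; apply: cin; apply: le_trans nN.
- exact: le_trans small.
- exact: le_trans small.
Qed.

(** The mass of the negative part is nonnegative and arbitrarily small, which gives the order of the
    fronts through [A - 2 g <= e]. A negative value of [W] would give a positive amount of mass near
    that point, the same for all cutoffs equal to [1] there. *)
Lemma front_pair_ge t : 0 <= t <= T -> (forall x, 0 <= W (t, x)) /\ x2 t <= x1 t.
Proof.
move=> tT; split => [x|]; last first.
  apply/ler_addgt0Pr => e e0; have [chi [tc c0 _ _ H]] := cutoff_mass_small 0 tT e0.
  have A0 : 0 <= npart_mass chi 0 (fun y => W (t, y)).
    by rewrite /npart_mass; apply: Rintegral_ge0 => y _; rewrite mulr_ge0// npart_ge0.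
  move: (npart_mass _ _ _) A0 H => A A0 H.
  by lra_from T0 fp fp' A0 H e0.
rewrite leNgt; apply/negP => Wx.
have [a a0 aE] : exists2 a, 0 < a & W (t, x) = - (2 * a).
  by exists (- W (t, x) / 2); [rewrite divr_gt0// oppr_gt0|field].
have lt_a : W (t, x) < - a by rewrite aE ltrN2 ltr_pMl ?ltr1n.
have cW := W_slice_continuous fp tT.
have [r /= r0 Hr] := cvgr_lt _ (cW x) _ lt_a.
have r2 : 0 < r / 2 by rewrite divr_gt0.
(* [W < - a] on [[x - r / 2, x + r / 2]] forces a mass of at least [a * r]; the cutoff is chosen to
   allow only half of it. *)
have ar : 0 < a * r / 2 by rewrite !mulr_gt0.
have [chi [tc c0 cin H _]] := cutoff_mass_small (`|x| + r / 2) tT ar.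
pose i := `[x - r / 2, x + r / 2].
have iP y : y \in i -> `|x - y| <= r / 2.
  rewrite in_itv/= ler_distlC => /andP[h1 h2].
  by apply/andP; split; rewrite ?lerBlDr// -lerBlDr.
have i_near y : y \in i -> `|y| <= `|x| + r / 2.
  move=> /iP h; have := ler_normB x (x - y); rewrite opprB addrC subrK => /le_trans; apply.
  by rewrite lerD2l.
have ti : tame (\1_[set` i] : R -> R).
  apply: (@tame_indic _ _ (`|x| + r / 2)); last by rewrite addr_ge0// ltW.
  by move=> y /i_near; rewrite ler_norml /= in_itv.
suff : a * r <= npart_mass chi 0 (fun y => W (t, y)).
  by move=> H'; have := le_trans H' H; rewrite leNgt ltr_pdivrMr// ltr_pMr ?mulr_gt0// ltr1n.
have -> : a * r = (\int[mu]_y (a * \1_[set` i] y))%R.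
  rewrite Rintegral_tameZ// Rintegral_indic_itv lebesgue_measure_itv/= lte_fin ifT.
    by rewrite /=; field.
  by rewrite ltrBlDr -addrA ltrDl addr_gt0.
apply: Rintegral_tame_le => //; first exact: tameZ.
move=> y; rewrite indicE; have [yi|yi] := boolP (y \in i); last first.
  by rewrite memNset ?mulr0 ?mulr_ge0 ?npart_ge0//; exact/negP.
rewrite mem_set// mulr1 cin ?i_near// mul1r.
have := Hr y; rewrite /= => /(_ (le_lt_trans (iP y yi) _)).
rewrite ltr_pdivrMr// ltr_pMr// ltr1n => /(_ isT) Wy.
by rewrite /npart le_max subr0 lerNr (ltW Wy).
Qed.

End comparison.

Theorem theorem3p18 (R : realType) (taufin : R) (taufin_gt0 : 0 < taufin)
    (P1 Q1 R1 P2 Q2 R2 : R * R -> R) (xi1 xi2 : R -> R)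
    (sol1 : limit_solution taufin P1 Q1 R1 xi1)
    (sol2 : limit_solution taufin P2 Q2 R2 xi2)
    (P_init : forall x : R, P1 (0, x) = P2 (0, x))
    (xi_init : xi1 0 = xi2 0) :
  (forall z : R * R, Omega taufin z ->
     [/\ P1 z = P2 z, Q1 z = Q2 z & R1 z = R2 z]) /\
  (forall tau : R, timeI taufin tau -> xi1 tau = xi2 tau).
Proof.
have P_init' x : P2 (0, x) = P1 (0, x) by rewrite P_init.
have [L [M0 fp]] := front_pair_of_solutions taufin_gt0 sol1 sol2 P_init xi_init.
have [L' [M0' fp']] :=
  front_pair_of_solutions taufin_gt0 sol2 sol1 P_init' (esym xi_init).
pose W z := P1 z - P2 z.
(* The comparison needs both orders of the solutions at once, the reversed pair being written with
   the negated difference. It yields one-sided inequalities, and the exchange of roles turns them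
   into equalities. *)
have N1 : (fun z => P2 z - P1 z) = (fun z => - W z).
  by apply/funext => z; rewrite opprB.
have N2 : (fun z => P1 z - P2 z) = (fun z => - (P2 z - P1 z)).
  by apply/funext => z; rewrite opprB.
have G1 t (tT : 0 <= t <= taufin) : (forall x, P2 (t, x) <= P1 (t, x)) /\ xi2 t <= xi1 t.
  have fpN := fp'; rewrite N1 in fpN.
  have [Wge xge] := front_pair_ge taufin_gt0 fp fpN tT; split => // x.
  by rewrite -subr_ge0.
have G2 t (tT : 0 <= t <= taufin) : (forall x, P1 (t, x) <= P2 (t, x)) /\ xi1 t <= xi2 t.
  have fpN := fp; rewrite N2 in fpN.
  have [Wge xge] := front_pair_ge taufin_gt0 fp' fpN tT; split => // x.
  by rewrite -subr_ge0.
split=> [[t x] Oz|t]; last first.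
  by rewrite timeIE => tT; apply: le_anti; rewrite (G1 t tT).2 (G2 t tT).2.
have PE : P1 (t, x) = P2 (t, x).
  have tT := Oz; rewrite OmegaE in tT.
  by apply: le_anti; rewrite ((G1 t tT).1 x) ((G2 t tT).1 x).
have QE : Q1 (t, x) = Q2 (t, x).
  apply: le_anti; rewrite (heat_solution_le taufin_gt0 sol1 sol2 P_init Oz).
  exact: heat_solution_le taufin_gt0 sol2 sol1 P_init' _ Oz.
split => //; apply: (@addrI _ (Q1 (t, x))).
by rewrite -(P_decomp sol1 Oz) PE (P_decomp sol2 Oz) QE.
Qed.
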